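(* Let $M$ be an immersed connected orientable surface in $\mathbb R^3$ with canonical principal direction relative to a constant vector field. If $M$ has constant mean curvature, then $M$ is (part of) a Delaunay surface.
   Context: All objects are smooth. An orientable hypersurface $M$ with unit normal $\xi$ has a canonical principal direction relative to a vector field $X$ if $X^T=X-\langle X,\xi\rangle\xi$, which is assumed to be nowhere zero on $M$, is at each point an eigenvector of the shape operator of $M$. Delaunay surfaces are the surfaces of revolution in $\mathbb R^3$ with constant mean curvature (including, in particular, planes and right circular cylinders). *)

(* Defs.v *)
From HB Require Import structures.
From mathcomp Require Export all_boot all_order all_algebra.
From mathcomp Require Export all_classical all_reals all_analysis.
Import Order.TTheory GRing.Theory Num.Theory.
Import numFieldNormedType.Exports.

Set Implicit Arguments.
Unset Strict Implicit.
Unset Printing Implicit Defensive.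

Local Open Scope classical_set_scope.
Local Open Scope ring_scope.

(* f is of class C^k on U; meant for U open. *)
Fixpoint class_C (R : realType) (V W : normedModType R) (k : nat)
    (U : set V) (f : V -> W) : Prop :=
  match k with
  | 0 => forall x, U x -> {for x, continuous f}
  | k'.+1 => (forall x, U x -> differentiable f x) /\
             (forall v, class_C k' U ('D_v f))
  end.

Definition smooth_on (R : realType) (V W : normedModType R)
    (U : set V) (f : V -> W) : Prop := forall k, class_C k U f.

(* Euclidean inner product (the library norm on row vectors is the sup norm;
   it is used for the topology only). *)
Definition dot (R : realType) (n : nat) (u v : 'rV[R]_n) : R :=
  (u *m v^T) 0 0.

(* A homeomorphism from the open set [dom] of T onto the open subset
   [coord @` dom] of R^2, with inverse [param]; the values of [coord] outside
   [dom] and of [param] outside [coord @` dom] are irrelevant. *)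
Record chart (R : realType) (T : topologicalType) := Chart {
  dom : set T;
  coord : T -> 'rV[R]_2;
  param : 'rV[R]_2 -> T;
  dom_open : open dom;
  img_open : open (coord @` dom);
  coord_continuous : forall p, dom p -> {for p, continuous coord};
  param_continuous :
    forall y, (coord @` dom) y -> {for y, continuous param};
  coordK : forall p, dom p -> param (coord p) = p }.

(* Smooth 2-manifolds without boundary; the atlas need not be maximal, and
   connectedness is not built in. *)
Record smooth_surface (R : realType) := SmoothSurface {
  carrier :> topologicalType;
  carrier_hausdorff : hausdorff_space carrier;
  carrier_second_countable : @second_countable carrier;
  atlas : set (chart R carrier);
  atlas_cover : forall p : carrier, exists2 c, atlas c & dom c p;
  atlas_compat : forall c d, atlas c -> atlas d ->
    smooth_on (coord c @` (dom c `&` dom d)) (coord d \o param c) }.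

Definition smooth_to_vector (R : realType) (S : smooth_surface R) (n : nat)
    (f : S -> 'rV[R]_n) : Prop :=
  forall c, atlas c -> smooth_on (coord c @` dom c) (f \o param c).

Definition smooth_map (R : realType) (S T : smooth_surface R)
    (phi : S -> T) : Prop :=
  continuous phi /\
  forall c d, atlas c -> atlas d ->
    smooth_on (coord c @` (dom c `&` phi @^-1` dom d))
              (coord d \o phi \o param c).

(* Matrix of the differential of f at p in the chart c: row i is the i-th
   partial derivative (linear maps act on row vectors from the right). *)
Definition dmx (R : realType) (S : smooth_surface R) (n : nat)
    (f : S -> 'rV[R]_n) (c : chart R S) (p : S) : 'M[R]_(2, n) :=
  jacobian (f \o param c) (coord c p).

(* A surface immersed in R^3 and oriented by a unit normal field. *)
Record immersed_surface (R : realType) := ImmersedSurface {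
  source :> smooth_surface R;
  imm : source -> 'rV[R]_3;
  normal : source -> 'rV[R]_3;
  imm_smooth : smooth_to_vector imm;
  imm_immersion :
    forall c p, atlas c -> dom c p -> row_free (dmx imm c p);
  normal_smooth : smooth_to_vector normal;
  normal_unit : forall p, dot (normal p) (normal p) = 1;
  normal_orthogonal :
    forall c p, atlas c -> dom c p -> dmx imm c p *m (normal p)^T = 0 }.

(* Matrix, in the coordinate basis of c, of the shape operator - d(normal):
   as each row of [dmx normal c p] is tangent, this is the unique A such that
   [A *m dmx imm c p = - dmx normal c p]. *)
Definition shape_mx (R : realType) (S : immersed_surface R)
    (c : chart R S) (p : S) : 'M[R]_2 :=
  - dmx (@normal R S) c p *m pinvmx (dmx (@imm R S) c p).

Definition mean_curvature (R : realType) (S : immersed_surface R)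
    (c : chart R S) (p : S) : R := \tr (shape_mx c p) / 2.

Definition constant_mean_curvature (R : realType) (S : immersed_surface R)
    : Prop :=
  exists H : R,
    forall (c : chart R S) (p : S),
      atlas c -> dom c p -> mean_curvature c p = H.

Definition tangent_part (R : realType) (S : immersed_surface R)
    (X : 'rV[R]_3 -> 'rV[R]_3) (p : S) : 'rV[R]_3 :=
  X (imm p) - dot (X (imm p)) (normal p) *: normal p.

(* w is the coordinate vector, in the chart c, of the tangent part of X. *)
Definition canonical_principal_direction (R : realType)
    (S : immersed_surface R) (X : 'rV[R]_3 -> 'rV[R]_3) : Prop :=
  (forall p : S, tangent_part X p != 0) /\
  (forall (c : chart R S) (p : S), atlas c -> dom c p ->
     exists (w : 'rV[R]_2) (lambda : R),
       w *m dmx (@imm R S) c p = tangent_part X p /\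
       w *m shape_mx c p = lambda *: w).

(* The rows of Q are an orthonormal frame. The axis is the line through o
   directed by the last row, and gamma is a regular curve in the plane through
   o spanned by the first and the last rows. gamma may meet the axis, so that
   entire spheres and planes are surfaces of revolution. *)
Definition surface_of_revolution (R : realType) (S : immersed_surface R)
    : Prop :=
  exists (o : 'rV[R]_3) (Q : 'M[R]_3) (I : set R) (gamma : R -> 'rV[R]_2),
    [/\ Q *m Q^T = 1%:M,
        [/\ is_interval I, open I & I !=set0],
        smooth_on (I : set R^o) (gamma : R^o -> 'rV[R]_2),
        forall t, I t -> 'D_1 (gamma : R^o -> 'rV[R]_2) t != 0 &
        range (@imm R S) =
        [set q | exists t theta, I t /\
           q = o + (gamma t 0 0 * cos theta) *: row 0 Q
                 + (gamma t 0 0 * sin theta) *: row 1 Q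
                 + gamma t 0 1 *: row ord_max Q]].

Definition delaunay_surface (R : realType) (S : immersed_surface R) : Prop :=
  [/\ connected [set: S], surface_of_revolution S &
      constant_mean_curvature S].

(* The immersion of M factors through that of S. The factor phi is then a local
   diffeomorphism; it need not be injective, since M itself may, for instance,
   wrap several times around a cylinder. *)
Definition part_of (R : realType) (M S : immersed_surface R) : Prop :=
  exists phi : M -> S,
    smooth_map phi /\ forall p, imm p = imm (phi p).

(* Main.v *)
From HB Require Import structures.
Require Import Defs.
From mathcomp Require Import ring lra.
Import Order.TTheory GRing.Theory Num.Theory.
Import numFieldNormedType.Exports.
Set Implicit Arguments.
Unset Strict Implicit.
Unset Printing Implicit Defensive.
Local Open Scope classical_set_scope.
Local Open Scope ring_scope.

(** Fix an orthonormal frame whose last vector e is parallel to X. Let h be the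
height along e, nu the component of the unit normal n along e, (n0, n1) its
horizontal part and H the mean curvature. The hypothesis says that the tangent
part of e, which has squared length 1 - nu^2 > 0, is principal, with curvature
lambda say. As the shape operator is symmetric, d nu = - lambda dh, and the
horizontal tangent direction is principal too, with curvature mu = 2H - lambda
([first_order]). Equality of mixed second derivatives of nu, of the immersion
and of the normal gives d mu as well ([codazzi]):

  d nu = (mu - 2H) dh,     (1 - nu^2) d mu = 2 mu nu (H - mu) dh.

The second equation is linear in mu along curves, so mu vanishes everywhere or
nowhere ([transverse_curvature_zero_or]).

Suppose that mu has no zero. The centres (f0, f1) + (n0, n1) / mu of the
horizontal sections form a single point ([axis_constant]), so that M lies on a
surface of revolution about a vertical axis, at distance sqrt(1 - nu^2) / |mu|
from it. What remains is to see this distance as one function of the height,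
although the level sets of h on M may be disconnected. The equations above form
an autonomous differential equation for (mu, nu) as functions of h. Near each
point of M the state (mu, nu) is a solution of it evaluated at h
([local_profile_solution]); by uniqueness and connectedness all these solutions
are restrictions of one maximal solution, on an interval that contains every
height of M ([glue_solutions]). The curve that it describes is rotated about the
axis. The result has mean curvature H by the same equations ([revolution_cmc]),
and M maps to it by its height and its direction seen from the axis
([part_of_revolution]). It is parametrised by an annulus rather than by a strip
because M may wind around the axis.

Suppose that mu is zero. Then the direction of (n0, n1) is constant
([direction_constant]). If H = 0, the whole normal is constant and M is part of
a plane ([planar_case]). Otherwise the projection of f + n / (2H) along the
horizontal tangent direction is constant, and M is part of a circular cylinder
whose axis is orthogonal to X ([cylindrical_case]). *)

(** * Smooth functions *)

Section smoothness.
Context {R : realType}.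
Implicit Types V W : normedModType R.

(** Both properties depend on the germ of the function only; this is what makes
[class_C] insensitive to values outside an open set. *)
Lemma near_differentiable V W (f g : V -> W) x :
  (\near x, f x = g x) -> differentiable f x ->
  differentiable g x /\ 'd g x = 'd f x :> (V -> W).
Proof.
move=> fg df.
have fx : f x = g x by exact: (nbhs_singleton fg).
have gP : g \o shift x = cst (g x) + 'd f x +o_ 0 id.
  apply/eqaddoP => _/posnumP[e].
  have /eqaddoP/(_ e%:num (ltac:(by [])))H := diff_locally df.
  move: H; rewrite !near_simpl => H.
  have fg0 : \forall h \near (0 : V), f (h + x) = g (h + x).
    by move: fg; rewrite (near_shift 0) subr0.
  by apply: filterS2 H fg0 => h H1 e1; move: H1; rewrite !fctE /= e1 fx.
have dgf : 'd g x = 'd f x :> (V -> W) by apply: diff_unique gP; exact: diff_continuous.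
split=> //; apply/diff_locallyP; by rewrite dgf; split; [exact: diff_continuous|exact: gP].
Qed.

Lemma class_C_pred V W k (U : set V) (f : V -> W) :
  class_C k.+1 U f -> class_C k U f.
Proof.
elim: k f => [|k IH] f /= [df Df].
  by move=> x Ux; apply: differentiable_continuous; exact: df.
by split=> // v; apply: IH; exact: Df.
Qed.

Lemma smooth_differentiable V W (U : set V) (f : V -> W) x :
  smooth_on U f -> U x -> differentiable f x.
Proof. by move=> /(_ 1%N)[df _]; exact: df. Qed.

Lemma smooth_continuous V W (U : set V) (f : V -> W) x :
  smooth_on U f -> U x -> {for x, continuous f}.
Proof. by move=> /(_ 0%N) cf Ux; exact: cf. Qed.

Lemma smooth_derive V W (U : set V) (f : V -> W) v :
  smooth_on U f -> smooth_on U ('D_v f).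
Proof. by move=> sf k; have [_] := sf k.+1; exact. Qed.

Lemma class_C_ext V W k (U : set V) (f g : V -> W) : open U ->
  (forall x, U x -> f x = g x) -> class_C k U f -> class_C k U g.
Proof.
move=> oU; elim: k f g => [|k IH] f g fg.
  move=> cf x Ux; have nU : \forall y \near x, U y by exact: open_nbhs_nbhs.
  rewrite /prop_for /continuous_at -fg//.
  apply: cvg_trans (cf x Ux); apply: near_eq_cvg.
  by apply: filterS nU => y /fg ->.
case=> df Df; split=> [x Ux|v].
  have nU : \forall y \near x, U y by exact: open_nbhs_nbhs.
  have [|//] := @near_differentiable _ _ f g x _ (df _ Ux).
  by apply: filterS nU => y /fg ->.
apply: IH (Df v) => x Ux; apply: near_eq_derive.
have nU : \forall y \near x, U y by exact: open_nbhs_nbhs.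
by apply: filterS nU => y /fg ->.
Qed.

Lemma smooth_ext V W (U : set V) (f g : V -> W) : open U ->
  (forall x, U x -> f x = g x) -> smooth_on U f -> smooth_on U g.
Proof. by move=> oU fg sf k; apply: class_C_ext (sf k). Qed.

(** The induction step of the closure properties below: each directional
derivative is compared on [U] with an expression of known regularity. *)
Lemma class_C_succ V W k (U : set V) (f : V -> W) : open U ->
  (forall x, U x -> differentiable f x) ->
  (forall v, exists2 g, class_C k U g & forall x, U x -> 'D_v f x = g x) ->
  class_C k.+1 U f.
Proof.
move=> oU df Df; split=> // v; have [g Cg e] := Df v.
by apply: class_C_ext Cg => // x Ux; rewrite e.
Qed.

Lemma class_C_cst V W k (U : set V) (c : W) : class_C k U (cst c).
Proof.
elim: k c => [|k IH] c; first by move=> x _; exact: cst_continuous.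
split=> [x _|v]; first exact: differentiable_cst.
suff -> : 'D_v (cst c : V -> W) = cst 0 by [].
by apply/funext => x; rewrite derive_cst.
Qed.

Lemma class_CD V W k (U : set V) (f g : V -> W) : open U ->
  class_C k U f -> class_C k U g -> class_C k U (f + g).
Proof.
move=> oU; elim: k f g => [|k IH] f g.
  by move=> cf cg x Ux; exact: (continuousD (cf x Ux) (cg x Ux)).
move=> [df Df] [dg Dg]; apply: (class_C_succ oU).
  by move=> x Ux; exact: (differentiableD (df _ Ux) (dg _ Ux)).
move=> v; exists ('D_v f + 'D_v g); first exact: (IH _ _ (Df v) (Dg v)).
move=> x Ux; rewrite deriveD //.
- exact/diff_derivable/df.
exact/diff_derivable/dg.
Qed.

Lemma class_C_id V k (U : set V) : open U -> class_C k U (@id V).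
Proof.
move=> oU; case: k => [|k]; first by move=> x _; exact: cvg_id.
apply: (class_C_succ oU) => [//|v]; exists (cst v); first exact: class_C_cst.
by move=> x _; rewrite derive_id.
Qed.

Lemma class_CM V k (U : set V) (f g : V -> R^o) : open U ->
  class_C k U f -> class_C k U g -> class_C k U (fun x => f x * g x : R^o).
Proof.
move=> oU; elim: k f g => [|k IH] f g.
  by move=> cf cg x Ux; exact: (@continuousM R _ _ _ _ (cf x Ux) (cg x Ux)).
move=> Cf Cg; case: (Cf) => df Df; case: (Cg) => dg Dg; apply: (class_C_succ oU).
  by move=> x Ux; exact: (differentiableM (df _ Ux) (dg _ Ux)).
move=> v; exists ((fun x => f x * 'D_v g x : R^o) + (fun x => g x * 'D_v f x : R^o)).
  exact: (class_CD oU (IH _ _ (class_C_pred Cf) (Dg v)) (IH _ _ (class_C_pred Cg) (Df v))).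
move=> x Ux; rewrite deriveM //.
- exact/diff_derivable/df.
exact/diff_derivable/dg.
Qed.

Lemma class_CZl V W k (U : set V) (f : V -> R^o) (w : W) : open U ->
  class_C k U f -> class_C k U (fun x => f x *: w).
Proof.
move=> oU; elim: k f => [|k IH] f.
  by move=> cf x Ux; apply: continuousZr_tmp; exact: cf.
move=> [df Df]; apply: (class_C_succ oU).
  by move=> x Ux; apply: differentiableZl; exact: df.
move=> v; exists (fun x => 'D_v f x *: w); first exact: (IH _ (Df v)).
move=> x Ux; have dfx := df _ Ux; rewrite deriveE; last exact: differentiableZl.
by rewrite diffZl // deriveE.
Qed.

Lemma derive_comp V (g : R -> R) (f : V -> R^o) x v dg :
  differentiable f x -> is_derive (f x) (1 : R) g dg ->
  differentiable ((g : R^o -> R^o) \o f) x /\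
  'D_v ((g : R^o -> R^o) \o f) x = 'D_v f x * dg.
Proof.
move=> df [gd <-].
have dgx : differentiable (g : R^o -> R^o) (f x) by exact/derivable1_diffP.
have dgf : differentiable ((g : R^o -> R^o) \o f) x by exact: differentiable_comp.
split=> //.
rewrite (deriveE _ dgf) (deriveE _ df) (diff_comp df dgx) /= (diff1E dgx).
by rewrite derive1E.
Qed.

Lemma class_C_comp V k (U : set V) (J : set R^o) (g : R^o -> R^o) (f : V -> R^o) :
  open U -> (forall x, U x -> J (f x)) ->
  class_C k J g -> class_C k U f -> class_C k U (g \o f).
Proof.
move=> oU; elim: k f g => [|k IH] f g fJ.
  by move=> cg cf x Ux; exact: (continuous_comp (cf x Ux) (cg _ (fJ _ Ux))).
move=> Cg Cf; case: (Cf) => df Df; case: (Cg) => dg Dg; apply: (class_C_succ oU).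
  by move=> x Ux; apply: differentiable_comp; [exact: df|exact/dg/fJ].
move=> v; exists (fun x => 'D_v f x * ('D_1 g \o f) x).
  exact: (class_CM oU (Df v) (IH _ _ fJ (Dg 1) (class_C_pred Cf))).
move=> x Ux; have dgx : is_derive (f x) (1 : R) (g : R -> R) ('D_1 g (f x)).
  by apply: derivableP; apply/derivable1_diffP; exact/dg/fJ.
by have [_ ->] := derive_comp v (df _ Ux) dgx.
Qed.

End smoothness.

Section smooth_closure.
Context {R : realType}.
Implicit Types V W : normedModType R.

Section elementary.
Context {V : normedModType R} (U : set V) (oU : open U).
Implicit Types f g : V -> R^o.

(** Induction works because the derivative of 1/f is D_v f times a power of 1/f;
the exponential and the square root behave likewise. *)
Lemma class_CV k f : (forall x, U x -> f x != 0) ->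
  class_C k U f -> class_C k U (fun x => (f x)^-1 : R^o).
Proof.
move=> f0; elim: k => [|k IH] Cf.
  by move=> x Ux; apply: (@continuousV R _ f x (f0 _ Ux) (Cf x Ux)).
case: (Cf) => df Df; apply: (class_C_succ oU).
  by move=> x Ux; exact: (differentiableV (df _ Ux) (f0 _ Ux)).
move=> v; exists (fun x => 'D_v f x * ((-1) * ((f x)^-1 * (f x)^-1)) : R^o).
  apply: class_CM => //; first exact: Df.
  have CV := IH (class_C_pred Cf).
  by apply: class_CM => //; [exact: class_C_cst|exact: class_CM].
move=> x Ux; rewrite deriveV //; last exact/diff_derivable/df.
  by rewrite /GRing.scale /=; have f0x := f0 _ Ux; field.
exact: f0.
Qed.

Lemma class_C_expR k f : class_C k U f -> class_C k U (fun x => expR (f x) : R^o).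
Proof.
elim: k => [|k IH] Cf.
  move=> x Ux; exact: (continuous_comp (Cf x Ux) (@continuous_expR R _)).
case: (Cf) => df Df; apply: (class_C_succ oU).
  by move=> x Ux; have [] := derive_comp 0 (df _ Ux) (is_derive_expR (f x)).
move=> v; exists (fun x => 'D_v f x * expR (f x) : R^o).
  by apply: class_CM => //; [exact: Df|exact/IH/class_C_pred].
by move=> x Ux; have [] := derive_comp v (df _ Ux) (is_derive_expR (f x)).
Qed.

Lemma class_C_ln k f : (forall x, U x -> 0 < f x) ->
  class_C k U f -> class_C k U (fun x => ln (f x) : R^o).
Proof.
move=> f0; case: k => [|k] Cf.
  move=> x Ux; exact: (continuous_comp (Cf x Ux) (continuous_ln (f0 _ Ux))).
case: (Cf) => df Df; apply: (class_C_succ oU).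
  by move=> x Ux; have [] := derive_comp 0 (df _ Ux) (is_derive1_ln (f0 _ Ux)).
move=> v; exists (fun x => 'D_v f x * (f x)^-1 : R^o).
  apply: class_CM => //; first exact: Df.
  by apply: class_CV; [move=> x /f0 /lt0r_neq0|exact: class_C_pred].
by move=> x Ux; have [] := derive_comp v (df _ Ux) (is_derive1_ln (f0 _ Ux)).
Qed.

Lemma class_C_sqrt k f : (forall x, U x -> 0 < f x) ->
  class_C k U f -> class_C k U (fun x => Num.sqrt (f x) : R^o).
Proof.
move=> f0; elim: k => [|k IH] Cf.
  move=> x Ux; exact: (continuous_comp (Cf x Ux) (@sqrt_continuous R _)).
case: (Cf) => df Df; apply: (class_C_succ oU).
  by move=> x Ux; have [] := derive_comp 0 (df _ Ux) (is_derive1_sqrt (f0 _ Ux)).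
move=> v; exists (fun x => 'D_v f x * (2 * Num.sqrt (f x))^-1 : R^o).
  apply: class_CM => //; first exact: Df.
  apply: class_CV; first by move=> x /f0 f0x; rewrite mulf_neq0 // gt_eqF ?sqrtr_gt0.
  apply: class_CM => //; first exact: class_C_cst.
  exact/IH/class_C_pred.
by move=> x Ux; have [] := derive_comp v (df _ Ux) (is_derive1_sqrt (f0 _ Ux)).
Qed.

Lemma class_C_row k n (f : V -> 'rV[R]_n.+1) :
  (forall i, class_C k U (fun x => f x 0 i : R^o)) -> class_C k U f.
Proof.
move=> Cf.
have -> : f = \sum_i (fun x => f x 0 i *: delta_mx 0 i).
  by apply/funext => x; rewrite fct_sumE -row_sum_delta.
elim/big_rec: _ => [|i g _ Cg]; first exact: class_C_cst.
by apply: class_CD => //; apply: class_CZl => //; exact: Cf.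
Qed.

Lemma class_C_coord k n (f : V -> 'rV[R]_n.+1) i :
  class_C k U f -> class_C k U (fun x => f x 0 i : R^o).
Proof.
elim: k f => [|k IH] f Cf.
  by move=> x Ux; exact: (continuous_comp (Cf x Ux) (@matrix_normedtype.coord_continuous _ _ _ 0 i _)).
case: (Cf) => df Df; apply: (class_C_succ oU).
  by move=> x Ux; exact: (differentiable_comp (df _ Ux) (differentiable_coord _ 0 i)).
move=> v; exists (fun x => 'D_v f x 0 i); first exact: (IH _ (Df v)).
by move=> x Ux; rewrite derive_mx ?mxE //; exact/diff_derivable/df.
Qed.

Lemma smooth_cst W (c : W) : smooth_on U (cst c).
Proof. by move=> k; exact: class_C_cst. Qed.
Lemma smoothD W (f g : V -> W) : smooth_on U f -> smooth_on U g -> smooth_on U (fun x => f x + g x).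
Proof. by move=> sf sg k; exact: (class_CD oU (sf k) (sg k)). Qed.
Lemma smoothM f g : smooth_on U f -> smooth_on U g -> smooth_on U (fun x => f x * g x : R^o).
Proof. by move=> sf sg k; exact: class_CM. Qed.
Lemma smoothZ f c : smooth_on U f -> smooth_on U (fun x => c * f x : R^o).
Proof. by move=> sf; apply: smoothM => //; exact: smooth_cst. Qed.
Lemma smoothN f : smooth_on U f -> smooth_on U (fun x => - f x : R^o).
Proof.
move=> /(smoothZ (-1)) sf.
by apply: smooth_ext sf => // x _; rewrite mulN1r.
Qed.
Lemma smoothB f g : smooth_on U f -> smooth_on U g -> smooth_on U (fun x => f x - g x : R^o).
Proof. by move=> sf /smoothN sg; exact: smoothD. Qed.
Lemma smoothZl W f (w : W) : smooth_on U f -> smooth_on U (fun x => f x *: w).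
Proof. by move=> sf k; exact: class_CZl. Qed.
Lemma smoothV f : (forall x, U x -> f x != 0) -> smooth_on U f ->
  smooth_on U (fun x => (f x)^-1 : R^o).
Proof. by move=> f0 sf k; exact: class_CV. Qed.
Lemma smooth_id : smooth_on U (@id V).
Proof. by move=> k; exact: class_C_id. Qed.
Lemma smooth_expR f : smooth_on U f -> smooth_on U (fun x => expR (f x) : R^o).
Proof. by move=> sf k; exact: class_C_expR. Qed.
Lemma smooth_ln f : (forall x, U x -> 0 < f x) -> smooth_on U f ->
  smooth_on U (fun x => ln (f x) : R^o).
Proof. by move=> f0 sf k; exact: class_C_ln. Qed.
Lemma smooth_sqrt f : (forall x, U x -> 0 < f x) -> smooth_on U f ->
  smooth_on U (fun x => Num.sqrt (f x) : R^o).
Proof. by move=> f0 sf k; exact: class_C_sqrt. Qed.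
Lemma smooth_comp (J : set R^o) (g : R^o -> R^o) f :
  (forall x, U x -> J (f x)) -> smooth_on J g -> smooth_on U f ->
  smooth_on U (fun x => g (f x)).
Proof. by move=> fJ sg sf k; exact: (class_C_comp oU fJ (sg k) (sf k)). Qed.
Lemma smooth_row n (f : V -> 'rV[R]_n.+1) :
  (forall i, smooth_on U (fun x => f x 0 i : R^o)) -> smooth_on U f.
Proof. by move=> sf k; apply: class_C_row => i; exact: sf. Qed.
Lemma smooth_coord n (f : V -> 'rV[R]_n.+1) i :
  smooth_on U f -> smooth_on U (fun x => f x 0 i : R^o).
Proof. by move=> sf k; exact: class_C_coord. Qed.
End elementary.

Lemma derive_coord V n (f : V -> 'rV[R]_n.+1) x v i : differentiable f x ->
  'D_v (fun y => f y 0 i : R^o) x = ('D_v f x) 0 i.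
Proof. by move=> df; rewrite derive_mx ?mxE //; exact: diff_derivable. Qed.

Lemma is_derive_line V W (g : V -> W) (a y : V) (s : R^o) :
  differentiable g (s *: a + y) ->
  is_derive s 1 (fun t : R^o => g (t *: a + y)) ('D_a g (s *: a + y)).
Proof.
move=> dg.
have dl : is_diff s (fun t : R^o => t *: a + y) ( *:%R ^~ a).
  by apply: is_diff_eq; rewrite addr0.
have dgl : is_diff s (g \o (fun t : R^o => t *: a + y)) ('d g (s *: a + y) \o ( *:%R ^~ a)).
  by apply: is_diff_comp => //; exact: differentiableP.
apply: DeriveDef; first by apply: diff_derivable; exact: (@ex_diff _ _ _ _ _ _ _ dgl).
rewrite deriveE; last exact: (@ex_diff _ _ _ _ _ _ _ dgl).
by rewrite (@diff_val _ _ _ _ _ _ _ dgl) /= scale1r deriveE.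
Qed.

Lemma line_MVT V (g : V -> R^o) (a y : V) (t : R) : 0 < t ->
  (forall s, 0 <= s <= t -> differentiable g (s *: a + y)) ->
  exists2 s, 0 <= s <= t & g (t *: a + y) - g y = t * 'D_a g (s *: a + y).
Proof.
move=> t0 dg.
pose p := fun s : R^o => g (s *: a + y).
have dp (s : R) : 0 <= s <= t -> is_derive s 1 p ('D_a g (s *: a + y)).
  by move=> st; apply: is_derive_line; exact: dg.
have [||s] := @MVT R p (fun s => 'D_a g (s *: a + y)) 0 t t0.
- by move=> s; rewrite in_itv /= => /andP[/ltW ? /ltW ?]; apply: dp; apply/andP.
- apply: derivable_within_continuous => s; rewrite in_itv /= => st.
  by have [] := dp s st.
rewrite in_itv /= => /andP[/ltW s0 /ltW st].
rewrite /p scale0r add0r subr0 mulrC => e.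
by exists s => //; apply/andP.
Qed.

End smooth_closure.

(** * Symmetry of second derivatives and linear systems *)

Section second_derivatives.
Context {R : realType}.
Implicit Types V W : normedModType R.

Lemma MVT_from_zero (p dp : R -> R) (t : R) : 0 < t ->
  (forall s, 0 <= s <= t -> is_derive s (1 : R) p (dp s)) ->
  exists2 s, 0 <= s <= t & p t - p 0 = t * dp s.
Proof.
move=> t0 dpE.
have [||s] := @MVT R p dp 0 t t0.
- by move=> s; rewrite in_itv /= => /andP[/ltW ? /ltW ?]; apply: dpE; apply/andP.
- apply: derivable_within_continuous => s; rewrite in_itv /= => st.
  by have [] := dpE s st.
rewrite in_itv /= subr0 mulrC => /andP[/ltW s0 /ltW st] e.
by exists s => //; apply/andP.
Qed.

(** The mean value theorem, once in each direction. The left-hand side is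
symmetric in [a] and [b] up to the order of its terms, which gives [derive_sym]. *)
Lemma second_difference V (U : set V) (g : V -> R^o) (x a b : V) (t : R) :
  0 < t -> class_C 2 U g ->
  (forall s r, 0 <= s <= t -> 0 <= r <= t -> U (s *: a + (r *: b + x))) ->
  exists s r, [/\ 0 <= s <= t, 0 <= r <= t &
    g (t *: a + (t *: b + x)) - g (t *: a + x) - g (t *: b + x) + g x =
    t * (t * 'D_b ('D_a g) (s *: a + (r *: b + x)))].
Proof.
move=> t0 [dg Dg] Uab; have [dDg _] := Dg a.
have t00 : (0 : R) <= 0 <= t by apply/andP; split=> [|]; [exact: lexx|exact: ltW].
have tt : 0 <= t <= t by apply/andP; split; [exact: ltW|exact: lexx].
have Ua s : 0 <= s <= t -> U (s *: a + x).
  by move=> st; have := Uab s 0 st t00; rewrite scale0r add0r.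
have [|s st e] := @MVT_from_zero (fun s => g (s *: a + (t *: b + x)) - g (s *: a + x))
  (fun s => 'D_a g (s *: a + (t *: b + x)) - 'D_a g (s *: a + x)) t t0.
  move=> s st; apply: is_deriveB.
    by apply: is_derive_line; apply: dg; exact: Uab.
  by apply: is_derive_line; apply: dg; exact: Ua.
have [|r rt e2] := @line_MVT R V ('D_a g) b (s *: a + x) t t0.
  by move=> r rt; apply: dDg; rewrite addrCA; exact: Uab.
exists s, r; split => //.
rewrite [s *: a + (r *: b + x)]addrCA -e2 [t *: b + (s *: a + x)]addrCA -e.
by rewrite !scale0r !add0r; ring.
Qed.

Lemma second_difference_eq (t g1 g2 g3 g4 P Q : R) : t != 0 ->
  g1 - g2 - g3 + g4 = t * (t * P) -> g1 - g3 - g2 + g4 = t * (t * Q) -> P = Q.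
Proof.
by move=> tn0 h1 h2; apply: (mulfI tn0); apply: (mulfI tn0); rewrite -h1 -h2; ring.
Qed.

Lemma dist_le_half (e P Q S : R) :
  `|P - S| < e / 2 -> `|Q - S| < e / 2 -> `|P - Q| <= e.
Proof.
rewrite !ltr_norml => /andP[? ?] /andP[? ?].
by rewrite ler_norml; apply/andP; split; lra.
Qed.

(** On arbitrarily small squares, both mixed derivatives take the value of the
same second difference quotient; they are continuous. *)
Lemma derive_sym V (U : set V) (g : V -> R^o) (x a b : V) :
  open U -> class_C 2 U g -> U x ->
  'D_a ('D_b g) x = 'D_b ('D_a g) x.
Proof.
move=> oU Cg Ux.
have Cab c d : {for x, continuous ('D_c ('D_d g))}.
  by case: (Cg) => _ /(_ d)[_ /(_ c)]; exact.
apply/eqP; rewrite -subr_eq0 -normr_le0; apply/ler_addgt0Pr => e e0.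
have e20 : 0 < e / 2 by rewrite divr_gt0.
have nU : \forall y \near x, [/\ U y, `|'D_a ('D_b g) x - 'D_a ('D_b g) y| < e / 2
   & `|'D_b ('D_a g) x - 'D_b ('D_a g) y| < e / 2].
  have h1 : \forall y \near x, `|'D_a ('D_b g) x - 'D_a ('D_b g) y| < e / 2.
    by move/cvgrPdist_lt: (Cab a b) => /(_ _ e20).
  have h2 : \forall y \near x, `|'D_b ('D_a g) x - 'D_b ('D_a g) y| < e / 2.
    by move/cvgrPdist_lt: (Cab b a) => /(_ _ e20).
  have h3 : \forall y \near x, U y by exact: open_nbhs_nbhs.
  by apply: filterS3 h3 h1 h2.
have [d d0 Hd] := (nbhs_ballP _ _).1 nU.
(* the square with side t spanned by a and b stays in the ball of radius d *)
pose t := d / (1 + `|a| + `|b|).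
have n0 : 0 < 1 + `|a| + `|b| by have := normr_ge0 a; have := normr_ge0 b; lra.
have t0 : 0 < t by rewrite divr_gt0.
have inb s r : 0 <= s <= t -> 0 <= r <= t -> ball x d (s *: a + (r *: b + x)).
  move=> /andP[s0 st] /andP[r0 rt]; rewrite -ball_normE /= addrA.
  rewrite opprD addrCA subrr addr0 normrN (le_lt_trans (ler_normD _ _)) // !normrZ !ger0_norm //.
  apply: (@le_lt_trans _ _ (t * (`|a| + `|b|))).
    by rewrite mulrDr lerD // ler_wpM2r.
  by rewrite /t -mulrA gtr_pMr // ltr_pdivrMl // mulr1 -addrA ltrDr.
have inb' s r : 0 <= s <= t -> 0 <= r <= t -> ball x d (s *: b + (r *: a + x)).
  by move=> st rt; rewrite addrCA; exact: inb.
have [s [r [st rt e1]]] := second_difference t0 Cg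
  (fun s r st rt => let: And3 h _ _ := Hd _ (inb s r st rt) in h).
have [s' [r' [st' rt' e2]]] := second_difference t0 Cg
  (fun s r st rt => let: And3 h _ _ := Hd _ (inb' s r st rt) in h).
rewrite [t *: b + (t *: a + x)]addrCA in e2.
have [_ _ h1] := Hd _ (inb _ _ st rt).
have [_ h2 _] := Hd _ (inb' _ _ st' rt').
rewrite (second_difference_eq (lt0r_neq0 t0) e1 e2) in h1.
rewrite add0r; exact: (dist_le_half h2 h1).
Qed.

(** The left-hand side is the derivative of x^2 + y^2 along the system of
[linear_system_zero]. *)
Lemma quadratic_bound (x y a b c d k : R) : `|a| + `|b| + `|c| + `|d| <= k ->
  2 * x * (a * x + b * y) + 2 * y * (c * x + d * y) <= 2 * k * (x ^+ 2 + y ^+ 2).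
Proof.
move=> ck.
have lin (u : R) : - `|u| <= u <= `|u| by rewrite -ler_norml lexx.
have cross (u : R) : 2 * u * (x * y) <= `|u| * (x ^+ 2 + y ^+ 2).
  have /andP[u1 u2] := lin u.
  have h1 : 0 <= (`|u| + u) * (x - y) ^+ 2 by rewrite mulr_ge0 ?sqr_ge0 //; lra.
  have h2 : 0 <= (`|u| - u) * (x + y) ^+ 2 by rewrite mulr_ge0 ?sqr_ge0 //; lra.
  by lra.
have sq (u v : R) : 2 * u * v ^+ 2 <= 2 * (`|u| * v ^+ 2).
  by rewrite -mulrA ler_pM2l // ler_wpM2r ?sqr_ge0 // ler_norm.
have h1 := sq a x; have h2 := sq d y; have h3 := cross b; have h4 := cross c.
have h5 : 0 <= (k - (`|a| + `|b| + `|c| + `|d|)) * (x ^+ 2 + y ^+ 2).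
  by apply: mulr_ge0; [rewrite subr_ge0|rewrite addr_ge0 ?sqr_ge0].
have h6 : 0 <= `|a| * y ^+ 2 by rewrite mulr_ge0 ?sqr_ge0.
have h7 : 0 <= `|d| * x ^+ 2 by rewrite mulr_ge0 ?sqr_ge0.
have h8 : 0 <= `|b| * (x ^+ 2 + y ^+ 2) by rewrite mulr_ge0 ?addr_ge0 ?sqr_ge0.
have h9 : 0 <= `|c| * (x ^+ 2 + y ^+ 2) by rewrite mulr_ge0 ?addr_ge0 ?sqr_ge0.
by lra.
Qed.

(** If k bounds the coefficients, exp (- 2kt) (x^2 + y^2) does not increase, is
nonnegative and starts at 0. *)
Lemma linear_system_zero (x y a b c d : R -> R) (t : R) : 0 < t ->
  (forall s, 0 <= s <= t -> {for s, continuous a}) ->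
  (forall s, 0 <= s <= t -> {for s, continuous b}) ->
  (forall s, 0 <= s <= t -> {for s, continuous c}) ->
  (forall s, 0 <= s <= t -> {for s, continuous d}) ->
  (forall s, 0 <= s <= t -> is_derive s (1 : R) x (a s * x s + b s * y s)) ->
  (forall s, 0 <= s <= t -> is_derive s (1 : R) y (c s * x s + d s * y s)) ->
  x 0 = 0 -> y 0 = 0 -> x t = 0 /\ y t = 0.
Proof.
move=> t0 ca cb cc cd dx dy x0 y0.
pose C s := `|a s| + `|b s| + `|c s| + `|d s|.
have [|m mt Cm] := @EVT_max R C 0 t (ltW t0).
  apply: continuous_in_subspaceT => s; rewrite inE /= in_itv /= => st.
  have n f : {for s, continuous f} -> {for s, continuous (fun u => `|f u : R|)}.
    by move=> cf; exact: (@cvg_norm _ _ _ _ _ _ _ cf).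
  rewrite /C; apply: (@cvgD _ R^o); last exact/n/cd.
  apply: (@cvgD _ R^o); last exact/n/cc.
  by apply: (@cvgD _ R^o); [exact/n/ca|exact/n/cb].
set K := 2 * C m in Cm *.
pose D s := x s ^+ 2 + y s ^+ 2.
pose E s := expR (- K * s) * D s.
have dE s : 0 <= s <= t -> is_derive s (1 : R) E
  (expR (- K * s) * (2 * x s * (a s * x s + b s * y s) + 2 * y s * (c s * x s + d s * y s) - K * D s)).
  move=> st; have dxs := dx s st; have dys := dy s st.
  have de : is_derive s (1 : R) (fun u : R => expR (- K * u)) (expR (- K * s) * (- K)).
    apply: (@is_derive1_comp _ expR (fun u => - K * u)).
    have := is_deriveZ (- K) (is_derive_id s (1 : R)).
    by rewrite /GRing.scale /= mulr1.
  have dD := is_deriveD (is_deriveM dxs dxs) (is_deriveM dys dys).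
  have -> : E = (fun u : R => expR (- K * u)) * (x * x + y * y).
    by apply/funext => u; rewrite /E /D !fctE !expr2.
  apply: is_derive_eq (is_deriveM de dD) _.
  by rewrite /D /GRing.scale /= !fctE; ring.
have E0 : E t <= E 0.
  have [s st e] := MVT_from_zero t0 dE.
  have := Cm s; rewrite in_itv /= => /(_ st) Cs.
  rewrite -subr_le0 e pmulr_rle0 // pmulr_rle0 ?expR_gt0 // subr_le0.
  exact: quadratic_bound.
have : D t <= 0.
  move: E0; rewrite /E {2}/D x0 y0 expr0n /= addr0 mulr0.
  by rewrite pmulr_rle0 // expR_gt0.
rewrite /D => D0.
have := sqr_ge0 (x t); have := sqr_ge0 (y t) => hy hx.
by split; apply/eqP; rewrite -sqrf_eq0 eq_le; apply/andP; split => //; lra.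
Qed.

End second_derivatives.

(** * Gluing solutions along a connected space *)

(** The set where [P] holds is open, and so is its complement. *)
Lemma connected_locally_constant (T : topologicalType) (P : T -> Prop) (p0 : T) :
  connected [set: T] -> (forall p : T, \forall q \near p, P q <-> P p) ->
  P p0 -> forall p, P p.
Proof.
move=> cT locP Pp0 p.
have oP (Q : T -> Prop) : (forall p : T, \forall q \near p, Q q <-> Q p) -> open [set q | Q q].
  move=> locQ; rewrite openE => q /= Qq; rewrite /interior.
  by apply: filterS (locQ q) => r [_]; exact.
have := cT [set q | P q].
rewrite eqEsubset => /(_ _ _ _)[|||_]; last by apply.
- by exists p0.
- by exists [set q | P q]; [exact: oP|rewrite setTI].
- exists [set q | P q]; last by rewrite setTI.
  rewrite -openC; apply: (oP (fun q => ~ P q)) => q.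
  by apply: filterS (locP q) => r [h1 h2]; split => h h3; apply: h; auto.
Qed.

Section gluing.
Context {R : realType} {Y : Type} (sol_at : (R -> Y) -> R -> Prop).

Definition solution (I : set R) (y : R -> Y) :=
  [/\ open I, is_interval I & forall t, I t -> sol_at y t].

Hypothesis sol_near : forall (y z : R -> Y) (t : R),
  (\forall s \near t, y s = z s) -> sol_at y t -> sol_at z t.
Hypothesis sol_unique : forall I J y z s t, solution I y -> solution J z ->
  I s -> J s -> y s = z s -> I t -> J t -> y t = z t.

Lemma is_intervalU (I J : set R) t : is_interval I -> is_interval J -> I t -> J t ->
  is_interval (I `|` J).
Proof.
move=> iI iJ It Jt.
have key (K L : set R) x y : is_interval K -> is_interval L -> K t -> L t -> K x -> L y ->
    forall z, x < z < y -> (K `|` L) z.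
  move=> iK iL Kt Lt Kx Ly z /andP[xz zy].
  have [zt|tz] := leP z t; first by left; apply: (iK x t) => //; rewrite (ltW xz).
  by right; apply: (iL t y) => //; rewrite !ltW.
move=> x y [Ix|Jx] [Iy|Jy] z /andP[].
- by move=> xz zy; left; apply: (iI x y) => //; rewrite xz.
- rewrite !le_eqVlt => /orP[/eqP<- _|xz]; first by left.
  by move=> /orP[/eqP->|zy]; [right|apply: (key I J x y) => //; rewrite xz].
- rewrite !le_eqVlt => /orP[/eqP<- _|xz]; first by right.
  by move=> /orP[/eqP->|zy]; [left|rewrite setUC; apply: (key J I x y) => //; rewrite xz].
- by move=> xz zy; right; apply: (iJ x y) => //; rewrite xz.
Qed.

(** Uniqueness makes the two solutions agree on the whole overlap, so that they can
be patched. *)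
Lemma solutionU I J y z s : solution I y -> solution J z -> I s -> J s -> y s = z s ->
  exists w, [/\ solution (I `|` J) w, forall t, I t -> w t = y t & forall t, J t -> w t = z t].
Proof.
move=> SI SJ Is Js ys; case: (SI) => oI iI yI; case: (SJ) => oJ iJ zJ.
pose w t := if pselect (I t) then y t else z t.
have wI t : I t -> w t = y t by rewrite /w; case: pselect.
have wJ t : J t -> w t = z t.
  by move=> Jt; rewrite /w; case: pselect => // It; exact: (sol_unique SI SJ Is Js ys).
exists w; split=> //; split; [exact: openU|exact: (is_intervalU iI iJ Is Js)|].
move=> t [It|Jt].
  apply: (@sol_near y) (yI t It).
  by apply: filterS (open_nbhs_nbhs (conj oI It)) => r /wI.
apply: (@sol_near z) (zJ t Jt).
by apply: filterS (open_nbhs_nbhs (conj oJ Jt)) => r /wJ.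
Qed.

(** The solutions through the state of [p0] are restrictions of a maximal one. The
points of [M] whose state lies on it form an open and closed set: a local
solution that meets the maximal one extends it, hence is part of it. *)
Lemma glue_solutions (M : topologicalType) (h : M -> R) (y : M -> Y) (p0 : M) :
  connected [set: M] ->
  (forall p : M, exists I z, solution I z /\
     \forall q \near p, I (h q) /\ z (h q) = y q) ->
  exists I z, [/\ solution I z, I (h p0) & forall q, I (h q) /\ z (h q) = y q].
Proof.
move=> cM loc.
pose F I z := [/\ solution I z, I (h p0) & z (h p0) = y p0].
pose Imax := [set t | exists I z, F I z /\ I t].
(* Pz t v: some solution through the state of p0 takes the value v at t *)
pose Pz t v := exists I z, [/\ F I z, I t & z t = v].
pose zmax t := if pselect (exists v, Pz t v) is left e then sval (cid e) else y p0.
have zmaxE I z t : F I z -> I t -> zmax t = z t.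
  move=> FI It; rewrite /zmax; case: pselect => [e|nz]; last first.
    by exfalso; apply: nz; exists (z t), I, z.
  case: cid => v /= [J [z' [[SJ J0 z'0] Jt <-]]]; case: FI => SI I0 z0.
  by apply: (sol_unique SJ SI J0 I0) => //; rewrite z'0 z0.
have Smax : solution Imax zmax.
  split.
  - rewrite openE => t [I [z [FI It]]]; rewrite /interior.
    have [[oI _ _] _ _] := FI.
    by apply: filterS (open_nbhs_nbhs (conj oI It)) => r Ir; exists I, z.
  - move=> a b [I [z [FI Ia]]] [J [z' [FJ Jb]]] c cab.
    have [[_ iI _] I0 _] := FI; have [[_ iJ _] J0 _] := FJ.
    have [|] := is_intervalU iI iJ I0 J0 (or_introl Ia) (or_intror Jb) cab.
      by move=> Ic; exists I, z.
    by move=> Jc; exists J, z'.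
  - move=> t [I [z [FI It]]]; have [[oI _ zI] _ _] := FI.
    apply: (@sol_near z) (zI t It).
    by apply: filterS (open_nbhs_nbhs (conj oI It)) => r Ir; rewrite (zmaxE I z).
have [I0 [z0 [[oI0 iI0 zI0] /nbhs_singleton[I0p z0p]]]] := loc p0.
have F0 : F I0 z0 by [].
have max0 : Imax (h p0) by exists I0, z0.
have zmax0 : zmax (h p0) = y p0 by rewrite (zmaxE _ _ _ F0).
exists Imax, zmax; split => //.
apply: (@connected_locally_constant _ _ p0 cM) => // p.
have [J [z [SJ nJ]]] := loc p.
suff key q q' : J (h q) -> z (h q) = y q -> J (h q') -> z (h q') = y q' ->
    Imax (h q) /\ zmax (h q) = y q -> Imax (h q') /\ zmax (h q') = y q'.
  have [Jp zp] := nbhs_singleton nJ.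
  by apply: filterS nJ => q [Jq zq]; split; exact: key.
move=> Jq zq Jq' zq' [mq zmq].
have [w [Sw wm wJ]] := solutionU Smax SJ mq Jq (etrans zmq (esym zq)).
have FW : F (Imax `|` J) w by split=> //; [left|rewrite wm].
split; first by exists (Imax `|` J), w; split=> //; right.
by rewrite (zmaxE _ _ _ FW); [rewrite wJ|right].
Qed.

End gluing.

(** * The equation of the profile *)

Section profile_equation.
Context {R : realType} (H : R).

(** [mu_rate] and [nu_rate] are the derivatives of mu and nu with respect to the
height, as prescribed by the structure equations of the surface. *)
Definition mu_rate (m n : R) : R := 2 * m * n * (H - m) / (1 - n ^+ 2).
Definition nu_rate (m : R) : R := m - 2 * H.

Definition profile_ode (y : R -> R * R) (t : R) :=
  [/\ (y t).1 != 0, (y t).2 ^+ 2 < 1,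
      is_derive t (1 : R) (fun u => (y u).1) (mu_rate (y t).1 (y t).2) &
      is_derive t (1 : R) (fun u => (y u).2) (nu_rate (y t).1)].

(** Rewriting the increment with coefficients that are continuous along two
solutions turns their difference into a solution of a linear system. *)
Lemma mu_rate_diff (m1 n1 m2 n2 : R) : n1 ^+ 2 < 1 -> n2 ^+ 2 < 1 ->
  mu_rate m1 n1 - mu_rate m2 n2 =
    2 * (H - m1 - m2) * n1 / (1 - n1 ^+ 2) * (m1 - m2) +
    2 * m2 * (H - m2) * (1 + n1 * n2) / ((1 - n1 ^+ 2) * (1 - n2 ^+ 2)) * (n1 - n2).
Proof.
move=> h1 h2; rewrite /mu_rate.
have d1 : 1 - n1 ^+ 2 != 0 by rewrite subr_eq0 gt_eqF.
have d2 : 1 - n2 ^+ 2 != 0 by rewrite subr_eq0 gt_eqF.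
by field; rewrite d1 d2.
Qed.

Lemma is_derive_continuous (f : R -> R) (t d : R) :
  is_derive t (1 : R) f d -> {for t, continuous f}.
Proof. by case=> df _; apply: differentiable_continuous; exact/derivable1_diffP. Qed.

(** The factor [k] stands for the derivative of the height along a path: the
equation can thus be compared along curves of the surface, on which the height
need not be monotone. *)
Lemma profile_ode_unique (k m1 n1 m2 n2 : R -> R) :
  (forall s, 0 <= s <= 1 -> {for s, continuous k}) ->
  (forall s, 0 <= s <= 1 -> [/\ n1 s ^+ 2 < 1,
     is_derive s (1 : R) m1 (mu_rate (m1 s) (n1 s) * k s) &
     is_derive s (1 : R) n1 (nu_rate (m1 s) * k s)]) ->
  (forall s, 0 <= s <= 1 -> [/\ n2 s ^+ 2 < 1,
     is_derive s (1 : R) m2 (mu_rate (m2 s) (n2 s) * k s) &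
     is_derive s (1 : R) n2 (nu_rate (m2 s) * k s)]) ->
  m1 0 = m2 0 -> n1 0 = n2 0 -> m1 1 = m2 1 /\ n1 1 = n2 1.
Proof.
move=> ck f1 f2 m0 n0.
pose a s := 2 * (H - m1 s - m2 s) * n1 s / (1 - n1 s ^+ 2) * k s.
pose b s := 2 * m2 s * (H - m2 s) * (1 + n1 s * n2 s) /
  ((1 - n1 s ^+ 2) * (1 - n2 s ^+ 2)) * k s.
suff [] : m1 1 - m2 1 = 0 /\ n1 1 - n2 1 = 0.
  by move=> /eqP; rewrite subr_eq0 => /eqP-> /eqP; rewrite subr_eq0 => /eqP->.
have cst_c (c s : R) : {for s, continuous (fun=> c : R)} by exact: cvg_cst.
have cB (f g : R -> R) (s : R) : {for s, continuous f} -> {for s, continuous g} ->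
    {for s, continuous (fun u => f u - g u)} by exact: (@continuousB R R^o).
have cD (f g : R -> R) (s : R) : {for s, continuous f} -> {for s, continuous g} ->
    {for s, continuous (fun u => f u + g u)} by exact: (@continuousD R R^o).
have cM (f g : R -> R) (s : R) : {for s, continuous f} -> {for s, continuous g} ->
    {for s, continuous (fun u => f u * g u)} by exact: (@continuousM R).
have cV (f : R -> R) (s : R) : f s != 0 -> {for s, continuous f} ->
    {for s, continuous (fun u => (f u)^-1)} by exact: (@continuousV R).
have cm1 s : 0 <= s <= 1 -> {for s, continuous m1}.
  by move=> /f1[_ + _]; exact: is_derive_continuous.
have cn1 s : 0 <= s <= 1 -> {for s, continuous n1}.
  by move=> /f1[_ _ +]; exact: is_derive_continuous.
have cm2 s : 0 <= s <= 1 -> {for s, continuous m2}.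
  by move=> /f2[_ + _]; exact: is_derive_continuous.
have cn2 s : 0 <= s <= 1 -> {for s, continuous n2}.
  by move=> /f2[_ _ +]; exact: is_derive_continuous.
have nz1 s : 0 <= s <= 1 -> 1 - n1 s ^+ 2 != 0.
  by move=> /f1[h _ _]; rewrite subr_eq0 gt_eqF.
have nz2 s : 0 <= s <= 1 -> 1 - n2 s ^+ 2 != 0.
  by move=> /f2[h _ _]; rewrite subr_eq0 gt_eqF.
have cn1' s : 0 <= s <= 1 -> {for s, continuous (fun u => 1 - n1 u ^+ 2)}.
  by move=> st; apply: (cB (fun=> 1)) => //; exact: (cM _ _ _ (cn1 s st) (cn1 s st)).
have cn2' s : 0 <= s <= 1 -> {for s, continuous (fun u => 1 - n2 u ^+ 2)}.
  by move=> st; apply: (cB (fun=> 1)) => //; exact: (cM _ _ _ (cn2 s st) (cn2 s st)).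
apply: (@linear_system_zero R (fun s => m1 s - m2 s) (fun s => n1 s - n2 s)
  a b k (fun=> 0) 1 ltr01) => //.
- move=> s st.
  have c1 : {for s, continuous (fun u => 2 * (H - m1 u - m2 u))}.
    apply: (cM (fun=> 2) (fun u => H - m1 u - m2 u)) => //.
    by apply: (cB (fun u => H - m1 u) m2 _ _ (cm2 s st)); exact: (cB (fun=> H) m1 _ _ (cm1 s st)).
  have c2 := cV (fun u => 1 - n1 u ^+ 2) s (nz1 s st) (cn1' s st).
  exact: (cM _ _ _ (cM _ _ _ (cM _ _ _ c1 (cn1 s st)) c2) (ck s st)).
- move=> s st.
  have c1 : {for s, continuous (fun u => 2 * m2 u * (H - m2 u))}.
    apply: (cM (fun u => 2 * m2 u) (fun u => H - m2 u)).
      exact: (cM (fun=> 2) m2 _ _ (cm2 s st)).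
    exact: (cB (fun=> H) m2 _ _ (cm2 s st)).
  have c2 : {for s, continuous (fun u => 1 + n1 u * n2 u)}.
    exact: (cD (fun=> 1) (fun u => n1 u * n2 u) _ _ (cM _ _ _ (cn1 s st) (cn2 s st))).
  have c3 := cM _ _ _ (cn1' s st) (cn2' s st).
  have c4 := cV (fun u => (1 - n1 u ^+ 2) * (1 - n2 u ^+ 2)) s (mulf_neq0 (nz1 s st) (nz2 s st)) c3.
  exact: (cM _ _ _ (cM _ _ _ (cM _ _ _ c1 c2) c4) (ck s st)).
- move=> s st; have [h1 dm1 _] := f1 s st; have [h2 dm2 _] := f2 s st.
  apply: is_derive_eq (is_deriveB dm1 dm2) _.
  by rewrite -mulrBl mu_rate_diff // /a /b mulrDl; congr (_ + _); rewrite mulrAC.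
- move=> s st; have [h1 _ dn1] := f1 s st; have [h2 _ dn2] := f2 s st.
  apply: is_derive_eq (is_deriveB dn1 dn2) _.
  by rewrite /nu_rate; ring.
- by rewrite m0 subrr.
- by rewrite n0 subrr.
Qed.

Lemma profile_ode_near (y z : R -> R * R) (t : R) :
  (\forall s \near t, y s = z s) -> profile_ode y t -> profile_ode z t.
Proof.
move=> yz [m0 n1 dm dn]; rewrite /profile_ode -(nbhs_singleton yz); split=> //.
  by apply: near_eq_is_derive dm; apply: filterS yz => s ->.
by apply: near_eq_is_derive dn; apply: filterS yz => s ->.
Qed.

Lemma is_derive_segment (f : R -> R) (s e u d : R) : is_derive (s + u * e) (1 : R) f d ->
  is_derive u (1 : R) (fun v => f (s + v * e)) (d * e).
Proof.
move=> df; apply: (@is_derive1_comp _ f (fun v => s + v * e)) => //.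
have dl := is_deriveM (is_derive_id u (1 : R)) (is_derive_cst e u (1 : R)).
apply: is_derive_eq (is_deriveD (is_derive_cst s u (1 : R)) dl) _.
by rewrite /GRing.scale /=; ring.
Qed.

Lemma profile_solution_unique (I J : set R) (y z : R -> R * R) (s t : R) :
  solution profile_ode I y -> solution profile_ode J z ->
  I s -> J s -> y s = z s -> I t -> J t -> y t = z t.
Proof.
move=> [_ iI yI] [_ iJ zJ] Is Js ys It Jt.
have seg K : is_interval K -> K s -> K t -> forall u, 0 <= u <= 1 -> K (s + u * (t - s)).
  move=> iK Ks Kt u /andP[u0 u1].
  have [st|ts] := leP s t.
    apply: (iK s t) => //; rewrite lerDl mulr_ge0 ?subr_ge0 //=.
    by rewrite -lerBrDl ler_piMl ?subr_ge0.
  apply: (iK t s) => //; rewrite gerDl mulr_ge0_le0 ?subr_le0 ?(ltW ts) // andbT.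
  by rewrite -lerBlDl ler_niMl // subr_le0 ltW.
(* the affine path from s to t, whose speed t - s may be negative *)
have [|||||] := @profile_ode_unique (fun=> t - s) (fun u => (y (s + u * (t - s))).1)
  (fun u => (y (s + u * (t - s))).2) (fun u => (z (s + u * (t - s))).1)
  (fun u => (z (s + u * (t - s))).2).
- by move=> u _; exact: cvg_cst.
- move=> u u01; have [m0 n1 dm dn] := yI _ (seg I iI Is It u u01); split => //.
    exact: is_derive_segment dm.
  exact: is_derive_segment dn.
- move=> u u01; have [m0 n1 dm dn] := zJ _ (seg J iJ Js Jt u u01); split => //.
    exact: is_derive_segment dm.
  exact: is_derive_segment dn.
- by rewrite mul0r addr0 ys.
- by rewrite mul0r addr0 ys.
rewrite mul1r subrKC => e1 e2.
by rewrite [LHS]surjective_pairing [RHS]surjective_pairing e1 e2.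
Qed.

(** A curve at signed distance [rho] from the axis, parametrised by the height,
with unit normal ([sg], [nu]). The equation for [rho] says that the normal is
orthogonal to the curve. The one for [nu] says that the curvature of the curve is
2H + sg/rho; as that of the parallels is - sg/rho, the mean curvature is H. *)
Definition profile (I : set R) (rho nu sg : R -> R) :=
  [/\ open I, is_interval I,
      [/\ smooth_on (I : set R^o) (rho : R^o -> R^o), smooth_on (I : set R^o) (nu : R^o -> R^o) &
          smooth_on (I : set R^o) (sg : R^o -> R^o)] &
      forall t, I t -> [/\ rho t != 0, 0 < sg t, sg t ^+ 2 + nu t ^+ 2 = 1 &
       [/\ is_derive t (1 : R) rho (- nu t / sg t),
           is_derive t (1 : R) nu (- (2 * H + sg t / rho t)) &
           is_derive t (1 : R) sg (nu t * (2 * H + sg t / rho t) / sg t)]]].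

Lemma derive_scalar (f : R -> R) (t v d : R) : is_derive t (1 : R) f d ->
  differentiable (f : R^o -> R^o) t /\ 'D_v (f : R^o -> R^o) t = v * d.
Proof.
move=> df.
have [] := @derive_comp R R^o f id t v d (@ex_diff _ _ _ _ _ _ _ (is_diff_id (t : R^o))) df.
by rewrite derive_id.
Qed.

(** Bootstrapping: the derivatives are rational functions of the state, hence as
regular as the state itself. *)
Lemma profile_solution_smooth I y : solution profile_ode I y ->
  smooth_on (I : set R^o) (fun t : R^o => (y t).1 : R^o) /\
  smooth_on (I : set R^o) (fun t : R^o => (y t).2 : R^o).
Proof.
move=> [oI iI yI].
suff C k : class_C k (I : set R^o) (fun t : R^o => (y t).1 : R^o) /\
           class_C k (I : set R^o) (fun t : R^o => (y t).2 : R^o).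
  by split=> k; have [] := C k.
elim: k => [|k [C1 C2]].
  by split => t /yI[_ _ d1 d2]; [exact: is_derive_continuous d1|exact: is_derive_continuous d2].
have C0 (c : R) : class_C k (I : set R^o) (fun=> c : R^o) by exact: class_C_cst.
split; apply: (class_C_succ oI).
- by move=> t /yI[_ _ d1 d2]; have [] := derive_scalar 0 d1.
- move=> v; exists (fun t : R^o => v * (2 * (y t).1 * (y t).2 * (H + (-1) * (y t).1) *
    (1 + (-1) * ((y t).2 * (y t).2))^-1)) => [|t /yI[_ _ d1 _]]; last first.
    have [_ ->] := derive_scalar v d1.
    by rewrite /mu_rate !mulN1r -expr2.
  apply: (class_CM oI (C0 v)); apply: (class_CM oI).
    apply: (class_CM oI); last exact: (class_CD oI (C0 H) (class_CM oI (C0 (-1)) C1)).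
    exact: (class_CM oI (class_CM oI (C0 2) C1) C2).
  apply: (class_CV oI); last first.
    exact: (class_CD oI (C0 1) (class_CM oI (C0 (-1)) (class_CM oI C2 C2))).
  by move=> t /yI[_ n1 _ _]; rewrite mulN1r -expr2 subr_eq0 gt_eqF.
- by move=> t /yI[_ _ d1 d2]; have [] := derive_scalar 0 d2.
- move=> v; exists (fun t : R^o => v * ((y t).1 - 2 * H)) => [|t /yI[_ _ _ d2]]; last first.
    by have [_ ->] := derive_scalar v d2.
  exact: (class_CM oI (C0 v) (class_CD oI C1 (C0 _))).
Qed.

(** The curvature mu of the parallels is - sg/rho, which dictates the radius. *)
Lemma profile_of_solution I y : solution profile_ode I y ->
  profile I (fun t => - Num.sqrt (1 - (y t).2 ^+ 2) / (y t).1) (fun t => (y t).2)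
    (fun t => Num.sqrt (1 - (y t).2 ^+ 2)).
Proof.
move=> sol; have [s1 s2] := profile_solution_smooth sol; case: sol => oI iI yI.
have ss : smooth_on (I : set R^o) (fun t : R^o => Num.sqrt (1 - (y t).2 ^+ 2) : R^o).
  apply: (smooth_sqrt oI); first by move=> t /yI[_ ? _ _]; rewrite subr_gt0.
  apply: (smoothB oI); [exact: (smooth_cst _)|exact: (smoothM oI)].
split=> //.
  split=> //; apply: (smoothM oI); first exact: (smoothN oI).
  by apply: (smoothV oI) => // t /yI[].
move=> t /yI[m0 n1 d1 d2].
have p : 0 < 1 - (y t).2 ^+ 2 by rewrite subr_gt0.
have sp : 0 < Num.sqrt (1 - (y t).2 ^+ 2) by rewrite sqrtr_gt0.
have sE := sqr_sqrtr (ltW p).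
have ds : is_derive t (1 : R) (fun u => Num.sqrt (1 - (y u).2 ^+ 2))
   ((2 * Num.sqrt (1 - (y t).2 ^+ 2))^-1 * (- (2 * (y t).2 * nu_rate (y t).1))).
  apply: (@is_derive1_comp _ Num.sqrt (fun u => 1 - (y u).2 ^+ 2)).
    exact: is_derive1_sqrt.
  apply: is_derive_eq (is_deriveB (is_derive_cst (1 : R) t (1 : R)) (is_deriveM d2 d2)) _.
  by rewrite /GRing.scale /=; ring.
have sn0 := lt0r_neq0 sp.
split=> //.
- by rewrite mulf_neq0 ?oppr_eq0 ?invr_neq0.
- by rewrite sE subrK.
split.
- apply: is_derive_eq (is_deriveM (is_deriveN ds) (is_deriveV m0 d1)) _.
  rewrite /GRing.scale /= /mu_rate /nu_rate !fctE.
  set S := Num.sqrt _ in sE sn0 *; rewrite -sE.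
  by field; rewrite m0 sn0.
- apply: is_derive_eq d2 _; rewrite /nu_rate.
  by field; rewrite ?m0 ?sn0.
- apply: is_derive_eq ds _; rewrite /nu_rate.
  by field; rewrite ?m0 ?sn0.
Qed.

(** A line parallel to the axis is a constant solution, with parallels of
curvature 2H. *)
Lemma cylinder_profile : H != 0 -> profile setT (fun=> - (2 * H)^-1) (fun=> 0) (fun=> 1).
Proof.
move=> H0; split=> //; first exact: openT.
  by split; exact: smooth_cst.
move=> t _; split=> //.
- by rewrite oppr_eq0 invr_eq0 mulf_neq0.
- by rewrite expr0n expr1n addr0.
split.
- by apply: is_derive_eq (is_derive_cst _ t (1 : R)) _; rewrite oppr0 mul0r.
- apply: is_derive_eq (is_derive_cst _ t (1 : R)) _.
  by rewrite div1r invrN invrK subrr oppr0.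
- by apply: is_derive_eq (is_derive_cst _ t (1 : R)) _; rewrite !mul0r.
Qed.

End profile_equation.

(** * Surfaces parametrised by a planar domain *)

Lemma mx_ballP (R : realType) n (x y : 'rV[R]_n.+1) (e : R) : 0 < e ->
  ball x e y <-> forall i, `|x 0 i - y 0 i| < e.
Proof.
move=> e0; split=> [[_ h] i|h]; first exact: (h 0 i).
by split=> // i j; rewrite ord1; exact: h.
Qed.

Lemma dmx_near (R : realType) (S : smooth_surface R) n (f : S -> 'rV[R]_n.+1)
    (c : chart R S) (p : S) (G : 'rV[R]_2 -> 'rV[R]_n.+1) :
  (\forall y \near coord c p, G y = f (param c y)) -> differentiable G (coord c p) ->
  dmx f c p = jacobian G (coord c p).
Proof.
move=> nG dG; have [_ e] := near_differentiable nG dG.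
rewrite /dmx /jacobian; exact: (congr1 (@lin1_mx R 2 n.+1) e).
Qed.

(** In the basis of eigenvectors [w0], [w1] the shape operator is diagonal, and the
trace does not depend on the basis. *)
Lemma principal_frame_trace (R : realType) n (P N : 'M[R]_(2, n)) (w0 w1 : 'rV[R]_2)
    (k0 k1 : R) : row_free P -> w0 0 0 * w1 0 1 - w0 0 1 * w1 0 0 != 0 ->
  w0 *m N = - (k0 *: (w0 *m P)) -> w1 *m N = - (k1 *: (w1 *m P)) ->
  \tr (- N *m pinvmx P) = k0 + k1.
Proof.
move=> rP det0 e0 e1.
pose B : 'M[R]_2 := \matrix_i (if i == 0 then w0 else w1).
pose k : 'rV[R]_2 := \row_i (if i == 0 then k0 else k1).
have lift1 : lift ord0 ord0 = 1 :> 'I_2 by apply: val_inj.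
have uB : B \in unitmx.
  rewrite -row_free_unit; apply: inj_row_free => v.
  rewrite mulmx_sum_row !big_ord_recl big_ord0 addr0 !rowK /= lift1 => h.
  have h0 := congr1 (fun M : 'rV[R]_2 => M 0 0) h.
  have h1 := congr1 (fun M : 'rV[R]_2 => M 0 1) h.
  rewrite !mxE in h0 h1.
  have z0 : v 0 0 * (w0 0 0 * w1 0 1 - w0 0 1 * w1 0 0) = 0.
    transitivity ((v 0 0 * w0 0 0 + v 0 1 * w1 0 0) * w1 0 1 -
      (v 0 0 * w0 0 1 + v 0 1 * w1 0 1) * w1 0 0); first by ring.
    by rewrite h0 h1; ring.
  have z1 : v 0 1 * (w0 0 0 * w1 0 1 - w0 0 1 * w1 0 0) = 0.
    transitivity ((v 0 0 * w0 0 1 + v 0 1 * w1 0 1) * w0 0 0 -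
      (v 0 0 * w0 0 0 + v 0 1 * w1 0 0) * w0 0 1); first by ring.
    by rewrite h0 h1; ring.
  move/eqP: z0; rewrite mulf_eq0 (negbTE det0) orbF => /eqP z0.
  move/eqP: z1; rewrite mulf_eq0 (negbTE det0) orbF => /eqP z1.
  apply/rowP => -[[|[|//]] hi]; rewrite mxE.
    by rewrite (_ : Ordinal hi = 0) //; apply: val_inj.
  by rewrite (_ : Ordinal hi = 1) //; apply: val_inj.
have BN : B *m - N = diag_mx k *m (B *m P).
  apply/row_matrixP => i; rewrite row_mul rowK mulmxN.
  have -> : row i (diag_mx k *m (B *m P)) = k 0 i *: row i (B *m P).
    by apply/rowP => j; rewrite mul_diag_mx !mxE.
  by rewrite row_mul rowK mxE; case: eqP => _; rewrite ?e0 ?e1 opprK.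
have -> : - N *m pinvmx P = invmx B *m (diag_mx k *m B).
  have -> : - N = invmx B *m (diag_mx k *m (B *m P)) by rewrite -BN mulKmx.
  by rewrite -!mulmxA mulmxVp ?mulmx1.
rewrite mxtrace_mulC -mulmxA mulmxV // mulmx1 mxtrace_diag.
by rewrite !big_ord_recl big_ord0 addr0 !mxE.
Qed.

Section planar_domain.
Context {R : realType} (U : set 'rV[R]_2) (oU : open U) (u0 : set_type U).
Local Notation T := (set_type U).

Lemma planar_hausdorff : hausdorff_space T.
Proof.
rewrite open_hausdorff => x y xy.
have vxy : val x != val y by apply: contra xy => /eqP/val_inj->.
have := @norm_hausdorff _ 'rV[R]_2; rewrite open_hausdorff => /(_ _ _ vxy).
move=> [[A B]] /= [xA yB] [oA oB /eqP AB0].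
exists (val @^-1` A, val @^-1` B) => /=; first by rewrite !inE in xA yB *.
split; [by exists A|by exists B|].
by apply/eqP; rewrite -preimage_setI AB0 preimage_set0.
Qed.

(** A basis is given by the traces of the boxes with rational centre and radius
1/(n+1). *)
Lemma planar_second_countable : @second_countable T.
Proof.
pose g (q : rat * rat) (i : 'I_2) : R := if i == 0 then ratr q.1 else ratr q.2.
pose f (q : (rat * rat) * nat) : set T :=
  [set z : T | forall i : 'I_2, `|g q.1 i - (val z : 'rV[R]_2) 0 i| < q.2.+1%:R^-1].
exists (range f); first by apply: (sub_countable (card_image_le _ _)); exact: countableP.
split.
  move=> _ [q _ <-].
  pose c : 'rV[R]_2 := \row_i g q.1 i.
  exists (ball c q.2.+1%:R^-1); first by apply: ball_open.
  apply/seteqP; split=> z /=.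
    by move/mx_ballP => h i; have := h (ltac:(by [])) i; rewrite mxE.
  by move=> h; apply/mx_ballP => // i; rewrite mxE; exact: h.
move=> x V; rewrite nbhsE => -[_ [[W oW <-] /= Wx] WV].
move: oW; rewrite openE => /(_ _ Wx)/nbhs_ballP[e /= e0 xe].
have [n] : exists n : nat, 0 + n.+1%:R^-1 < e / 2.
  by have [|n hn] := @ltr_add_invr R 0 (e / 2); [rewrite divr_gt0|exists n].
rewrite add0r => ne.
have rat_near (r : R) : exists q : rat, `|ratr q - r| < n.+1%:R^-1.
  have [||r'] := @dense_rat R (ball r n.+1%:R^-1).
  - by exists r; apply: ballxx.
  - exact: ball_open.
  by rewrite /ball /= => -[h [q _ qr]]; exists q; rewrite distrC qr.
have [q0 hq0] := rat_near ((val x) 0 0).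
have [q1 hq1] := rat_near ((val x) 0 1).
have hx (i : 'I_2) : `|g (q0, q1) i - (val x) 0 i| < n.+1%:R^-1.
  rewrite /g; case: i => -[|[|//]] hi.
    by rewrite (_ : Ordinal hi = 0) ?eqxx //; apply: val_inj.
  by rewrite (_ : Ordinal hi = 1) //; apply: val_inj.
(* two points of this box are at distance less than 2/(n+1) < e *)
exists (f ((q0, q1), n)); first by split=> //; exists (q0, q1, n).
move=> z fz; apply: WV; apply: xe; apply/mx_ballP => // i.
have := fz i => /= h1; have h2 := hx i.
rewrite -(subrKA (g (q0, q1) i)) (le_lt_trans (ler_normD _ _)) //.
by rewrite [ltRHS]splitr distrC ltrD // (lt_trans _ ne).
Qed.

(** Outside [U] the value is the default [u0]. *)
Definition planar_param (y : 'rV[R]_2) : T := insubd u0 y.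

Lemma planar_paramK y : U y -> val (planar_param y) = y.
Proof. by move=> Uy; rewrite val_insubd mem_set. Qed.

Lemma planar_valK (p : T) : planar_param (val p) = p.
Proof. exact: valKd. Qed.

Lemma planar_valU (p : T) : U (val p).
Proof. exact: set_valP. Qed.

Lemma planar_image : (val : T -> 'rV[R]_2) @` [set: T] = U.
Proof.
apply/seteqP; split=> [_ [p _ <-]|y Uy]; first exact: planar_valU.
by exists (planar_param y) => //; exact: planar_paramK.
Qed.

Lemma planar_param_continuous y : U y -> {for y, continuous planar_param}.
Proof.
move=> Uy V; rewrite nbhsE => -[_ [[W oW <-] /= Wy] WV].
have {}Wy : W y by rewrite -(planar_paramK Uy); exact: Wy.
have nU : \forall z \near y, U z by exact: open_nbhs_nbhs.
have nW : \forall z \near y, W z by exact: open_nbhs_nbhs.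
apply: filterS2 nU nW => z Uz Wz; apply: WV.
by rewrite /preimage /= -[set_val _]/(val (planar_param z)) planar_paramK.
Qed.

Program Definition planar_chart : chart R T :=
  @Chart R T setT val planar_param openT _ _ _ _.
Next Obligation. by rewrite planar_image. Qed.
Next Obligation. by move=> p _; exact: (@initial_continuous T 'rV[R]_2 set_val p). Qed.
Next Obligation. by move=> y; rewrite planar_image; exact: planar_param_continuous. Qed.
Next Obligation. by move=> p _; exact: planar_valK. Qed.

Program Definition planar_surface : smooth_surface R :=
  @SmoothSurface R T planar_hausdorff planar_second_countable [set planar_chart] _ _.
Next Obligation. by move=> p; exists planar_chart. Qed.
Next Obligation.
move=> c d -> ->; rewrite setTI planar_image; apply: (smooth_ext oU _ (smooth_id oU)) => y Uy.
exact/esym/planar_paramK.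
Qed.

Section immersion.
Variables (F N : 'rV[R]_2 -> 'rV[R]_3).
Hypothesis sF : smooth_on U F.
Hypothesis sN : smooth_on U N.
Hypothesis rankF : forall y, U y -> row_free (jacobian F y).
Hypothesis unitN : forall y, U y -> dot (N y) (N y) = 1.
Hypothesis orthN : forall y, U y -> jacobian F y *m (N y)^T = 0.

Lemma planar_dmx (G : 'rV[R]_2 -> 'rV[R]_3) (p : planar_surface) : smooth_on U G ->
  @dmx R planar_surface 3 (G \o val) planar_chart p = jacobian G (val p).
Proof.
move=> sG.
have nU : \forall z \near (val p : 'rV[R]_2), U z.
  by apply: open_nbhs_nbhs; split => //; exact: planar_valU.
apply: (@dmx_near R planar_surface 2 (G \o val) planar_chart p G).
  by apply: filterS nU => z Uz; rewrite /= planar_paramK.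
exact: (smooth_differentiable sG (planar_valU p)).
Qed.

Lemma planar_smooth (G : 'rV[R]_2 -> 'rV[R]_3) : smooth_on U G ->
  @smooth_to_vector R planar_surface 3 (G \o val).
Proof.
move=> sG c /= ->; rewrite planar_image; apply: (smooth_ext oU _ sG) => y Uy.
by rewrite /= planar_paramK.
Qed.

Program Definition planar_immersion : immersed_surface R :=
  @ImmersedSurface R planar_surface (F \o val) (N \o val) _ _ _ _ _.
Next Obligation. exact: planar_smooth. Qed.
Next Obligation. by move=> c p -> _; rewrite planar_dmx //; apply: rankF; exact: planar_valU. Qed.
Next Obligation. exact: planar_smooth. Qed.
Next Obligation. by move=> p; apply: unitN; exact: planar_valU. Qed.
Next Obligation. by move=> c p -> _; rewrite planar_dmx //; apply: orthN; exact: planar_valU. Qed.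

Lemma planar_cmc (H : R) :
  (forall y, U y -> exists (w0 w1 : 'rV[R]_2) (k0 k1 : R), [/\ w0 0 0 * w1 0 1 - w0 0 1 * w1 0 0 != 0,
     'D_w0 N y = - (k0 *: 'D_w0 F y), 'D_w1 N y = - (k1 *: 'D_w1 F y) & k0 + k1 = 2 * H]) ->
  constant_mean_curvature planar_immersion.
Proof.
move=> h; exists H => c p /= -> _.
rewrite /mean_curvature /shape_mx /= !planar_dmx //.
have Up := planar_valU p; have [w0 [w1 [k0 [k1 [det0 e0 e1 kk]]]]] := h _ Up.
have dF := smooth_differentiable sF Up; have dN := smooth_differentiable sN Up.
rewrite !deriveEjacobian // in e0 e1.
rewrite (principal_frame_trace (rankF Up) det0 e0 e1) kk.
by field.
Qed.

Lemma planar_connected : connected U -> connected [set: planar_immersion].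
Proof.
move=> cU; have <- : planar_param @` U = setT.
  apply/seteqP; split=> // p _; exists (val p); [exact: planar_valU|exact: planar_valK].
apply: connected_continuous_connected => //.
apply: continuous_in_subspaceT => y; rewrite inE.
exact: planar_param_continuous.
Qed.

Lemma planar_range : range (@imm R planar_immersion) = F @` U.
Proof.
apply/seteqP; split=> [_ [p _ <-]|_ [y Uy <-]].
  by exists (val p) => //; exact: planar_valU.
by exists (planar_param y) => //=; rewrite planar_paramK.
Qed.

Lemma planar_part_of (M : immersed_surface R) (phi : M -> 'rV[R]_2) :
  (forall p, U (phi p)) -> (forall p, imm p = F (phi p)) ->
  (forall c, atlas c -> smooth_on (coord c @` dom c) (phi \o param c)) ->
  part_of M planar_immersion.
Proof.
move=> Uphi immE sphi; exists (planar_param \o phi); split; last first.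
  by move=> p; rewrite /= planar_paramK.
have cphi : continuous phi.
  move=> p; have [c Ac dp] := @atlas_cover R M p.
  have h : {for p, continuous ((phi \o param c) \o coord c)}.
    apply: continuous_comp; first exact: Defs.coord_continuous.
    by apply: (smooth_continuous (sphi c Ac)); exists p.
  rewrite /prop_for /continuous_at -[X in _ --> phi X](coordK dp).
  apply: cvg_trans h; apply: near_eq_cvg.
  have nd : \forall q \near p, dom c q by apply: open_nbhs_nbhs; split=> //; exact: dom_open.
  by apply: filterS nd => q dq; rewrite /= coordK.
split.
  move=> p; apply: continuous_comp; first exact: cphi.
  exact: planar_param_continuous.
move=> c d Ac /= ->.
rewrite preimage_setT setIT.
have e y : (coord c @` dom c) y -> (phi \o param c) y = (val \o (planar_param \o phi) \o param c) y.
  by move=> _ /=; rewrite planar_paramK.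
exact: (smooth_ext (@img_open _ _ c) e (sphi c Ac)).
Qed.

End immersion.
End planar_domain.

(** * Orthonormal frames *)

Section frame.
Context {R : realType}.

Lemma dotE (u v : 'rV[R]_3) :
  dot u v = u 0 0 * v 0 0 + u 0 1 * v 0 1 + u 0 ord_max * v 0 ord_max.
Proof.
rewrite /dot mxE !big_ord_recl big_ord0 addr0 !mxE addrA.
have -> : lift ord0 ord0 = 1 :> 'I_3 by apply: val_inj.
by have -> : lift ord0 (lift ord0 ord0) = ord_max :> 'I_3 by apply: val_inj.
Qed.

Definition frame_vec (Q : 'M[R]_3) (a b c : R) : 'rV[R]_3 :=
  a *: row 0 Q + b *: row 1 Q + c *: row ord_max Q.

Section orthonormal.
Variables (Q : 'M[R]_3) (oQ : Q *m Q^T = 1%:M).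

Lemma dotDl (u v w : 'rV[R]_3) : dot (u + v) w = dot u w + dot v w.
Proof. by rewrite /dot mulmxDl mxE. Qed.
Lemma dotZl k (u v : 'rV[R]_3) : dot (k *: u) v = k * dot u v.
Proof. by rewrite /dot -scalemxAl mxE. Qed.
Lemma dotC (u v : 'rV[R]_3) : dot u v = dot v u.
Proof. by rewrite !dotE; ring. Qed.
Lemma dotDr (u v w : 'rV[R]_3) : dot u (v + w) = dot u v + dot u w.
Proof. by rewrite dotC dotDl !(dotC _ u). Qed.
Lemma dotZr k (u v : 'rV[R]_3) : dot u (k *: v) = k * dot u v.
Proof. by rewrite dotC dotZl dotC. Qed.

Lemma dot_frame i j : dot (row i Q) (row j Q) = (i == j)%:R.
Proof.
rewrite /dot mxE; have := congr1 (fun M : 'M[R]_3 => M i j) oQ; rewrite !mxE => <-.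
by apply: eq_bigr => k _; rewrite !mxE.
Qed.

Lemma dot_frame_vec a b c a' b' c' :
  dot (frame_vec Q a b c) (frame_vec Q a' b' c') = a * a' + b * b' + c * c'.
Proof.
rewrite /frame_vec !dotDl !dotDr !dotZl !dotZr !dot_frame /=.
by ring.
Qed.

Lemma frame_vec_dot u : u = frame_vec Q (dot u (row 0 Q)) (dot u (row 1 Q)) (dot u (row ord_max Q)).
Proof.
have QQ : Q^T *m Q = 1%:M by apply: mulmx1C.
rewrite -[LHS]mulmx1 -QQ mulmxA.
have -> (w : 'rV[R]_3) : w *m Q = w 0 0 *: row 0 Q + w 0 1 *: row 1 Q + w 0 ord_max *: row ord_max Q.
  rewrite mulmx_sum_row !big_ord_recl big_ord0 addr0 addrA.
  have -> : lift ord0 ord0 = 1 :> 'I_3 by apply: val_inj.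
  by have -> : lift ord0 (lift ord0 ord0) = ord_max :> 'I_3 by apply: val_inj.
rewrite /frame_vec /dot; congr (_ *: _ + _ *: _ + _ *: _); rewrite !mxE; apply: eq_bigr => k _; by rewrite !mxE.
Qed.

Lemma frame_vec_inj a b c a' b' c' : frame_vec Q a b c = frame_vec Q a' b' c' -> [/\ a = a', b = b' & c = c'].
Proof.
move=> e; split.
- by have := congr1 (fun u => dot u (frame_vec Q 1 0 0)) e; rewrite !dot_frame_vec => h; lra.
- by have := congr1 (fun u => dot u (frame_vec Q 0 1 0)) e; rewrite !dot_frame_vec => h; lra.
- by have := congr1 (fun u => dot u (frame_vec Q 0 0 1)) e; rewrite !dot_frame_vec => h; lra.
Qed.

Lemma frame_vecZ k a b c : k *: frame_vec Q a b c = frame_vec Q (k * a) (k * b) (k * c).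
Proof. by rewrite /frame_vec !scalerDr !scalerA. Qed.

Section fields.
Context {V : normedModType R} (U : set V) (oU : open U).
Variables a b c : V -> R^o.

Lemma smooth_frame_vec o : smooth_on U a -> smooth_on U b -> smooth_on U c ->
  smooth_on U (fun y => o + frame_vec Q (a y) (b y) (c y)).
Proof.
move=> sa sb sc; apply: (smoothD oU); first exact: smooth_cst.
apply: (smoothD oU); last exact: smoothZl.
apply: (smoothD oU); exact: smoothZl.
Qed.

Lemma derive_frame_vec o x v : differentiable a x -> differentiable b x -> differentiable c x ->
  'D_v (fun y => o + frame_vec Q (a y) (b y) (c y)) x = frame_vec Q ('D_v a x) ('D_v b x) ('D_v c x).
Proof.
move=> da db dc.
have dZ (f : V -> R^o) (w : 'rV[R]_3) : differentiable f x ->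
    is_derive x v (fun y => f y *: w) ('D_v f x *: w).
  move=> df; have dfw := differentiableZl w df.
  apply: DeriveDef; first exact: diff_derivable.
  by rewrite deriveE // diffZl // deriveE.
have h := is_deriveD (is_derive_cst o x v)
  (is_deriveD (is_deriveD (dZ a (row 0 Q) da) (dZ b (row 1 Q) db)) (dZ c (row ord_max Q) dc)).
rewrite /frame_vec -[RHS]add0r.
exact: (@derive_val _ _ _ _ _ _ _ h).
Qed.

End fields.
End orthonormal.
End frame.

Section frames.
Context {R : realType}.

Lemma orthonormalP (Q : 'M[R]_3) :
  (forall i j, dot (row i Q) (row j Q) = (i == j)%:R) -> Q *m Q^T = 1%:M.
Proof.
move=> h; apply/matrixP => i j; rewrite [RHS]mxE -h /dot !mxE.
by apply: eq_bigr => k _; rewrite !mxE.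
Qed.

Lemma ord3P (i : 'I_3) : [\/ i = 0, i = 1 | i = ord_max].
Proof.
case: i => -[|[|[|//]]] hi.
- by apply: Or31; apply: val_inj.
- by apply: Or32; apply: val_inj.
- by apply: Or33; apply: val_inj.
Qed.

(** Take the reflection that exchanges [e] and the last basis vector. *)
Lemma orthonormal_frame (e : 'rV[R]_3) : dot e e = 1 ->
  exists2 Q : 'M[R]_3, Q *m Q^T = 1%:M & row ord_max Q = e.
Proof.
move=> ee; pose z : 'rV[R]_3 := delta_mx 0 ord_max.
have rz (A : 'M[R]_3) : row ord_max A = z *m A by rewrite rowE.
have zz : dot z z = 1 by rewrite dotE !mxE /=; ring.
clearbody z.
have [->|ez] := eqVneq e z.
  by exists 1%:M; [rewrite trmx1 mulmx1|rewrite rz mulmx1].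
(* the reflection 1 - 2 v^T v / (v v^T) exchanges e and z *)
pose v := e - z.
have vv : dot v v = 2 - 2 * dot z e.
  transitivity (dot e e + dot z z - 2 * dot z e); last by rewrite ee zz.
  by rewrite /v !dotE !mxE; ring.
have zv : dot z v = dot z e - 1 by rewrite -zz /v !dotE !mxE; ring.
have v0 : dot v v != 0.
  apply: contra ez; rewrite dotE -!expr2 !paddr_eq0 ?addr_ge0 ?sqr_ge0 // !sqrf_eq0.
  move=> /andP[/andP[/eqP h0 /eqP h1] /eqP h2]; rewrite -subr_eq0; apply/eqP/rowP => i.
  by rewrite [RHS]mxE; have [->|->|->] := ord3P i.
have ve : v + z = e by rewrite /v subrK.
clearbody v.
have vvM : v *m v^T = (dot v v)%:M by rewrite [LHS]mx11_scalar.
pose k := 2 / dot v v.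
pose S := v^T *m v.
have SS : S *m S = dot v v *: S.
  by rewrite /S mulmxA -[v^T *m v *m v^T]mulmxA vvM mul_mx_scalar -scalemxAl.
have St : S^T = S by rewrite /S trmx_mul trmxK.
pose Q : 'M[R]_3 := 1%:M - k *: S.
have sym : Q^T = Q by rewrite /Q linearB linearZ /= trmx1 St.
exists Q.
  have kk : k * k * dot v v = k + k by rewrite /k; field.
  rewrite sym /Q mulmxBl mul1mx mulmxBr mulmx1 -scalemxAl -scalemxAr SS.
  by rewrite !scalerA kk scalerDl opprB addrK subrK.
rewrite rz /Q mulmxBr mulmx1 -scalemxAr /S mulmxA [z *m v^T]mx11_scalar mul_scalar_mx scalerA.
rewrite -/(dot z v) zv.
have -> : k * (dot z e - 1) = -1.
  have -> : dot z e - 1 = - dot v v / 2 by rewrite vv; field.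
  by rewrite /k; field.
by rewrite scaleN1r opprK addrC.
Qed.

(** A frame for cylinders with horizontal axis: the last vector is the horizontal
direction orthogonal to (a, b). *)
Lemma horizontal_frame (Q : 'M[R]_3) (a b : R) : Q *m Q^T = 1%:M -> a ^+ 2 + b ^+ 2 = 1 ->
  exists Q' : 'M[R]_3, [/\ Q' *m Q'^T = 1%:M, row 0 Q' = frame_vec Q a b 0, row 1 Q' = frame_vec Q 0 0 1
    & row ord_max Q' = frame_vec Q (- b) a 0].
Proof.
move=> oQ ab.
pose Q' : 'M[R]_3 := \matrix_i (if i == 0 then frame_vec Q a b 0 else if i == 1 then frame_vec Q 0 0 1
  else frame_vec Q (- b) a 0).
have r0 : row 0 Q' = frame_vec Q a b 0 by rewrite rowK.
have r1 : row 1 Q' = frame_vec Q 0 0 1 by rewrite rowK.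
have r2 : row ord_max Q' = frame_vec Q (- b) a 0 by rewrite rowK.
exists Q'; split=> //; apply: orthonormalP => i j.
have [->|->|->] := ord3P i; have [->|->|->] := ord3P j;
  rewrite ?r0 ?r1 ?r2 (dot_frame_vec oQ) /=; first [by ring|by rewrite -ab; ring].
Qed.

End frames.

(** * Polar coordinates *)

Section polar.
Context {R : realType}.

Lemma unit_circle_angle (a b : R) : a ^+ 2 + b ^+ 2 = 1 ->
  exists theta, cos theta = a /\ sin theta = b.
Proof.
move=> ab.
have a1 : -1 <= a <= 1.
  by rewrite -ler_norml -(@expr_le1 _ 2) // real_normK ?num_real //; have := sqr_ge0 b; lra.
have cE : cos (acos a) = a by rewrite acosK // in_itv.
have sE : sin (acos a) = `|b|.
  by rewrite sin_acos // -ab addrC addKr sqrtr_sqr.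
have [b0|b0] := leP 0 b.
  by exists (acos a); rewrite cE sE ger0_norm.
by exists (- acos a); rewrite cosN sinN cE sE ltr0_norm // opprK.
Qed.

Lemma eq0_mulmxl n (A : 'M[R]_(2, n)) : (forall v : 'rV[R]_2, v *m A = 0) -> A = 0.
Proof. by move=> h; apply/row_matrixP => i; rewrite rowE h row0. Qed.

Definition row2 (a b : R) : 'rV[R]_2 := \row_i (if i == 0 then a else b).

Lemma row2_0 a b : row2 a b 0 0 = a. Proof. by rewrite mxE. Qed.
Lemma row2_1 a b : row2 a b 0 1 = b. Proof. by rewrite mxE. Qed.
Lemma row2P (u v : 'rV[R]_2) : u 0 0 = v 0 0 -> u 0 1 = v 0 1 -> u = v.
Proof.
move=> h0 h1; apply/rowP => -[[|[|//]] hi].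
  by rewrite (_ : Ordinal hi = 0) //; apply: val_inj.
by rewrite (_ : Ordinal hi = 1) //; apply: val_inj.
Qed.

Definition sqnorm (y : 'rV[R]_2) : R^o := y 0 0 ^+ 2 + y 0 1 ^+ 2.
(** The polar coordinates are the logarithm of the modulus and the direction, so
that intervals of any kind correspond to open annuli about the origin. *)
Definition logr (y : 'rV[R]_2) : R^o := ln (sqnorm y) / 2.
Definition dir0 (y : 'rV[R]_2) : R^o := y 0 0 * expR (- logr y).
Definition dir1 (y : 'rV[R]_2) : R^o := y 0 1 * expR (- logr y).

Lemma expR_logr y : 0 < sqnorm y -> expR (- logr y) ^+ 2 * sqnorm y = 1.
Proof.
move=> y0; rewrite expr2 -expRD -opprD -splitr expRN lnK ?mulVf ?lt0r_neq0 //.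
Qed.

Lemma dir_unit y : 0 < sqnorm y -> dir0 y ^+ 2 + dir1 y ^+ 2 = 1.
Proof. by move=> /expR_logr <-; rewrite /dir0 /dir1 /sqnorm; ring. Qed.

Lemma polar_logr (t a b : R) : a ^+ 2 + b ^+ 2 = 1 ->
  sqnorm (row2 (expR t * a) (expR t * b)) = expR t ^+ 2 /\
  logr (row2 (expR t * a) (expR t * b)) = t.
Proof.
move=> ab; have e : sqnorm (row2 (expR t * a) (expR t * b)) = expR t ^+ 2.
  by rewrite /sqnorm row2_0 row2_1 !exprMn -mulrDr ab mulr1.
split=> //; rewrite /logr e expr2 -expRD expRK; by field.
Qed.

Lemma polar_dir (t a b : R) : a ^+ 2 + b ^+ 2 = 1 ->
  dir0 (row2 (expR t * a) (expR t * b)) = a /\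
  dir1 (row2 (expR t * a) (expR t * b)) = b.
Proof.
move=> /(polar_logr t)[_ e]; rewrite /dir0 /dir1 e row2_0 row2_1 expRN.
by split; have := expR_eq0 t => h; field; rewrite h.
Qed.

Lemma derive_coordinate (y v : 'rV[R]_2) i :
  is_derive y v (fun z : 'rV[R]_2 => z 0 i : R^o) (v 0 i).
Proof.
have d := @ex_diff _ _ _ _ _ _ _ (is_diff_id y).
apply: DeriveDef; last by rewrite (derive_coord (f := id)) // derive_id.
apply: diff_derivable; exact: differentiable_coord.
Qed.

Lemma sqnormE : sqnorm =
  (fun z : 'rV[R]_2 => z 0 0 : R^o) * (fun z : 'rV[R]_2 => z 0 0 : R^o) +
  (fun z : 'rV[R]_2 => z 0 1 : R^o) * (fun z : 'rV[R]_2 => z 0 1 : R^o).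
Proof. by apply/funext => z; rewrite !fctE /sqnorm !expr2. Qed.

Lemma differentiable_sqnorm y : differentiable sqnorm y.
Proof.
have d i := differentiable_coord y 0 i.
by rewrite sqnormE; exact: (differentiableD (differentiableM (d 0) (d 0)) (differentiableM (d 1) (d 1))).
Qed.

Lemma derive_sqnorm y v : 'D_v sqnorm y = 2 * (y 0 0 * v 0 0 + y 0 1 * v 0 1).
Proof.
have h := is_deriveD (is_deriveM (derive_coordinate y v 0) (derive_coordinate y v 0))
  (is_deriveM (derive_coordinate y v 1) (derive_coordinate y v 1)).
rewrite sqnormE.
rewrite (@derive_val _ _ _ _ _ _ _ h) /GRing.scale /=; by ring.
Qed.

Lemma derive_logr y v : 0 < sqnorm y -> differentiable logr y /\
  'D_v logr y = (y 0 0 * v 0 0 + y 0 1 * v 0 1) / sqnorm y.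
Proof.
move=> y0.
have dl : is_derive (sqnorm y) (1 : R) (fun x : R => ln x * 2^-1) ((sqnorm y)^-1 * 2^-1).
  apply: is_derive_eq (is_deriveM (is_derive1_ln y0) (is_derive_cst (2^-1 : R) _ _)) _.
  by rewrite /GRing.scale /= mulr0 add0r mulrC.
have [d ->] := derive_comp v (differentiable_sqnorm y) dl.
by split=> //; rewrite derive_sqnorm; field; exact: lt0r_neq0.
Qed.

Lemma derive_dir y v i : 0 < sqnorm y ->
  differentiable (fun z : 'rV[R]_2 => z 0 i * expR (- logr z) : R^o) y /\
  'D_v (fun z : 'rV[R]_2 => z 0 i * expR (- logr z) : R^o) y =
   expR (- logr y) * (v 0 i - y 0 i * 'D_v logr y).
Proof.
move=> y0; have [dl _] := derive_logr v y0.
have de : is_derive (logr y) (1 : R) (fun x : R => expR (- x)) (expR (- logr y) * (-1)).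
  exact: (@is_derive1_comp _ expR (fun x : R => - x) _ _ _ (is_derive_expR _)
    (@is_deriveNid R R^o (logr y) (1 : R))).
have [dE DE] := derive_comp v dl de.
have dc := differentiable_coord y 0 i.
split; first exact: (differentiableM dc dE).
rewrite (deriveM (diff_derivable dc) (diff_derivable dE)).
rewrite DE (@derive_val _ _ _ _ _ _ _ (derive_coordinate y v i)) /GRing.scale /=.
by ring.
Qed.

End polar.

(** * The surface of revolution of a profile *)

Section revolution.
Context {R : realType} (H : R) (I : set R) (rho nu sg : R -> R).
Hypothesis prof : profile H I rho nu sg.
Variables (o : 'rV[R]_3) (Q : 'M[R]_3).
Hypothesis oQ : Q *m Q^T = 1%:M.

(** This open set is a model of the product of [I] with a circle that is covered by
a single chart. *)
Definition annulus : set 'rV[R]_2 := [set y | 0 < sqnorm y /\ I (logr y)].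

Definition rev_imm (y : 'rV[R]_2) : 'rV[R]_3 :=
  o + frame_vec Q (rho (logr y) * dir0 y) (rho (logr y) * dir1 y) (logr y).
(** The summand 0 gives both maps the form to which [smooth_rev] and [derive_rev]
apply. *)
Definition rev_normal (y : 'rV[R]_2) : 'rV[R]_3 :=
  0 + frame_vec Q (sg (logr y) * dir0 y) (sg (logr y) * dir1 y) (nu (logr y)).

Let oI : open I. Proof. by case: prof. Qed.

Lemma annulus_open : open annulus.
Proof.
rewrite openE => y [y0 Iy]; rewrite /interior.
have c1 : {for y, continuous (sqnorm : 'rV[R]_2 -> R^o)}.
  by apply: differentiable_continuous; exact: differentiable_sqnorm.
have c2 : {for y, continuous (logr : 'rV[R]_2 -> R^o)}.
  by have [d _] := derive_logr 0 y0; exact: differentiable_continuous d.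
have n1 : \forall z \near y, 0 < sqnorm z.
  exact: (@cvgr_gt _ _ _ _ _ (sqnorm y : R) c1 0 y0).
have n2 : \forall z \near y, I (logr z).
  exact: (c2 I (open_nbhs_nbhs (conj oI Iy))).
by apply: filterS2 n1 n2.
Qed.

Lemma smooth_logr : smooth_on annulus (logr : 'rV[R]_2 -> R^o).
Proof.
have sc i : smooth_on annulus (fun z : 'rV[R]_2 => z 0 i : R^o).
  exact: (smooth_coord annulus_open i (smooth_id annulus_open)).
apply: (smoothM annulus_open); last exact: smooth_cst.
apply: (smooth_ln annulus_open); first by move=> y [].
by apply: (smoothD annulus_open); apply: (smoothM annulus_open); exact: sc.
Qed.

Lemma smooth_dir i : smooth_on annulus (fun z : 'rV[R]_2 => z 0 i * expR (- logr z) : R^o).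
Proof.
apply: (smoothM annulus_open).
  exact: (smooth_coord annulus_open i (smooth_id annulus_open)).
by apply: (smooth_expR annulus_open); apply: (smoothN annulus_open); exact: smooth_logr.
Qed.

Lemma smooth_along (f : R^o -> R^o) : smooth_on (I : set R^o) f ->
  smooth_on annulus (fun y => f (logr y) : R^o).
Proof.
move=> sf; apply: (smooth_comp annulus_open _ sf smooth_logr).
by move=> y [].
Qed.

Lemma smooth_rev (a b : R -> R) (p : 'rV[R]_3) : smooth_on (I : set R^o) (a : R^o -> R^o) ->
  smooth_on (I : set R^o) (b : R^o -> R^o) ->
  smooth_on annulus (fun y => p + frame_vec Q (a (logr y) * dir0 y) (a (logr y) * dir1 y) (b (logr y))).
Proof.
move=> sa sb.
apply: (@smooth_frame_vec R Q _ annulus annulus_open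
  (fun y => a (logr y) * dir0 y : R^o) (fun y => a (logr y) * dir1 y : R^o)
  (fun y => b (logr y) : R^o) p).
- exact: (smoothM annulus_open (smooth_along sa) (smooth_dir 0)).
- exact: (smoothM annulus_open (smooth_along sa) (smooth_dir 1)).
- exact: smooth_along.
Qed.

Lemma rev_imm_smooth : smooth_on annulus rev_imm.
Proof.
case: prof => _ _ [sr sn ss] _; apply: (@smooth_rev rho id) => //.
exact: smooth_id.
Qed.

Lemma rev_normal_smooth : smooth_on annulus rev_normal.
Proof. by case: prof => _ _ [sr sn ss] _; exact: smooth_rev. Qed.

Lemma derive_rev (a b : R -> R) (da db : R) (p : 'rV[R]_3) y v : annulus y ->
  is_derive (logr y : R) (1 : R) a da -> is_derive (logr y : R) (1 : R) b db ->
  'D_v (fun z => p + frame_vec Q (a (logr z) * dir0 z) (a (logr z) * dir1 z) (b (logr z))) y =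
  frame_vec Q ('D_v logr y * da * dir0 y + a (logr y) * 'D_v dir0 y)
         ('D_v logr y * da * dir1 y + a (logr y) * 'D_v dir1 y)
         ('D_v logr y * db).
Proof.
move=> [y0 Iy] ha hb.
have [dl _] := derive_logr v y0.
have [d0 _] := derive_dir v 0 y0; have [d1 _] := derive_dir v 1 y0.
have [dal Dal] := derive_comp v dl ha.
have [dbl Dbl] := derive_comp v dl hb.
have hM (f : 'rV[R]_2 -> R^o) : differentiable f y ->
    differentiable (fun z => a (logr z) * f z : R^o) y /\
    'D_v (fun z => a (logr z) * f z : R^o) y = 'D_v logr y * da * f y + a (logr y) * 'D_v f y.
  move=> df; split; first exact: (differentiableM dal df).
  rewrite (deriveM (diff_derivable dal) (diff_derivable df)) Dal /GRing.scale /=.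
  by ring.
have [e0 E0] := hM _ d0; have [e1 E1] := hM _ d1.
by rewrite (derive_frame_vec _ _ _ e0 e1 dbl) E0 E1 Dbl.
Qed.

Lemma derive_dir0 y v : 0 < sqnorm y ->
  'D_v dir0 y = expR (- logr y) * (v 0 0 - y 0 0 * 'D_v (logr : 'rV[R]_2 -> R^o) y).
Proof. by move=> y0; have [_ <-] := derive_dir v 0 y0. Qed.

Lemma derive_dir1 y v : 0 < sqnorm y ->
  'D_v dir1 y = expR (- logr y) * (v 0 1 - y 0 1 * 'D_v (logr : 'rV[R]_2 -> R^o) y).
Proof. by move=> y0; have [_ <-] := derive_dir v 1 y0. Qed.

Lemma derive_rev_imm y v : annulus y ->
  'D_v rev_imm y = frame_vec Q ('D_v logr y * (- nu (logr y) / sg (logr y)) * dir0 y + rho (logr y) * 'D_v dir0 y)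
         ('D_v logr y * (- nu (logr y) / sg (logr y)) * dir1 y + rho (logr y) * 'D_v dir1 y)
         ('D_v logr y).
Proof.
move=> Ay; have [_ Iy] := Ay.
case: (prof) => _ _ _ /(_ _ Iy)[_ _ _ [dr _ _]].
rewrite (@derive_rev rho id _ 1 o y v Ay dr (is_derive_id _ _)).
by rewrite mulr1.
Qed.

Lemma derive_rev_normal y v : annulus y ->
  'D_v rev_normal y = frame_vec Q
    ('D_v logr y * (nu (logr y) * (2 * H + sg (logr y) / rho (logr y)) / sg (logr y)) * dir0 y + sg (logr y) * 'D_v dir0 y)
    ('D_v logr y * (nu (logr y) * (2 * H + sg (logr y) / rho (logr y)) / sg (logr y)) * dir1 y + sg (logr y) * 'D_v dir1 y)
    ('D_v logr y * - (2 * H + sg (logr y) / rho (logr y))).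
Proof.
move=> Ay; have [_ Iy] := Ay.
case: (prof) => _ _ _ /(_ _ Iy)[_ _ _ [_ dn ds]].
exact: (@derive_rev sg nu _ _ 0 y v Ay ds dn).
Qed.

Lemma rev_jacobian (G : 'rV[R]_2 -> 'rV[R]_3) y v : smooth_on annulus G -> annulus y ->
  v *m jacobian G y = 'D_v G y.
Proof. by move=> sG Ay; rewrite -deriveEjacobian //; exact: (smooth_differentiable sG Ay). Qed.

Lemma dir_derive_orth y v : annulus y ->
  dir0 y * 'D_v (dir0 : 'rV[R]_2 -> R^o) y + dir1 y * 'D_v (dir1 : 'rV[R]_2 -> R^o) y = 0.
Proof.
move=> [y0 _]; rewrite derive_dir0 // derive_dir1 //.
have [_ ->] := derive_logr v y0; rewrite /dir0 /dir1 /sqnorm in y0 *.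
have yn0 := lt0r_neq0 y0; by field.
Qed.

(** The equation for the derivative of [rho] makes the contribution of the radial
direction vanish; the angular one is orthogonal to the direction. *)
Lemma rev_normal_orth y : annulus y -> jacobian rev_imm y *m (rev_normal y)^T = 0.
Proof.
move=> Ay; apply: eq0_mulmxl => v.
rewrite mulmxA (rev_jacobian _ rev_imm_smooth Ay) (derive_rev_imm _ Ay).
apply/rowP => i; rewrite ord1 [RHS]mxE.
rewrite -[LHS]/(dot _ (rev_normal y)) /rev_normal add0r (dot_frame_vec oQ).
have [y0 Iy] := Ay; have u1 := dir_unit y0; have orth := dir_derive_orth v Ay.
case: (prof) => _ _ _ /(_ _ Iy)[_ s0 _ _]; have sn0 := lt0r_neq0 s0.
move: orth u1; move: ('D_v dir0 y) ('D_v dir1 y) ('D_v logr y) => d0 d1 tau orth u1.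
transitivity (- nu (logr y) * tau * (dir0 y ^+ 2 + dir1 y ^+ 2)
   + rho (logr y) * sg (logr y) * (dir0 y * d0 + dir1 y * d1) + tau * nu (logr y)).
  by field.
by rewrite u1 orth; ring.
Qed.

Lemma rev_normal_unit y : annulus y -> dot (rev_normal y) (rev_normal y) = 1.
Proof.
move=> [y0 Iy]; rewrite /rev_normal add0r (dot_frame_vec oQ).
case: (prof) => _ _ _ /(_ _ Iy)[_ _ e _].
have u1 := dir_unit y0.
transitivity (sg (logr y) ^+ 2 * (dir0 y ^+ 2 + dir1 y ^+ 2) + nu (logr y) ^+ 2); first by ring.
by rewrite u1 mulr1.
Qed.

Lemma rev_imm_rank y : annulus y -> row_free (jacobian rev_imm y).
Proof.
move=> Ay; apply: inj_row_free => v.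
rewrite (rev_jacobian _ rev_imm_smooth Ay) (derive_rev_imm _ Ay).
have [y0 Iy] := Ay; case: (prof) => _ _ _ /(_ _ Iy)[r0 _ _ _].
have -> : 0 = frame_vec Q 0 0 0 by rewrite /frame_vec !scale0r !addr0.
move=> /(frame_vec_inj oQ)[+ + tau0]; rewrite tau0 !mul0r !add0r.
rewrite derive_dir0 // derive_dir1 // tau0 !mulr0 !subr0.
have ex : expR (- logr y) != 0 by rewrite expR_eq0.
move=> /eqP; rewrite !mulf_eq0 (negbTE r0) (negbTE ex) /= => /eqP v0.
move=> /eqP; rewrite !mulf_eq0 (negbTE r0) (negbTE ex) /= => /eqP v1.
by apply: row2P; rewrite ?v0 ?v1 mxE.
Qed.

Variable u0 : set_type annulus.

Definition revolution_surface : immersed_surface R :=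
  planar_immersion annulus_open u0 rev_imm_smooth rev_normal_smooth
    rev_imm_rank rev_normal_unit rev_normal_orth.

(** The radial and the angular direction are principal, with curvatures
2H + sg/rho and - sg/rho. *)
Lemma revolution_cmc : constant_mean_curvature revolution_surface.
Proof.
apply: (@planar_cmc R _ _ _ _ _ _ _ _ _ _ H) => y Ay; have [y0 Iy] := Ay.
case: (prof) => _ _ _ /(_ _ Iy)[r0 s0 e _]; have sn0 := lt0r_neq0 s0.
have yn0 := lt0r_neq0 y0.
have Dl (v : 'rV[R]_2) : 'D_v logr y = (y 0 0 * v 0 0 + y 0 1 * v 0 1) / sqnorm y.
  by have [_] := derive_logr v y0.
(* the radial and the angular direction at y *)
exists y, (row2 (- y 0 1) (y 0 0)), (2 * H + sg (logr y) / rho (logr y)), (- (sg (logr y) / rho (logr y))).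
split.
- rewrite row2_1 row2_0 (_ : _ - _ = sqnorm y) //.
  by rewrite /sqnorm; ring.
- rewrite (derive_rev_normal _ Ay) (derive_rev_imm _ Ay) -scaleNr frame_vecZ.
  rewrite derive_dir0 // derive_dir1 // Dl.
  have -> : (y 0 0 * y 0 0 + y 0 1 * y 0 1) / sqnorm y = 1 by rewrite /sqnorm -!expr2 divff.
  by rewrite !mulr1 !subrr !mulr0 !addr0; congr frame_vec; field; rewrite ?sn0 ?r0.
- rewrite (derive_rev_normal _ Ay) (derive_rev_imm _ Ay) -scaleNr frame_vecZ.
  rewrite derive_dir0 // derive_dir1 // Dl row2_1 row2_0.
  have -> : (y 0 0 * - y 0 1 + y 0 1 * y 0 0) / sqnorm y = 0.
    by rewrite (_ : _ + _ = 0) ?mul0r //; ring.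
  by rewrite !mulr0 !mul0r !subr0 !add0r; congr frame_vec; field; rewrite ?sn0 ?r0.
- by rewrite addrK.
Qed.

End revolution.

Section revolution_delaunay_surface.
Context {R : realType} (H : R) (I : set R) (rho nu sg : R -> R).
Hypothesis prof : profile H I rho nu sg.
Variables (o : 'rV[R]_3) (Q : 'M[R]_3).
Hypothesis oQ : Q *m Q^T = 1%:M.

Lemma annulus_polar t a b : I t -> a ^+ 2 + b ^+ 2 = 1 ->
  annulus I (row2 (expR t * a) (expR t * b)).
Proof.
move=> It ab; have [e1 e2] := polar_logr t ab.
by split; rewrite ?e1 ?e2 // exprn_gt0 // expR_gt0.
Qed.

Lemma rev_imm_polar t a b : I t -> a ^+ 2 + b ^+ 2 = 1 ->
  rev_imm rho o Q (row2 (expR t * a) (expR t * b)) = o + frame_vec Q (rho t * a) (rho t * b) t.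
Proof.
move=> It ab; have [_ e2] := polar_logr t ab; have [e3 e4] := polar_dir t ab.
by rewrite /rev_imm e2 e3 e4.
Qed.

(** Every point is joined to one base point by a path along which the logarithm of
the modulus and an argument are affine. *)
Lemma annulus_connected : connected (annulus I).
Proof.
have iI : is_interval I by case: prof.
have [[y0 Ay0]|n] := pselect (exists y, annulus I y); last first.
  have -> : annulus I = set0 by rewrite -subset0 => y Ay; apply: n; exists y.
  exact: connected0.
have [_ It0] := Ay0; set t0 := logr y0 in It0.
pose ang (y : 'rV[R]_2) : R := if pselect (exists th, cos th = dir0 y /\ sin th = dir1 y) is left e
  then sval (cid e) else 0.
pose path (y : 'rV[R]_2) (s : R^o) : 'rV[R]_2 :=
  row2 (expR (t0 + s * (logr y - t0)) * cos (s * ang y)) (expR (t0 + s * (logr y - t0)) * sin (s * ang y)).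
have path0 y : path y 0 = row2 (expR t0 * 1) (expR t0 * 0).
  by rewrite /path !mul0r addr0 cos0 sin0.
have path1 y : annulus I y -> path y 1 = y.
  move=> [y1 Iy]; rewrite /path !mul1r subrKC /ang.
  case: pselect => [e|]; last by move=> /(_ (unit_circle_angle (dir_unit y1))).
  case: cid => th /= [-> ->]; apply: row2P; rewrite ?row2_0 ?row2_1 /dir0 /dir1 expRN;
  have := expR_eq0 (logr y) => hn; by field; rewrite hn.
have pathA y s : annulus I y -> 0 <= s <= 1 -> annulus I (path y s).
  move=> [y1 Iy] /andP[s0 s1]; apply: annulus_polar; last exact: cos2Dsin2.
  have [tt|tt] := leP t0 (logr y).
    apply: (iI t0 (logr y)) => //; rewrite lerDl mulr_ge0 ?subr_ge0 //=.
    by rewrite -lerBrDl ler_piMl ?subr_ge0.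
  apply: (iI (logr y) t0) => //; rewrite gerDl mulr_ge0_le0 ?subr_le0 ?(ltW tt) // andbT.
  by rewrite -lerBlDl ler_niMl // subr_le0 ltW.
have cpath y : continuous (path y).
  move=> s.
  have dl (k c : R) : is_derive s (1 : R) (fun u : R => c + u * k) k.
    apply: is_derive_eq (is_deriveD (is_derive_cst c s (1 : R))
      (is_deriveM (is_derive_id s (1 : R)) (is_derive_cst k s (1 : R)))) _.
    by rewrite /GRing.scale /=; ring.
  have cl (k c : R) : {for s, continuous (fun u : R => c + u * k)} by exact: is_derive_continuous (dl k c).
  have c0 (k : R) : {for s, continuous (fun u : R => u * k)}.
    by have := cl k 0; congr continuous_at; apply/funext => u; rewrite add0r.
  have ce : {for s, continuous (fun u : R => expR (t0 + u * (logr y - t0)))}.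
    exact: (continuous_comp (cl _ _) (@continuous_expR R _)).
  have cc : {for s, continuous (fun u : R => cos (u * ang y))}.
    exact: (continuous_comp (c0 _) (@continuous_cos R _)).
  have cs : {for s, continuous (fun u : R => sin (u * ang y))}.
    exact: (continuous_comp (c0 _) (@continuous_sin R _)).
  have e1 := @continuousM R _ _ _ _ ce cc; have e2 := @continuousM R _ _ _ _ ce cs.
  have -> : path y = (fun u : R^o => (expR (t0 + u * (logr y - t0)) * cos (u * ang y)) *: row2 1 0) +
      (fun u : R^o => (expR (t0 + u * (logr y - t0)) * sin (u * ang y)) *: row2 0 1).
    by apply/funext => u; rewrite !fctE; apply: row2P; rewrite /path !mxE /=; ring.
  by apply: continuousD; apply: continuousZr_tmp.
have -> : annulus I = \bigcup_(y in annulus I) (path y @` `[0, 1]).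
  apply/seteqP; split=> [y Ay|z [y Ay [s]]].
    by exists y => //; exists 1; rewrite ?path1 //= in_itv /= ler01 lexx.
  by rewrite /= in_itv /= => s01 <-; exact: pathA.
apply: bigcup_connected.
  exists (row2 (expR t0 * 1) (expR t0 * 0)) => y Ay; exists 0; last exact: path0.
  by rewrite /= in_itv /= lexx ler01.
move=> y Ay; apply: connected_continuous_connected; first exact: segment_connected.
exact: continuous_subspaceT.
Qed.

Variable u0 : set_type (annulus I).
Local Notation S := (revolution_surface prof o oQ u0).

Lemma revolution_is_revolution : surface_of_revolution S.
Proof.
have [oI iI [sr _ _] h] := prof.
exists o, Q, I, (fun t => row2 (rho t) t); split=> //.
- by split=> //; exists (logr (val u0)); have [] := planar_valU u0.
- apply: (smooth_row oI) => -[[|[|//]] hi].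
    by apply: (smooth_ext oI _ sr) => t _; rewrite mxE.
  by apply: (smooth_ext oI _ (smooth_id oI)) => t _; rewrite mxE.
- move=> t It; have [_ _ _ [dr _ _]] := h t It.
  have d (i : 'I_2) : derivable (fun s : R^o => row2 (rho s) s 0 i : R^o) t 1.
    case: i => -[|[|//]] hi.
      have -> : (fun s : R^o => row2 (rho s) s 0 (Ordinal hi) : R^o) = rho.
        by apply/funext => s; rewrite mxE.
      by case: dr.
    have -> : (fun s : R^o => row2 (rho s) s 0 (Ordinal hi) : R^o) = id.
      by apply/funext => s; rewrite mxE.
    exact: derivable_id.
  have dd : derivable (fun s : R^o => row2 (rho s) s) t 1.
    by apply/derivable_mxP => i j; rewrite ord1; exact: d.
  apply/eqP => /(congr1 (fun M : 'rV[R]_2 => M 0 1)).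
  rewrite derive_mx // !mxE.
  have -> : (fun s : R^o => row2 (rho s) s 0 1 : R^o) = id.
    by apply/funext => s; rewrite mxE.
  by rewrite derive_id => /eqP; rewrite oner_eq0.
rewrite planar_range; apply/seteqP; split=> q.
  move=> [y [y0 Iy] <-]; have [th [e1 e2]] := unit_circle_angle (dir_unit y0).
  exists (logr y), th; split=> //.
  by rewrite row2_0 row2_1 e1 e2 /rev_imm /frame_vec !addrA.
move=> [t [th [It ->]]]; have ab := cos2Dsin2 th.
exists (row2 (expR t * cos th) (expR t * sin th)); first exact: annulus_polar.
by rewrite rev_imm_polar // row2_0 row2_1 /frame_vec !addrA.
Qed.

Lemma revolution_delaunay : delaunay_surface S.
Proof.
split; [exact: planar_connected annulus_connected|exact: revolution_is_revolution|].
exact: revolution_cmc.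
Qed.

Lemma smooth_dot_frame (V : normedModType R) (U : set V) (f : V -> 'rV[R]_3) (q p : 'rV[R]_3) :
  open U -> smooth_on U f -> smooth_on U (fun x => dot (f x - q) p : R^o).
Proof.
move=> oU sf.
have s i : smooth_on U (fun x => (f x 0 i - q 0 i) * p 0 i : R^o).
  apply: (smoothM oU); last exact: smooth_cst.
  by apply: (smoothB oU); [exact: smooth_coord|exact: smooth_cst].
apply: (smooth_ext oU _ (smoothD oU (smoothD oU (s 0) (s 1)) (s ord_max))) => x _.
by rewrite dotE !mxE.
Qed.

(** The factor map takes the height as logarithm of the modulus, and as direction
the horizontal position divided by the signed radius; the position is therefore
recovered even where the radius is negative. *)
Lemma part_of_revolution (M : immersed_surface R) :
  (forall p : M, I (dot (imm p - o) (row ord_max Q)) /\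
     dot (imm p - o) (row 0 Q) ^+ 2 + dot (imm p - o) (row 1 Q) ^+ 2 =
       rho (dot (imm p - o) (row ord_max Q)) ^+ 2) ->
  part_of M S.
Proof.
move=> h.
pose z (p : M) := dot (imm p - o) (row ord_max Q).
pose a (p : M) := dot (imm p - o) (row 0 Q) / rho (z p).
pose b (p : M) := dot (imm p - o) (row 1 Q) / rho (z p).
have r0 p : rho (z p) != 0.
  by have [Iz _] := h p; case: prof => _ _ _ /(_ _ Iz)[].
have ab p : a p ^+ 2 + b p ^+ 2 = 1.
  have [Iz e] := h p; have r := r0 p.
  transitivity ((dot (imm p - o) (row 0 Q) ^+ 2 + dot (imm p - o) (row 1 Q) ^+ 2) / rho (z p) ^+ 2).
    by rewrite /a /b; field.
  by rewrite e divff // expf_neq0.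
have oC (c : chart R M) : open (coord c @` dom c) by exact: (@img_open _ _ c).
apply: (@planar_part_of R _ _ _ _ _ _ _ _ _ _ M
  (fun p => row2 (expR (z p) * a p) (expR (z p) * b p))).
- by move=> p; have [Iz _] := h p; exact: annulus_polar.
- move=> p; have [Iz _] := h p; rewrite rev_imm_polar //.
  rewrite -[LHS](subrKC o) [imm p - o](frame_vec_dot oQ); congr (_ + frame_vec _ _ _ _).
    by rewrite /a; field; exact: r0.
  by rewrite /b; field; exact: r0.
- move=> c Ac.
  have si := imm_smooth Ac.
  have sz : smooth_on (coord c @` dom c) (fun y => z (param c y) : R^o).
    exact: (smooth_dot_frame _ _ (oC c) si).
  have sr : smooth_on (coord c @` dom c) (fun y => rho (z (param c y)) : R^o).
    case: prof => _ _ [sr _ _] _.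
    apply: (smooth_comp (oC c) _ sr sz) => y _.
    by have [] := h (param c y).
  have sq (q : 'rV[R]_3) : smooth_on (coord c @` dom c)
      (fun y => expR (z (param c y)) * (dot (imm (param c y) - o) q / rho (z (param c y))) : R^o).
    apply: (smoothM (oC c)); first exact: (smooth_expR (oC c)).
    apply: (smoothM (oC c)); first exact: (smooth_dot_frame _ _ (oC c) si).
    by apply: (smoothV (oC c)).
  apply: (smooth_row (oC c)) => -[[|[|//]] hi].
    by apply: (smooth_ext (oC c) _ (sq (row 0 Q))) => y _; rewrite mxE.
  by apply: (smooth_ext (oC c) _ (sq (row 1 Q))) => y _; rewrite mxE.
Qed.

End revolution_delaunay_surface.

(** * The plane *)

Section plane.
Context {R : realType} (o : 'rV[R]_3) (Q : 'M[R]_3).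
Hypothesis oQ : Q *m Q^T = 1%:M.

Definition plane_imm (y : 'rV[R]_2) : 'rV[R]_3 := o + frame_vec Q (y 0 0) (y 0 1) 0.
Definition plane_normal (y : 'rV[R]_2) : 'rV[R]_3 := frame_vec Q 0 0 1.

Lemma plane_imm_smooth : smooth_on setT plane_imm.
Proof.
have s i := smooth_coord (@openT 'rV[R]_2) i (smooth_id (@openT _)).
exact: (@smooth_frame_vec R Q _ setT openT _ _ (fun=> 0) o (s 0) (s 1) (smooth_cst _ _)).
Qed.

Lemma plane_normal_smooth : smooth_on setT plane_normal.
Proof. exact: smooth_cst. Qed.

Lemma derive_plane_imm y v : 'D_v plane_imm y = frame_vec Q (v 0 0) (v 0 1) 0.
Proof.
have d i := differentiable_coord y 0 i.
rewrite (@derive_frame_vec R Q _ _ _ (fun=> 0) o y v (d 0) (d 1) (differentiable_cst _ _)).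
rewrite (@derive_val _ _ _ _ _ _ _ (derive_coordinate y v 0)).
by rewrite (@derive_val _ _ _ _ _ _ _ (derive_coordinate y v 1)) derive_cst.
Qed.

Lemma plane_jacobian y v : v *m jacobian plane_imm y = frame_vec Q (v 0 0) (v 0 1) 0.
Proof.
have d := smooth_differentiable plane_imm_smooth (I : [set: 'rV[R]_2] y).
by rewrite -(derive_plane_imm y) (deriveEjacobian v d).
Qed.

Lemma plane_imm_rank y : [set: 'rV[R]_2] y -> row_free (jacobian plane_imm y).
Proof.
move=> _; apply: inj_row_free => v; rewrite plane_jacobian.
have -> : 0 = frame_vec Q 0 0 0 by rewrite /frame_vec !scale0r !addr0.
by move=> /(frame_vec_inj oQ)[v0 v1 _]; apply: row2P; rewrite ?v0 ?v1 mxE.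
Qed.

Lemma plane_normal_unit y : [set: 'rV[R]_2] y -> dot (plane_normal y) (plane_normal y) = 1.
Proof. by move=> _; rewrite (dot_frame_vec oQ); ring. Qed.

Lemma plane_normal_orth y : [set: 'rV[R]_2] y -> jacobian plane_imm y *m (plane_normal y)^T = 0.
Proof.
move=> _; apply: eq0_mulmxl => v; rewrite mulmxA plane_jacobian.
apply/rowP => i; rewrite ord1 [RHS]mxE -[LHS]/(dot _ (plane_normal y)) (dot_frame_vec oQ).
by ring.
Qed.

Let u0 : set_type [set: 'rV[R]_2] := SigSub (mem_set (I : [set: 'rV[R]_2] 0)).

Definition plane_surface : immersed_surface R :=
  planar_immersion openT u0 plane_imm_smooth plane_normal_smooth
    plane_imm_rank plane_normal_unit plane_normal_orth.

Lemma plane_connected : connected [set: 'rV[R]_2].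
Proof.
have -> : [set: 'rV[R]_2] = \bigcup_(y in [set: 'rV[R]_2]) ((fun s : R^o => s *: y) @` `[0, 1]).
  apply/seteqP; split=> // y _; exists y => //; exists 1; last by rewrite scale1r.
  by rewrite /= in_itv /= ler01 lexx.
apply: bigcup_connected.
  exists 0 => y _; exists 0; last by rewrite scale0r.
  by rewrite /= in_itv /= lexx ler01.
move=> y _; apply: connected_continuous_connected; first exact: segment_connected.
by apply: continuous_subspaceT => s; exact: scalel_continuous.
Qed.

Lemma plane_delaunay : delaunay_surface plane_surface.
Proof.
split.
- exact: planar_connected plane_connected.
- exists o, Q, setT, (fun t => row2 t 0); split=> //.
  + by split; [|exact: openT|exists 0].
  + apply: (smooth_row openT) => -[[|[|//]] hi].
      by apply: (smooth_ext openT _ (smooth_id openT)) => t _; rewrite mxE.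
    by apply: (smooth_ext openT _ (smooth_cst setT (0 : R^o))) => t _; rewrite mxE.
  + move=> t _.
    have -> : (fun s : R^o => row2 s 0) = (fun s : R^o => s *: row2 1 0).
      by apply/funext => s; apply: row2P; rewrite !mxE /= ?mulr1 ?mulr0.
    have d : differentiable (fun s : R^o => s *: row2 (1 : R) 0) (t : R^o).
      exact: (@ex_diff _ _ _ _ _ _ _ (is_diff_scalel t (row2 (1 : R) 0))).
    rewrite (deriveE _ d) (@diff_val _ _ _ _ _ _ _ (is_diff_scalel t (row2 (1 : R) 0))).
    rewrite scale1r; apply/eqP => /(congr1 (fun M : 'rV[R]_2 => M 0 0)).
    by rewrite row2_0 mxE => /eqP; rewrite oner_eq0.
  + rewrite planar_range; apply/seteqP; split=> q.
      move=> [y _ <-]; pose r := Num.sqrt (y 0 0 ^+ 2 + y 0 1 ^+ 2).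
      have [r0|r0] := eqVneq r 0.
        exists 0, 0; split=> //; rewrite row2_0 row2_1 !mul0r !scale0r !addr0.
        have /eqP : r ^+ 2 = 0 by rewrite r0 expr0n.
        rewrite sqr_sqrtr ?addr_ge0 ?sqr_ge0 // paddr_eq0 ?sqr_ge0 // !sqrf_eq0.
        move=> /andP[/eqP y0 /eqP y1].
        by rewrite /plane_imm /frame_vec y0 y1 !scale0r !addr0.
      have re : r ^+ 2 = y 0 0 ^+ 2 + y 0 1 ^+ 2 by rewrite sqr_sqrtr // addr_ge0 ?sqr_ge0.
      have [th [c s]] : exists th, cos th = y 0 0 / r /\ sin th = y 0 1 / r.
        apply: unit_circle_angle; rewrite !exprMn -mulrDl -re exprVn divff //.
        exact: expf_neq0.
      exists r, th; split=> //; rewrite row2_0 row2_1 c s /plane_imm /frame_vec !addrA.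
      by congr (_ + _ *: _ + _ *: _ + _ ); field.
    move=> [t [th [_ ->]]]; exists (row2 (t * cos th) (t * sin th)) => //.
    by rewrite /plane_imm /frame_vec !row2_0 !row2_1 !addrA.
- apply: (@planar_cmc R _ _ _ _ _ _ _ _ _ _ 0) => y _.
  exists (row2 1 0), (row2 0 1), 0, 0; split.
  + by rewrite !row2_0 !row2_1 mulr1 mulr0 subr0 oner_neq0.
  + by rewrite scale0r oppr0 derive_cst.
  + by rewrite scale0r oppr0 derive_cst.
  + by rewrite addr0 mulr0.
Qed.

Lemma part_of_plane (M : immersed_surface R) :
  (forall p : M, dot (imm p - o) (row ord_max Q) = 0) -> part_of M plane_surface.
Proof.
move=> h.
have oC (c : chart R M) : open (coord c @` dom c) by exact: (@img_open _ _ c).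
apply: (@planar_part_of R _ _ _ _ _ _ _ _ _ _ M
  (fun p => row2 (dot (imm p - o) (row 0 Q)) (dot (imm p - o) (row 1 Q)))) => //.
  move=> p; rewrite /plane_imm row2_0 row2_1.
  by rewrite -[LHS](subrKC o) [imm p - o in LHS](frame_vec_dot oQ) h.
move=> c Ac; have si := imm_smooth Ac.
apply: (smooth_row (oC c)) => -[[|[|//]] hi].
  by apply: (smooth_ext (oC c) _ (smooth_dot_frame o (row 0 Q) (oC c) si)) => y _; rewrite mxE.
by apply: (smooth_ext (oC c) _ (smooth_dot_frame o (row 1 Q) (oC c) si)) => y _; rewrite mxE.
Qed.

End plane.

(** * Algebra of the structure equations *)

Section algebra.
Context {R : realType}.
Implicit Types (a b c : R).

(** As w is a left eigenvector, the image of A - l is orthogonal to w, and so is g.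
In the plane this makes g an eigenvector, for the other root tr A - l of the
characteristic polynomial. *)
Lemma eigen_complement (A00 A01 A10 A11 w0 w1 g0 g1 l : R) :
  w0 * A00 + w1 * A10 = l * w0 -> w0 * A01 + w1 * A11 = l * w1 ->
  w0 * g0 + w1 * g1 = 0 -> (w0 != 0) || (w1 != 0) ->
  A00 * g0 + A01 * g1 = (A00 + A11 - l) * g0 /\
  A10 * g0 + A11 * g1 = (A00 + A11 - l) * g1.
Proof.
move=> e0 e1 eg wn.
suff [h0 h1] : A01 * g1 - (A11 - l) * g0 = 0 /\ A10 * g0 - (A00 - l) * g1 = 0.
  by split; apply/eqP; rewrite -subr_eq0; apply/eqP; [rewrite -h0|rewrite -h1]; ring.
have [z0|w00] := eqVneq w0 0.
  have w10 : w1 != 0 by move: wn; rewrite z0 eqxx.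
  rewrite z0 !mul0r !add0r in e0 e1 eg.
  have g1z : g1 = 0 by move/eqP: eg; rewrite mulf_eq0 (negbTE w10) => /eqP.
  have a10 : A10 = 0 by move/eqP: e0; rewrite mulr0 mulf_eq0 (negbTE w10) => /eqP.
  have a11 : A11 = l by apply: (mulfI w10); rewrite e1 mulrC.
  by rewrite g1z a10 a11; split; ring.
split; apply: (mulfI w00); rewrite mulr0.
  transitivity (g1 * (w0 * A01 + w1 * A11 - l * w1) - (A11 - l) * (w0 * g0 + w1 * g1)).
    by ring.
  by rewrite e1 eg; ring.
transitivity (A10 * (w0 * g0 + w1 * g1) - g1 * (w0 * A00 + w1 * A10 - l * w0)).
  by ring.
by rewrite e0 eg; ring.
Qed.

Section first_order.
(* n is the unit normal, A the shape operator in a chart and w the coordinates of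
  the tangent part of e; fij and mij are the j-th partial derivatives of the i-th
  coordinates of the immersion and of the normal. *)
Variables (n0 n1 n2 l w0 w1 : R) (A00 A01 A10 A11 : R).
Variables (f00 f01 f10 f11 f20 f21 m00 m01 m10 m11 m20 m21 : R).
Hypothesis orth0 : n0 * f00 + n1 * f10 + n2 * f20 = 0.
Hypothesis orth1 : n0 * f01 + n1 * f11 + n2 * f21 = 0.
Hypothesis unit0 : n0 * m00 + n1 * m10 + n2 * m20 = 0.
Hypothesis unit1 : n0 * m01 + n1 * m11 + n2 * m21 = 0.
Hypothesis sym : m00 * f01 + m10 * f11 + m20 * f21 = m01 * f00 + m11 * f10 + m21 * f20.
Hypothesis wf0 : w0 * f00 + w1 * f01 = - n2 * n0.
Hypothesis wf1 : w0 * f10 + w1 * f11 = - n2 * n1.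
Hypothesis wf2 : w0 * f20 + w1 * f21 = 1 - n2 * n2.
Hypothesis s0 : 1 - n2 * n2 != 0.
Hypothesis eA0 : w0 * A00 + w1 * A10 = l * w0.
Hypothesis eA1 : w0 * A01 + w1 * A11 = l * w1.
Hypothesis A_00 : m00 = - (A00 * f00 + A01 * f01).
Hypothesis A_01 : m01 = - (A10 * f00 + A11 * f01).
Hypothesis A_10 : m10 = - (A00 * f10 + A01 * f11).
Hypothesis A_11 : m11 = - (A10 * f10 + A11 * f11).
Hypothesis A_20 : m20 = - (A00 * f20 + A01 * f21).
Hypothesis A_21 : m21 = - (A10 * f20 + A11 * f21).

Let wm0 : w0 * m00 + w1 * m01 = l * n2 * n0.
Proof.
transitivity (- ((w0 * A00 + w1 * A10) * f00 + (w0 * A01 + w1 * A11) * f01)).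
  by rewrite A_00 A_01; ring.
rewrite eA0 eA1; transitivity (- l * (w0 * f00 + w1 * f01)); first by ring.
by rewrite wf0; ring.
Qed.
Let wm1 : w0 * m10 + w1 * m11 = l * n2 * n1.
Proof.
transitivity (- ((w0 * A00 + w1 * A10) * f10 + (w0 * A01 + w1 * A11) * f11)).
  by rewrite A_10 A_11; ring.
rewrite eA0 eA1; transitivity (- l * (w0 * f10 + w1 * f11)); first by ring.
by rewrite wf1; ring.
Qed.
Let wm2 : w0 * m20 + w1 * m21 = - l * (1 - n2 * n2).
Proof.
transitivity (- ((w0 * A00 + w1 * A10) * f20 + (w0 * A01 + w1 * A11) * f21)).
  by rewrite A_20 A_21; ring.
rewrite eA0 eA1; transitivity (- l * (w0 * f20 + w1 * f21)); first by ring.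
by rewrite wf2; ring.
Qed.

Let key (p0 p1 p2 q0 q1 q2 : R) : n0 * q0 + n1 * q1 + n2 * q2 = 0 ->
  n0 * p0 + n1 * p1 + n2 * p2 = 0 ->
  p0 * (w0 * f00 + w1 * f01) + p1 * (w0 * f10 + w1 * f11) + p2 * (w0 * f20 + w1 * f21) =
  (w0 * m00 + w1 * m01) * q0 + (w0 * m10 + w1 * m11) * q1 + (w0 * m20 + w1 * m21) * q2 ->
  p2 = - l * q2.
Proof.
move=> nq np; rewrite wf0 wf1 wf2 wm0 wm1 wm2 => e.
apply/eqP; rewrite -subr_eq0; apply/eqP.
transitivity ((p0 * (- n2 * n0) + p1 * (- n2 * n1) + p2 * (1 - n2 * n2)) -
  (l * n2 * n0 * q0 + l * n2 * n1 * q1 + - l * (1 - n2 * n2) * q2) +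
  n2 * (n0 * p0 + n1 * p1 + n2 * p2) + l * n2 * (n0 * q0 + n1 * q1 + n2 * q2)).
  by ring.
by rewrite np nq e; ring.
Qed.

(** By symmetry <dn(v), df(w)> = <dn(w), df(v)>. On the left df(w) is the tangent
part of e and yields d nu(v); on the right dn(w) = - l df(w) yields - l dh(v). *)
Lemma first_order_height : m20 = - l * f20 /\ m21 = - l * f21.
Proof.
split.
  apply: (key orth0 unit0).
  transitivity (w0 * (m00 * f00 + m10 * f10 + m20 * f20) + w1 * (m00 * f01 + m10 * f11 + m20 * f21)).
    by ring.
  by rewrite sym; ring.
apply: (key orth1 unit1).
transitivity (w0 * (m01 * f00 + m11 * f10 + m21 * f20) + w1 * (m01 * f01 + m11 * f11 + m21 * f21)).
  by ring.
by rewrite -sym; ring.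
Qed.

(** The form n0 df1 - n1 df0 pairs df with the horizontal tangent direction. It
vanishes on w, because df(w) is the tangent part of e; so [eigen_complement]
applies to it. *)
Lemma first_order_angle :
  n0 * m10 - n1 * m00 = - (A00 + A11 - l) * (n0 * f10 - n1 * f00) /\
  n0 * m11 - n1 * m01 = - (A00 + A11 - l) * (n0 * f11 - n1 * f01).
Proof.
have wn : (w0 != 0) || (w1 != 0).
  rewrite -negb_and; apply/negP => /andP[/eqP z0 /eqP z1].
  by move: s0; rewrite -wf2 z0 z1 !mul0r addr0 eqxx.
have wg : w0 * (n0 * f10 - n1 * f00) + w1 * (n0 * f11 - n1 * f01) = 0.
  transitivity (n0 * (w0 * f10 + w1 * f11) - n1 * (w0 * f00 + w1 * f01)); first by ring.
  by rewrite wf0 wf1; ring.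
have [h0 h1] := eigen_complement eA0 eA1 wg wn.
by rewrite !mulNr -h0 -h1 A_00 A_01 A_10 A_11; split; ring.
Qed.
End first_order.

Section structure_algebra.
Variables (n0 n1 n2 H mu : R).
(* hj and uj are the derivatives of the height and of mu in two directions, fij and
  mij those of the horizontal coordinates of the immersion and of the normal. *)
Variables (h0 h1 f00 f01 f10 f11 m00 m01 m10 m11 u0 u1 : R).
Let l := 2 * H - mu.
Let g0 := n0 * f10 - n1 * f00.
Let g1 := n0 * f11 - n1 * f01.
Hypothesis orth0 : n0 * f00 + n1 * f10 = - n2 * h0.
Hypothesis orth1 : n0 * f01 + n1 * f11 = - n2 * h1.
Hypothesis unit0 : n0 * m00 + n1 * m10 = n2 * l * h0.
Hypothesis unit1 : n0 * m01 + n1 * m11 = n2 * l * h1.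
Hypothesis ang0 : n0 * m10 - n1 * m00 = - mu * g0.
Hypothesis ang1 : n0 * m11 - n1 * m01 = - mu * g1.
Hypothesis closed_nu : u0 * h1 = u1 * h0.
Hypothesis closed_ang : 2 * (m01 * m10 - m11 * m00) + u1 * g0 - u0 * g1 +
  mu * (m01 * f10 - m11 * f00 - m00 * f11 + m10 * f01) = 0.
Hypothesis indep : h0 * g1 - h1 * g0 != 0.

(** The two closedness hypotheses determine the values of d mu on the independent
forms dh and n0 df1 - n1 df0. The identities come from multiplying out products
of the complex numbers n0 + i n1, f0 + i f1 and m0 + i m1. *)
Lemma codazzi_algebra :
  (n0 * n0 + n1 * n1) * u0 = 2 * mu * n2 * (H - mu) * h0 /\
  (n0 * n0 + n1 * n1) * u1 = 2 * mu * n2 * (H - mu) * h1.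
Proof.
set s := n0 * n0 + n1 * n1; set k := 2 * mu * n2 * (H - mu).
have e1 : s * (m01 * m10 - m11 * m00) = n2 * l * mu * (h0 * g1 - h1 * g0).
  transitivity ((n0 * m01 + n1 * m11) * (n0 * m10 - n1 * m00) -
     (n0 * m11 - n1 * m01) * (n0 * m00 + n1 * m10)); first by rewrite /s; ring.
  by rewrite unit0 unit1 ang0 ang1; ring.
have e2 : s * (m01 * f10 - m11 * f00 - m00 * f11 + m10 * f01) = - n2 * (l + mu) * (h0 * g1 - h1 * g0).
  transitivity ((n0 * m01 + n1 * m11) * g0 - (n0 * m11 - n1 * m01) * (n0 * f00 + n1 * f10)
    - ((n0 * m00 + n1 * m10) * g1 - (n0 * m10 - n1 * m00) * (n0 * f01 + n1 * f11))).
    by rewrite /s /g0 /g1; ring.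
  by rewrite unit0 unit1 ang0 ang1 orth0 orth1; ring.
have e3 : (s * u0 - k * h0) * g1 = (s * u1 - k * h1) * g0.
  apply/eqP; rewrite -subr_eq0; apply/eqP.
  transitivity (- s * (2 * (m01 * m10 - m11 * m00) + u1 * g0 - u0 * g1 +
    mu * (m01 * f10 - m11 * f00 - m00 * f11 + m10 * f01)) + 2 * (s * (m01 * m10 - m11 * m00))
    + mu * (s * (m01 * f10 - m11 * f00 - m00 * f11 + m10 * f01)) - k * (h0 * g1 - h1 * g0)).
    by ring.
  by rewrite closed_ang e1 e2 /k /l; ring.
have e4 : (s * u0 - k * h0) * h1 = (s * u1 - k * h1) * h0.
  apply/eqP; rewrite -subr_eq0; apply/eqP.
  transitivity (s * (u0 * h1 - u1 * h0)); first by ring.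
  by rewrite closed_nu; ring.
split; apply/eqP; rewrite -subr_eq0; apply/eqP; apply: (mulIf indep); rewrite mul0r.
  transitivity (h0 * ((s * u0 - k * h0) * g1) - g0 * ((s * u0 - k * h0) * h1)); first by ring.
  by rewrite e3 e4; ring.
transitivity (g1 * ((s * u1 - k * h1) * h0) - h1 * ((s * u1 - k * h1) * g0)); first by ring.
by rewrite -e3 -e4; ring.
Qed.
End structure_algebra.

(** The radial component vanishes by the Codazzi equation, the angular one because
mu is the curvature in the horizontal direction. *)
Lemma axis_algebra (n0 n1 n2 H mu h f0 f1 m0 m1 u : R) :
  n0 * n0 + n1 * n1 != 0 -> mu != 0 ->
  n0 * f0 + n1 * f1 = - n2 * h ->
  n0 * m0 + n1 * m1 = n2 * (2 * H - mu) * h ->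
  n0 * m1 - n1 * m0 = - mu * (n0 * f1 - n1 * f0) ->
  (n0 * n0 + n1 * n1) * u = 2 * mu * n2 * (H - mu) * h ->
  f0 + (m0 / mu - n0 * u / mu ^+ 2) = 0 /\ f1 + (m1 / mu - n1 * u / mu ^+ 2) = 0.
Proof.
move=> s0 mu0 orth un ang cod.
have mu20 : mu ^+ 2 != 0 by rewrite expf_neq0.
set s := n0 * n0 + n1 * n1 in s0 cod.
have E1 : n0 * (f0 * mu ^+ 2 + m0 * mu - n0 * u) + n1 * (f1 * mu ^+ 2 + m1 * mu - n1 * u) = 0.
  transitivity (mu ^+ 2 * (n0 * f0 + n1 * f1) + mu * (n0 * m0 + n1 * m1) - s * u).
    by rewrite /s; ring.
  by rewrite orth un cod; ring.
have E2 : n0 * (f1 * mu ^+ 2 + m1 * mu - n1 * u) - n1 * (f0 * mu ^+ 2 + m0 * mu - n0 * u) = 0.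
  transitivity (mu ^+ 2 * (n0 * f1 - n1 * f0) + mu * (n0 * m1 - n1 * m0)); first by ring.
  by rewrite ang; ring.
split; apply: (mulIf mu20); apply: (mulIf s0); rewrite !mul0r.
  transitivity (n0 * (n0 * (f0 * mu ^+ 2 + m0 * mu - n0 * u) + n1 * (f1 * mu ^+ 2 + m1 * mu - n1 * u))
    - n1 * (n0 * (f1 * mu ^+ 2 + m1 * mu - n1 * u) - n1 * (f0 * mu ^+ 2 + m0 * mu - n0 * u))).
    by rewrite /s; field.
  by rewrite E1 E2; ring.
transitivity (n1 * (n0 * (f0 * mu ^+ 2 + m0 * mu - n0 * u) + n1 * (f1 * mu ^+ 2 + m1 * mu - n1 * u))
    + n0 * (n0 * (f1 * mu ^+ 2 + m1 * mu - n1 * u) - n1 * (f0 * mu ^+ 2 + m0 * mu - n0 * u))).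
  by rewrite /s; field.
by rewrite E1 E2; ring.
Qed.

End algebra.

(** * First-order structure in a chart *)

Section chart_tools.
Context {R : realType}.

Lemma smooth_dot (V : normedModType R) (U : set V) (f : V -> 'rV[R]_3) (q : 'rV[R]_3) :
  open U -> smooth_on U f -> smooth_on U (fun x => dot (f x) q : R^o).
Proof.
move=> oU sf; apply: (smooth_ext oU _ (smooth_dot_frame 0 q oU sf)) => x _.
by rewrite subr0.
Qed.

Lemma derive_dot (V : normedModType R) (f : V -> 'rV[R]_3) (q : 'rV[R]_3) x v :
  differentiable f x -> 'D_v (fun y => dot (f y) q : R^o) x = dot ('D_v f x) q.
Proof.
move=> df.
have dc i : is_derive x v (fun y => f y 0 i : R^o) (('D_v f x) 0 i).
  apply: DeriveDef; last exact: derive_coord.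
  apply: diff_derivable; exact: (differentiable_comp df (differentiable_coord _ 0 i)).
have dM i : is_derive x v (fun y => f y 0 i * q 0 i : R^o) (('D_v f x) 0 i * q 0 i).
  apply: is_derive_eq (is_deriveM (dc i) (is_derive_cst (q 0 i : R^o) x v)) _.
  by rewrite scaler0 add0r /GRing.scale /= mulrC.
have h := is_deriveD (is_deriveD (dM 0) (dM 1)) (dM ord_max).
have -> : (fun y => dot (f y) q : R^o) = (fun y => f y 0 0 * q 0 0 : R^o) +
   (fun y => f y 0 1 * q 0 1 : R^o) + (fun y => f y 0 ord_max * q 0 ord_max : R^o).
  by apply/funext => y; rewrite dotE !fctE.
by rewrite (@derive_val _ _ _ _ _ _ _ h) dotE.
Qed.

Lemma dotNl (u v : 'rV[R]_3) : dot (- u) v = - dot u v.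
Proof. by rewrite /dot mulNmx mxE. Qed.

Lemma dot_parseval (Q : 'M[R]_3) (u w : 'rV[R]_3) : Q *m Q^T = 1%:M ->
  dot u w = dot u (row 0 Q) * dot w (row 0 Q) + dot u (row 1 Q) * dot w (row 1 Q)
    + dot u (row ord_max Q) * dot w (row ord_max Q).
Proof. by move=> oQ; rewrite [in LHS](frame_vec_dot oQ u) [in LHS](frame_vec_dot oQ w) dot_frame_vec. Qed.

Lemma dot_mulmx (v : 'rV[R]_2) (P : 'M[R]_(2, 3)) (q : 'rV[R]_3) :
  dot (v *m P) q = v 0 0 * dot (row 0 P) q + v 0 1 * dot (row 1 P) q.
Proof.
rewrite mulmx_sum_row !big_ord_recl big_ord0 addr0.
have -> : lift ord0 ord0 = 1 :> 'I_2 by apply: val_inj.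
by rewrite dotDl !dotZl.
Qed.

Lemma derive_zero_on (V W : normedModType R) (U : set V) (g : V -> W) (k : W) x v :
  open U -> (forall y, U y -> g y = k) -> U x -> 'D_v g x = 0.
Proof.
move=> oU gk Ux; rewrite -(derive_cst k x v); apply: near_eq_derive.
by apply: filterS (open_nbhs_nbhs (conj oU Ux)) => y /gk.
Qed.

Lemma smooth_is_derive (V W : normedModType R) (U : set V) (f : V -> W) x v :
  smooth_on U f -> U x -> is_derive x v f ('D_v f x).
Proof. by move=> sf Ux; apply: derivableP; apply: diff_derivable; exact: smooth_differentiable sf Ux. Qed.

Lemma trace2 (A : 'M[R]_2) : \tr A = A 0 0 + A 1 1.
Proof.
rewrite /mxtrace !big_ord_recl big_ord0 addr0.
by have -> : lift ord0 ord0 = 1 :> 'I_2 by apply: val_inj.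
Qed.

(** The rows of [P] form a basis of the orthogonal complement of [n]. *)
Lemma submx_of_orth (P N : 'M[R]_(2, 3)) (n : 'rV[R]_3) : row_free P ->
  dot n n != 0 -> P *m n^T = 0 -> N *m n^T = 0 -> (N <= P)%MS.
Proof.
move=> rP nn Pn Nn.
have rn : \rank n^T = 1%N.
  apply/eqP; rewrite eqn_leq rank_leq_col lt0n mxrank_eq0.
  apply: contra nn => /eqP n0; rewrite /dot n0 mulmx0 mxE //.
have rk : \rank (kermx n^T) = 2%N by rewrite mxrank_ker rn.
have PK : (P <= kermx n^T)%MS by apply/sub_kermxP.
have NK : (N <= kermx n^T)%MS by apply/sub_kermxP.
have [_ ] := mxrank_leqif_sup PK.
rewrite rk (eqP rP) eqxx => /esym KP.
exact: submx_trans NK KP.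
Qed.
End chart_tools.

Lemma product_rule_rearrange (R : realType) (n0 n1 n2 q0 q1 q2 dn0 dn1 dn2 dq0 dq1 dq2 : R) :
  0 = n0 * dq0 + q0 * dn0 + (n1 * dq1 + q1 * dn1) + (n2 * dq2 + q2 * dn2) ->
  dn0 * q0 + dn1 * q1 + dn2 * q2 = - (n0 * dq0 + n1 * dq1 + n2 * dq2).
Proof.
move=> z; apply/eqP; rewrite -subr_eq0 opprK [X in _ == X]z; apply/eqP; by ring.
Qed.

Lemma square_rule_rearrange (R : realType) (n0 n1 n2 d0 d1 d2 : R) :
  0 = n0 * d0 + n0 * d0 + (n1 * d1 + n1 * d1) + (n2 * d2 + n2 * d2) ->
  n0 * d0 + n1 * d1 + n2 * d2 = 0.
Proof. by move=> z; lra. Qed.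

Section coordinates.
Context {R : realType} (M : immersed_surface R) (Q : 'M[R]_3).
Hypothesis oQ : Q *m Q^T = 1%:M.

Definition pos (i : 'I_3) (p : M) : R := dot (imm p) (row i Q).
Definition nor (i : 'I_3) (p : M) : R := dot (normal p) (row i Q).
Definition in_chart (c : chart R M) (g : M -> R) : 'rV[R]_2 -> R^o := fun y => g (param c y).
Definition cdom (c : chart R M) : set 'rV[R]_2 := coord c @` dom c.

Lemma cdom_open c : open (cdom c). Proof. exact: (@img_open _ _ c). Qed.

Lemma cdom_coord c p : dom c p -> cdom c (coord c p). Proof. by move=> dp; exists p. Qed.

Lemma posE i p : pos i p = dot (imm p) (row i Q). Proof. by []. Qed.
Lemma norE i p : nor i p = dot (normal p) (row i Q). Proof. by []. Qed.
Lemma in_chartE c g y : in_chart c g y = g (param c y). Proof. by []. Qed.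

Section chart.
Variables (c : chart R M) (Ac : atlas c).

Lemma smooth_pos i : smooth_on (cdom c) (in_chart c (pos i)).
Proof. exact: (smooth_dot _ (@cdom_open c) (imm_smooth Ac)). Qed.

Lemma smooth_nor i : smooth_on (cdom c) (in_chart c (nor i)).
Proof. exact: (smooth_dot _ (@cdom_open c) (normal_smooth Ac)). Qed.

Lemma nor_unit p : nor 0 p * nor 0 p + nor 1 p * nor 1 p + nor ord_max p * nor ord_max p = 1.
Proof. by rewrite -(dot_parseval _ _ oQ) normal_unit. Qed.

Lemma derive_pos i p v : dom c p ->
  'D_v (in_chart c (pos i)) (coord c p) = dot (v *m dmx (@imm R M) c p) (row i Q).
Proof.
move=> dp; have d : differentiable (@imm R M \o param c) (coord c p).
  exact: (smooth_differentiable (imm_smooth Ac) (cdom_coord dp)).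
by rewrite /dmx -(deriveEjacobian v d) -(derive_dot _ _ d).
Qed.

Lemma derive_nor i p v : dom c p ->
  'D_v (in_chart c (nor i)) (coord c p) = dot (v *m dmx (@normal R M) c p) (row i Q).
Proof.
move=> dp; have d : differentiable (@normal R M \o param c) (coord c p).
  exact: (smooth_differentiable (normal_smooth Ac) (cdom_coord dp)).
by rewrite /dmx -(deriveEjacobian v d) -(derive_dot _ _ d).
Qed.

(** This is half of the derivative of the squared norm of the normal. *)
Lemma nor_derive_nor y v : cdom c y ->
  in_chart c (nor 0) y * 'D_v (in_chart c (nor 0)) y + in_chart c (nor 1) y * 'D_v (in_chart c (nor 1)) y
   + in_chart c (nor ord_max) y * 'D_v (in_chart c (nor ord_max)) y = 0.
Proof.
move=> Vy.
have dn i := smooth_is_derive v (smooth_nor i) Vy.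
have h := is_deriveD (is_deriveD (is_deriveM (dn 0) (dn 0)) (is_deriveM (dn 1) (dn 1)))
  (is_deriveM (dn ord_max) (dn ord_max)).
have z := @derive_val _ _ _ _ _ _ _ h.
have z0 := @derive_zero_on _ _ _ (cdom c) (in_chart c (nor 0) * in_chart c (nor 0) +
  in_chart c (nor 1) * in_chart c (nor 1) + in_chart c (nor ord_max) * in_chart c (nor ord_max)) 1
  y v (@cdom_open c) (fun z _ => nor_unit (param c z)) Vy.
rewrite z0 in z.
rewrite /GRing.scale /= in z.
exact: square_rule_rearrange z.
Qed.

Lemma nor_derive_pos y v : cdom c y ->
  in_chart c (nor 0) y * 'D_v (in_chart c (pos 0)) y + in_chart c (nor 1) y * 'D_v (in_chart c (pos 1)) y
   + in_chart c (nor ord_max) y * 'D_v (in_chart c (pos ord_max)) y = 0.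
Proof.
move=> [p dp <-]; rewrite !derive_pos // /in_chart coordK //.
have : dot (v *m dmx (@imm R M) c p) (normal p) = 0.
  by rewrite /dot -mulmxA normal_orthogonal // mulmx0 mxE.
rewrite (dot_parseval _ _ oQ) => <-.
by rewrite /nor; ring.
Qed.

(** Differentiate the relation <n, D_b imm> = 0 in the direction [a]: what is left
of <D_a n, D_b imm> is - <n, D_a D_b imm>. *)
Lemma second_form_sym y a b : cdom c y ->
  'D_a (in_chart c (nor 0)) y * 'D_b (in_chart c (pos 0)) y +
  'D_a (in_chart c (nor 1)) y * 'D_b (in_chart c (pos 1)) y +
  'D_a (in_chart c (nor ord_max)) y * 'D_b (in_chart c (pos ord_max)) y =
  'D_b (in_chart c (nor 0)) y * 'D_a (in_chart c (pos 0)) y +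
  'D_b (in_chart c (nor 1)) y * 'D_a (in_chart c (pos 1)) y +
  'D_b (in_chart c (nor ord_max)) y * 'D_a (in_chart c (pos ord_max)) y.
Proof.
move=> Vy.
have half u w : 'D_u (in_chart c (nor 0)) y * 'D_w (in_chart c (pos 0)) y +
  'D_u (in_chart c (nor 1)) y * 'D_w (in_chart c (pos 1)) y +
  'D_u (in_chart c (nor ord_max)) y * 'D_w (in_chart c (pos ord_max)) y =
  - (in_chart c (nor 0) y * 'D_u ('D_w (in_chart c (pos 0))) y +
  in_chart c (nor 1) y * 'D_u ('D_w (in_chart c (pos 1))) y +
  in_chart c (nor ord_max) y * 'D_u ('D_w (in_chart c (pos ord_max))) y).
  have dn i := smooth_is_derive u (smooth_nor i) Vy.
  have df i := smooth_is_derive u (smooth_derive w (smooth_pos i)) Vy.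
  have h := is_deriveD (is_deriveD (is_deriveM (dn 0) (df 0)) (is_deriveM (dn 1) (df 1)))
    (is_deriveM (dn ord_max) (df ord_max)).
  have z := @derive_val _ _ _ _ _ _ _ h.
  have z0 := @derive_zero_on _ _ _ (cdom c) (in_chart c (nor 0) * 'D_w (in_chart c (pos 0)) +
    in_chart c (nor 1) * 'D_w (in_chart c (pos 1)) + in_chart c (nor ord_max) * 'D_w (in_chart c (pos ord_max))) 0
    y u (@cdom_open c) (fun z Vz => nor_derive_pos w Vz) Vy.
  rewrite z0 in z.
  rewrite /GRing.scale /= in z.
  exact: product_rule_rearrange z.
have sy i : 'D_a ('D_b (in_chart c (pos i))) y = 'D_b ('D_a (in_chart c (pos i))) y.
  exact: (derive_sym _ _ (@cdom_open c) (smooth_pos i 2%N) Vy).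
apply: etrans (half a b) _; apply: etrans (esym (half b a)).
exact: (congr1 -%R (congr2 +%R (congr2 +%R (congr1 _ (sy 0)) (congr1 _ (sy 1))) (congr1 _ (sy ord_max)))).
Qed.

(** The first equation is d nu = - lambda dh for lambda = 2H - mu; the second says
that mu is the curvature of the surface in the horizontal tangent direction. *)
Definition is_transverse_curvature (H : R) (y : 'rV[R]_2) (mu : R) : Prop :=
  forall v, 'D_v (in_chart c (nor ord_max)) y =
              - (2 * H - mu) * 'D_v (in_chart c (pos ord_max)) y /\
    in_chart c (nor 0) y * 'D_v (in_chart c (nor 1)) y
      - in_chart c (nor 1) y * 'D_v (in_chart c (nor 0)) y =
    - mu * (in_chart c (nor 0) y * 'D_v (in_chart c (pos 1)) y
      - in_chart c (nor 1) y * 'D_v (in_chart c (pos 0)) y).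

Opaque pos nor in_chart.

Section first_order.
Variables (H L : R).
Hypothesis L0 : L != 0.
Hypothesis cmcH : forall p, dom c p -> mean_curvature c p = H.
Hypothesis dirM : canonical_principal_direction M (fun=> L *: row ord_max Q).

Lemma tangent_partE p :
  tangent_part (fun=> L *: row ord_max Q) p = L *: (row ord_max Q - nor ord_max p *: normal p).
Proof. by rewrite /tangent_part dotZl scalerBr scalerA dotC norE. Qed.

(** This number is the squared length of the tangent part of the last vector of the
frame. *)
Lemma nor_max_lt1 p : 0 < 1 - nor ord_max p * nor ord_max p.
Proof.
have e : 1 - nor ord_max p * nor ord_max p = nor 0 p ^+ 2 + nor 1 p ^+ 2.
  by rewrite -(nor_unit p); ring.
rewrite lt_def e addr_ge0 ?sqr_ge0 // andbT; apply/negP => z.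
have [/(_ p) + _] := dirM; rewrite tangent_partE scaler_eq0 negb_or => /andP[_ /eqP].
apply; move: z; rewrite paddr_eq0 ?sqr_ge0 // !sqrf_eq0 => /andP[/eqP z0 /eqP z1].
have nE : normal p = frame_vec Q 0 0 (nor ord_max p) by rewrite {1}(frame_vec_dot oQ (normal p)) -!norE z0 z1.
have n2 : nor ord_max p * nor ord_max p = 1 by rewrite -[RHS](nor_unit p) z0 z1; ring.
by rewrite nE /frame_vec !scale0r !add0r scalerA n2 scale1r subrr.
Qed.

Lemma first_order p : dom c p -> exists mu w,
  is_transverse_curvature H (coord c p) mu /\
  'D_w (in_chart c (pos ord_max)) (coord c p) = 1 - nor ord_max p * nor ord_max p.
Proof.
move=> dp; set y := coord c p; have Vy : cdom c y by exact: cdom_coord.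
set P := dmx (@imm R M) c p; set N := dmx (@normal R M) c p; set A := shape_mx c p.
have rP : row_free P := imm_immersion Ac dp.
have nE i : in_chart c (nor i) y = nor i p by rewrite in_chartE coordK.
have Pn : P *m (normal p)^T = 0 := normal_orthogonal Ac dp.
have Nn : N *m (normal p)^T = 0.
  apply: eq0_mulmxl => v; rewrite mulmxA; apply/rowP => i; rewrite ord1 [RHS]mxE.
  rewrite -[LHS]/(dot _ (normal p)) (dot_parseval _ _ oQ) -!derive_nor //.
  rewrite -[RHS](nor_derive_nor v Vy) !nE !norE; by ring.
have AP : A *m P = - N.
  have NP : (- N <= P)%MS.
    by rewrite eqmx_opp (submx_of_orth rP _ Pn Nn) // normal_unit oner_eq0.
  exact: mulmxKpV.
have [_ /(_ c p Ac dp)[w' [l [w'P w'A]]]] := dirM.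
rewrite tangent_partE -/P in w'P; rewrite -/A in w'A.
pose w := L^-1 *: w'.
have wP : w *m P = row ord_max Q - nor ord_max p *: normal p.
  by rewrite /w -scalemxAl w'P scalerA mulVf // scale1r.
have wA : w *m A = l *: w by rewrite /w -scalemxAl w'A !scalerA mulrC.
have trA : A 0 0 + A 1 1 = 2 * H.
  by rewrite -trace2 -(cmcH dp) /mean_curvature; field.
clearbody w A.
pose f (i : 'I_3) (a : 'I_2) := dot (row a P) (row i Q).
pose m (i : 'I_3) (a : 'I_2) := dot (row a N) (row i Q).
have Df v i : 'D_v (in_chart c (pos i)) y = v 0 0 * f i 0 + v 0 1 * f i 1.
  by rewrite derive_pos // dot_mulmx.
have Dm v i : 'D_v (in_chart c (nor i)) y = v 0 0 * m i 0 + v 0 1 * m i 1.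
  by rewrite derive_nor // dot_mulmx.
have Am i a : m i a = - (A a 0 * f i 0 + A a 1 * f i 1).
  have -> : m i a = - dot (row a (A *m P)) (row i Q).
    by rewrite AP linearN /= dotNl opprK.
  by rewrite row_mul dot_mulmx !mxE.
have wA0 : w 0 0 * A 0 0 + w 0 1 * A 1 0 = l * w 0 0.
  have := congr1 (fun M : 'rV[R]_2 => M 0 0) wA; rewrite !mxE !big_ord_recl big_ord0 addr0.
  by have -> : lift ord0 ord0 = 1 :> 'I_2 by apply: val_inj.
have wA1 : w 0 0 * A 0 1 + w 0 1 * A 1 1 = l * w 0 1.
  have := congr1 (fun M : 'rV[R]_2 => M 0 1) wA; rewrite !mxE !big_ord_recl big_ord0 addr0.
  by have -> : lift ord0 ord0 = 1 :> 'I_2 by apply: val_inj.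
have wf i : w 0 0 * f i 0 + w 0 1 * f i 1 = (ord_max == i)%:R - nor ord_max p * nor i p.
  by rewrite -dot_mulmx wP dotDl dotNl dotZl (dot_frame oQ) norE.
clearbody f m.
pose d0 : 'rV[R]_2 := row2 1 0; pose d1 : 'rV[R]_2 := row2 0 1.
have E0 (g : 'I_2 -> R) : d0 0 0 * g 0 + d0 0 1 * g 1 = g 0 by rewrite row2_0 row2_1; ring.
have E1 (g : 'I_2 -> R) : d1 0 0 * g 0 + d1 0 1 * g 1 = g 1 by rewrite row2_0 row2_1; ring.
clearbody d0 d1.
have o0 := nor_derive_pos d0 Vy; have o1 := nor_derive_pos d1 Vy.
have u0 := nor_derive_nor d0 Vy; have u1 := nor_derive_nor d1 Vy.
have sy := second_form_sym d0 d1 Vy.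
have Df0 i : 'D_d0 (in_chart c (pos i)) y = f i 0 by exact: etrans (Df _ _) (E0 (f i)).
have Df1 i : 'D_d1 (in_chart c (pos i)) y = f i 1 by exact: etrans (Df _ _) (E1 (f i)).
have Dm0 i : 'D_d0 (in_chart c (nor i)) y = m i 0 by exact: etrans (Dm _ _) (E0 (m i)).
have Dm1 i : 'D_d1 (in_chart c (nor i)) y = m i 1 by exact: etrans (Dm _ _) (E1 (m i)).
rewrite !nE !Df0 in o0; rewrite !nE !Df1 in o1.
rewrite !nE !Dm0 in u0; rewrite !nE !Dm1 in u1.
rewrite !Df0 !Df1 !Dm0 !Dm1 in sy.
have wf0 := wf 0; have wf1 := wf 1; have wf2 := wf ord_max.
rewrite /= !sub0r -mulNr in wf0; rewrite /= !sub0r -mulNr in wf1; rewrite eqxx in wf2.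
have s0 := lt0r_neq0 (nor_max_lt1 p).
have [h0 h1] := first_order_height o0 o1 u0 u1 sy wf0 wf1 wf2 wA0 wA1
  (Am 0 0) (Am 0 1) (Am 1 0) (Am 1 1) (Am ord_max 0) (Am ord_max 1).
have [k0 k1] := first_order_angle wf0 wf1 wf2 s0 wA0 wA1
  (Am 0 0) (Am 0 1) (Am 1 0) (Am 1 1).
(* l is the curvature in the direction of the tangent part, w its coordinates *)
exists (2 * H - l), w; split; last by rewrite Df wf2.
move=> v; rewrite !nE !Df !Dm h0 h1; split; first by ring.
rewrite trA in k0 k1.
transitivity (v 0 0 * (nor 0 p * m 1 0 - nor 1 p * m 0 0) + v 0 1 * (nor 0 p * m 1 1 - nor 1 p * m 0 1)).
  by ring.
by rewrite k0 k1; ring.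
Qed.

End first_order.

End chart.
End coordinates.

(** * The transverse curvature and the Codazzi equation *)

Lemma closed_height_algebra (R : realType) (l ua ub fa fb s sa sb : R) :
  sa = sb -> sa = l * s + fb * ua -> sb = l * s + fa * ub -> ua * fb = ub * fa.
Proof. by move=> -> -> e; rewrite mulrC [RHS]mulrC; apply: (addrI (l * s)). Qed.

Lemma closed_angle_algebra (R : realType)
  (n0 n1 mu h00 h01 h10 h11 f00 f01 f10 f11 m00 m01 m10 m11 u0 u1 : R) :
  0 = n0 * h01 + m10 * m01 - (n1 * h00 + m00 * m11)
    + (mu * (n0 * h11 + f10 * m01 - (n1 * h10 + f00 * m11)) + (n0 * f10 - n1 * f00) * u1) ->
  0 = n0 * h01 + m11 * m00 - (n1 * h00 + m01 * m10)
    + (mu * (n0 * h11 + f11 * m00 - (n1 * h10 + f01 * m10)) + (n0 * f11 - n1 * f01) * u0) ->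
  2 * (m01 * m10 - m11 * m00) + u1 * (n0 * f10 - n1 * f00) - u0 * (n0 * f11 - n1 * f01) +
  mu * (m01 * f10 - m11 * f00 - m00 * f11 + m10 * f01) = 0.
Proof. by move=> e1 e2; have := congr2 (fun x y => x - y) e1 e2 => /= e; lra. Qed.

Lemma derive_basis (R : realType) (W : normedModType R) (g : 'rV[R]_2 -> W) y v :
  differentiable g y ->
  'D_v g y = v 0 0 *: 'D_(row2 1 0) g y + v 0 1 *: 'D_(row2 0 1) g y.
Proof.
move=> dg; have e : v = v 0 0 *: row2 1 0 + v 0 1 *: row2 0 1.
  by apply: row2P; rewrite !mxE /=; ring.
by rewrite !(deriveE _ dg) {1}e linearD !linearZ.
Qed.

Lemma derive_combination (R : realType) (W : normedModType R) (g : 'rV[R]_2 -> W) y a b (k l : R) :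
  differentiable g y ->
  'D_(k *: a + l *: b) g y = k *: 'D_a g y + l *: 'D_b g y.
Proof. by move=> dg; rewrite !(deriveE _ dg) linearD !linearZ. Qed.

Lemma dependent_algebra (R : realType) (n0 n1 n2 a0 a1 a2 b0 b1 b2 k l : R) :
  n0 * n0 + n1 * n1 != 0 ->
  n0 * a0 + n1 * a1 + n2 * a2 = 0 -> n0 * b0 + n1 * b1 + n2 * b2 = 0 ->
  k * a2 + l * b2 = 0 ->
  k * (n0 * a1 - n1 * a0) + l * (n0 * b1 - n1 * b0) = 0 ->
  k * a0 + l * b0 = 0 /\ k * a1 + l * b1 = 0.
Proof.
move=> s0 oa ob e2 eg.
have er : n0 * (k * a0 + l * b0) + n1 * (k * a1 + l * b1) = 0.
  transitivity (k * (n0 * a0 + n1 * a1 + n2 * a2) + l * (n0 * b0 + n1 * b1 + n2 * b2)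
    - n2 * (k * a2 + l * b2)); first by ring.
  by rewrite oa ob e2; ring.
split; apply: (mulfI s0); rewrite mulr0.
  transitivity (n0 * (n0 * (k * a0 + l * b0) + n1 * (k * a1 + l * b1)) -
    n1 * (k * (n0 * a1 - n1 * a0) + l * (n0 * b1 - n1 * b0))); first by ring.
  by rewrite er eg; ring.
transitivity (n1 * (n0 * (k * a0 + l * b0) + n1 * (k * a1 + l * b1)) +
    n0 * (k * (n0 * a1 - n1 * a0) + l * (n0 * b1 - n1 * b0))); first by ring.
by rewrite er eg; ring.
Qed.

Lemma proportional_combination (R : realType) (s k x0 x1 h0 h1 a b : R) :
  s * x0 = k * h0 -> s * x1 = k * h1 -> s * (a * x0 + b * x1) = k * (a * h0 + b * h1).
Proof. by move=> e0 e1; rewrite !mulrDr !(mulrCA s) e0 e1; ring. Qed.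

Section structure_equations.
Context {R : realType} (M : immersed_surface R) (Q : 'M[R]_3) (H L : R).
Hypothesis oQ : Q *m Q^T = 1%:M.
Hypothesis L0 : L != 0.
Hypothesis cmcH : forall (c : chart R M) p, atlas c -> dom c p -> mean_curvature c p = H.
Hypothesis dirM : canonical_principal_direction M (fun=> L *: row ord_max Q).

(** The three coordinates determine the image of [v] under the differential of the
immersion. *)
Lemma pos_immersion (c : chart R M) (p : M) v : atlas c -> dom c p ->
  (forall i, 'D_v (in_chart c (pos Q i)) (coord c p) = 0) -> v = 0.
Proof.
move=> Ac dp h; have rP := imm_immersion Ac dp.
apply: (row_free_inj rP); rewrite mul0mx (frame_vec_dot oQ (v *m _)).
rewrite -(derive_pos Q Ac 0 v dp) -(derive_pos Q Ac 1 v dp) -(derive_pos Q Ac ord_max v dp) !h.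
by rewrite /frame_vec !scale0r !addr0.
Qed.

(** By the chain rule, with [v'] the image of [v] under the differential of the
transition map. *)
Lemma chart_change (c d : chart R M) (p : M) v : atlas c -> atlas d -> dom c p -> dom d p ->
  exists v', forall g : M -> R, differentiable (in_chart d g) (coord d p) ->
    'D_v (in_chart c g) (coord c p) = 'D_v' (in_chart d g) (coord d p).
Proof.
move=> Ac Ad dc dd; pose tr := coord d \o param c.
have cp : param c (coord c p) = p by rewrite coordK.
have pc : {for coord c p, continuous (param c)} by apply: param_continuous; exists p.
have nV : \forall z \near coord c p, cdom c z.
  exact: (open_nbhs_nbhs (conj (@cdom_open _ _ c) (cdom_coord dc))).
have nd : \forall z \near coord c p, dom d (param c z).
  by apply: pc; apply: open_nbhs_nbhs; rewrite cp; split=> //; exact: dom_open.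
have dtr : differentiable tr (coord c p).
  have oU : open (coord c @` (dom c `&` dom d)).
    rewrite openE => _ [q [qc qd] <-]; rewrite /interior.
    have nV' : \forall z \near coord c q, cdom c z.
      exact: (open_nbhs_nbhs (conj (@cdom_open _ _ c) (cdom_coord qc))).
    have pq : {for coord c q, continuous (param c)} by apply: param_continuous; exists q.
    have nd' : \forall z \near coord c q, dom d (param c z).
      apply: pq; apply: open_nbhs_nbhs; rewrite coordK //; split=> //; exact: dom_open.
    apply: filterS2 nV' nd' => z [r rc <-]; rewrite coordK // => rd.
    by exists r.
  by apply: (smooth_differentiable (atlas_compat Ac Ad)); exists p.
have trp : tr (coord c p) = coord d p by rewrite /tr /= cp.
exists ('D_v tr (coord c p)) => g dg.
have dg' : differentiable (in_chart d g) (tr (coord c p)) by rewrite trp.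
have -> : 'D_v (in_chart c g) (coord c p) = 'D_v (in_chart d g \o tr) (coord c p).
  apply: near_eq_derive; apply: filterS nd => z dz.
  by rewrite /= !in_chartE coordK.
have dgt := differentiable_comp dtr dg'.
by rewrite (deriveE _ dgt) (diff_comp dtr dg') /= (deriveE _ dtr) trp (deriveE _ dg).
Qed.

(** The equation d nu = - (2H - mu) dh does not depend on the chart and, as dh is
not zero, determines mu. *)
Lemma transverse_curvature_exists (p : M) : exists mu, forall c : chart R M, atlas c -> dom c p ->
  is_transverse_curvature Q c H (coord c p) mu.
Proof.
have [d Ad dd] := atlas_cover p.
have [mu0 [_ [h0 _]]] := first_order oQ Ad L0 (fun p => cmcH (p := p) Ad) dirM dd.
exists mu0 => c Ac dc.
have [mu [w [h e]]] := first_order oQ Ac L0 (fun p => cmcH (p := p) Ac) dirM dc.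
suff -> : mu0 = mu by [].
have [w' cw] := chart_change w Ac Ad dc dd.
have c1 := cw _ (smooth_differentiable (smooth_nor Q Ad ord_max) (cdom_coord dd)).
have c2 := cw _ (smooth_differentiable (smooth_pos Q Ad ord_max) (cdom_coord dd)).
have s0 := lt0r_neq0 (nor_max_lt1 oQ dirM p).
have [e1 _] := h w; have [e2 _] := h0 w'.
rewrite -c1 -c2 e1 in e2; move: e2; rewrite e => /(mulIf s0); lra.
Qed.

Definition transverse_curvature (p : M) : R := sval (cid (transverse_curvature_exists p)).

Lemma transverse_curvatureP (c : chart R M) (p : M) : atlas c -> dom c p -> is_transverse_curvature Q c H (coord c p) (transverse_curvature p).
Proof. by rewrite /transverse_curvature; case: cid => m /= h Ac dp; exact: h. Qed.

Section chart.
Variables (c : chart R M) (Ac : atlas c).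
Local Notation f_ i := (in_chart c (pos Q i)).
Local Notation n_ i := (in_chart c (nor Q i)).
Local Notation m_ := (in_chart c transverse_curvature).

Lemma derive_height y v : cdom c y ->
  'D_v (n_ ord_max) y = - (2 * H - m_ y) * 'D_v (f_ ord_max) y.
Proof. by move=> [p dp <-]; have [-> _] := transverse_curvatureP Ac dp v; rewrite in_chartE coordK. Qed.

Lemma derive_angle y v : cdom c y ->
  n_ 0 y * 'D_v (n_ 1) y - n_ 1 y * 'D_v (n_ 0) y =
  - m_ y * (n_ 0 y * 'D_v (f_ 1) y - n_ 1 y * 'D_v (f_ 0) y).
Proof. by move=> [p dp <-]; have [_ ->] := transverse_curvatureP Ac dp v; rewrite [m_ _]in_chartE coordK. Qed.

Lemma height_direction y : cdom c y -> exists2 w, 'D_w (f_ ord_max) y = 1 - n_ ord_max y * n_ ord_max y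
  & 0 < 'D_w (f_ ord_max) y.
Proof.
move=> [p dp <-].
have [_ [w [_ e]]] := first_order oQ Ac L0 (fun p => cmcH (p := p) Ac) dirM dp.
exists w; first by rewrite e in_chartE coordK.
by rewrite e; exact: (nor_max_lt1 oQ dirM).
Qed.

(** Near [y] the function is 2H + D_w nu / D_w h for a fixed [w] with D_w h > 0. *)
Lemma differentiable_mu y : cdom c y -> differentiable m_ y.
Proof.
move=> Vy; have [w _ w0] := height_direction Vy.
have sf := smooth_derive w (smooth_pos Q Ac ord_max).
have sn := smooth_derive w (smooth_nor Q Ac ord_max).
have df := smooth_differentiable sf Vy; have dn := smooth_differentiable sn Vy.
pose q : 'rV[R]_2 -> R^o := fun z => 2 * H + 'D_w (n_ ord_max) z * ('D_w (f_ ord_max) z)^-1.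
have nV : \forall z \near y, cdom c z by exact: (open_nbhs_nbhs (conj (@cdom_open _ _ c) Vy)).
have nf : \forall z \near y, 0 < 'D_w (f_ ord_max) z.
  exact: (@cvgr_gt _ _ _ _ _ ('D_w (f_ ord_max) y : R) (differentiable_continuous df) 0 w0).
have dq : differentiable q y.
  have dV := differentiableV df (lt0r_neq0 w0).
  exact: (differentiableD (differentiable_cst (2 * H : R^o) y) (differentiableM dn dV)).
have [|//] := @near_differentiable _ _ _ q m_ y _ dq.
apply: filterS2 nV nf => z Vz f0; rewrite /q derive_height // mulfK ?lt0r_neq0 //.
by ring.
Qed.

(** The exterior derivative of the equation for d nu. *)
Lemma closed_height y a b : cdom c y ->
  'D_a m_ y * 'D_b (f_ ord_max) y = 'D_b m_ y * 'D_a (f_ ord_max) y.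
Proof.
move=> Vy.
have oV := @cdom_open _ _ c.
have half u w : 'D_u ('D_w (n_ ord_max)) y =
    (m_ y - 2 * H) * 'D_u ('D_w (f_ ord_max)) y + 'D_w (f_ ord_max) y * 'D_u m_ y.
  have dm : is_derive y u m_ ('D_u m_ y).
    by apply: derivableP; apply: diff_derivable; exact: differentiable_mu.
  have df := smooth_is_derive u (smooth_derive w (smooth_pos Q Ac ord_max)) Vy.
  have h := is_deriveM (is_deriveB dm (is_derive_cst (2 * H : R^o) y u)) df.
  have e := @derive_val _ _ _ _ _ _ _ h.
  rewrite subr0 /GRing.scale /= in e.
  rewrite -[RHS]e; apply: near_eq_derive.
  apply: filterS (open_nbhs_nbhs (conj oV Vy)) => z Vz.
  by rewrite derive_height // opprB.
have sn := derive_sym a b oV (smooth_nor Q Ac ord_max 2%N) Vy.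
have sf := derive_sym a b oV (smooth_pos Q Ac ord_max 2%N) Vy.
apply: (closed_height_algebra sn (half a b)).
by have := half b a; rewrite -sf.
Qed.

(** The exterior derivative of the equation for n0 dn1 - n1 dn0. *)
Lemma closed_angle y a b : cdom c y ->
  2 * ('D_b (n_ 0) y * 'D_a (n_ 1) y - 'D_b (n_ 1) y * 'D_a (n_ 0) y) +
  'D_b m_ y * (n_ 0 y * 'D_a (f_ 1) y - n_ 1 y * 'D_a (f_ 0) y) -
  'D_a m_ y * (n_ 0 y * 'D_b (f_ 1) y - n_ 1 y * 'D_b (f_ 0) y) +
  m_ y * ('D_b (n_ 0) y * 'D_a (f_ 1) y - 'D_b (n_ 1) y * 'D_a (f_ 0) y
    - 'D_a (n_ 0) y * 'D_b (f_ 1) y + 'D_a (n_ 1) y * 'D_b (f_ 0) y) = 0.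
Proof.
move=> Vy.
have oV := @cdom_open _ _ c.
have half u w : 0 =
    n_ 0 y * 'D_u ('D_w (n_ 1)) y + 'D_w (n_ 1) y * 'D_u (n_ 0) y
    - (n_ 1 y * 'D_u ('D_w (n_ 0)) y + 'D_w (n_ 0) y * 'D_u (n_ 1) y)
    + (m_ y * (n_ 0 y * 'D_u ('D_w (f_ 1)) y + 'D_w (f_ 1) y * 'D_u (n_ 0) y
        - (n_ 1 y * 'D_u ('D_w (f_ 0)) y + 'D_w (f_ 0) y * 'D_u (n_ 1) y))
      + (n_ 0 y * 'D_w (f_ 1) y - n_ 1 y * 'D_w (f_ 0) y) * 'D_u m_ y).
  have dm : is_derive y u m_ ('D_u m_ y).
    by apply: derivableP; apply: diff_derivable; exact: differentiable_mu.
  have dn i := smooth_is_derive u (smooth_nor Q Ac i) Vy.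
  have ddn i := smooth_is_derive u (smooth_derive w (smooth_nor Q Ac i)) Vy.
  have ddf i := smooth_is_derive u (smooth_derive w (smooth_pos Q Ac i)) Vy.
  have h := is_deriveD
    (is_deriveB (is_deriveM (dn 0) (ddn 1)) (is_deriveM (dn 1) (ddn 0)))
    (is_deriveM dm (is_deriveB (is_deriveM (dn 0) (ddf 1)) (is_deriveM (dn 1) (ddf 0)))).
  have e := @derive_val _ _ _ _ _ _ _ h.
  rewrite -[LHS](@derive_zero_on _ _ _ (cdom c)
    (n_ 0 * 'D_w (n_ 1) - n_ 1 * 'D_w (n_ 0) + m_ * (n_ 0 * 'D_w (f_ 1) - n_ 1 * 'D_w (f_ 0)))
    0 y u oV _ Vy); first exact: e.
  move=> z Vz; rewrite !fctE; have := derive_angle w Vz; rewrite mulNr => ->.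
  by rewrite addNr.
have sn i := derive_sym a b oV (smooth_nor Q Ac i 2%N) Vy.
have sf i := derive_sym a b oV (smooth_pos Q Ac i 2%N) Vy.
have h1 := half b a; have h2 := half a b.
rewrite (sn 0) (sn 1) (sf 0) (sf 1) in h2.
exact: (closed_angle_algebra h1 h2).
Qed.

Lemma horizontal_normal_neq0 y : n_ 0 y * n_ 0 y + n_ 1 y * n_ 1 y != 0.
Proof.
rewrite !in_chartE; have := lt0r_neq0 (nor_max_lt1 oQ dirM (param c y)).
by rewrite -(nor_unit oQ (param c y)) addrK.
Qed.

(** The vector in the conclusion is annihilated by dh and by n0 df1 - n1 df0,
while df is orthogonal to the normal. As (n0, n1) is not zero, all components of
df vanish on it, and the immersion is regular. *)
Lemma height_angle_independent y a b : cdom c y ->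
  'D_a (f_ ord_max) y * (n_ 0 y * 'D_b (f_ 1) y - n_ 1 y * 'D_b (f_ 0) y) -
  'D_b (f_ ord_max) y * (n_ 0 y * 'D_a (f_ 1) y - n_ 1 y * 'D_a (f_ 0) y) = 0 ->
  'D_b (f_ ord_max) y *: a - 'D_a (f_ ord_max) y *: b = 0.
Proof.
move=> Vy e; have df i : differentiable (f_ i) y := smooth_differentiable (smooth_pos Q Ac i) Vy.
have s0 := horizontal_normal_neq0 y.
have oa := nor_derive_pos oQ Ac a Vy; have ob := nor_derive_pos oQ Ac b Vy.
have e2 : 'D_b (f_ ord_max) y * 'D_a (f_ ord_max) y + - 'D_a (f_ ord_max) y * 'D_b (f_ ord_max) y = 0.
  by rewrite mulNr mulrC subrr.
have eg : 'D_b (f_ ord_max) y * (n_ 0 y * 'D_a (f_ 1) y - n_ 1 y * 'D_a (f_ 0) y) +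
   - 'D_a (f_ ord_max) y * (n_ 0 y * 'D_b (f_ 1) y - n_ 1 y * 'D_b (f_ 0) y) = 0.
  by rewrite mulNr -opprB e oppr0.
have [e0 e1] := dependent_algebra s0 oa ob e2 eg.
have [p dp yp] := Vy; rewrite -scaleNr.
apply: (pos_immersion Ac dp); rewrite yp => i.
rewrite (derive_combination _ _ _ _ (df i)).
have [->|->|->] : [\/ i = 0, i = 1 | i = ord_max].
  case: i => -[|[|[|//]]] hi.
  - by apply: Or31; apply: val_inj.
  - by apply: Or32; apply: val_inj.
  - by apply: Or33; apply: val_inj.
- exact: e0.
- exact: e1.
- exact: e2.
Qed.

Lemma horizontal_normal_derive y v : cdom c y ->
  n_ 0 y * 'D_v (n_ 0) y + n_ 1 y * 'D_v (n_ 1) y =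
  n_ ord_max y * (2 * H - m_ y) * 'D_v (f_ ord_max) y.
Proof.
move=> Vy; have := nor_derive_nor oQ Ac v Vy; rewrite (derive_height v Vy) => e.
apply/eqP; rewrite -subr_eq0; apply/eqP; rewrite -[RHS]e.
by rewrite mulNr mulrN mulrA.
Qed.

Lemma horizontal_pos_derive y v : cdom c y ->
  n_ 0 y * 'D_v (f_ 0) y + n_ 1 y * 'D_v (f_ 1) y = - n_ ord_max y * 'D_v (f_ ord_max) y.
Proof.
move=> Vy; have := nor_derive_pos oQ Ac v Vy => /eqP.
by rewrite addr_eq0 mulNr => /eqP.
Qed.

(** [codazzi_algebra] on a basis of directions. *)
Lemma codazzi y v : cdom c y ->
  (n_ 0 y * n_ 0 y + n_ 1 y * n_ 1 y) * 'D_v m_ y =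
  2 * m_ y * n_ ord_max y * (H - m_ y) * 'D_v (f_ ord_max) y.
Proof.
move=> Vy; pose a : 'rV[R]_2 := row2 1 0; pose b : 'rV[R]_2 := row2 0 1.
have indep : 'D_a (f_ ord_max) y * (n_ 0 y * 'D_b (f_ 1) y - n_ 1 y * 'D_b (f_ 0) y) -
    'D_b (f_ ord_max) y * (n_ 0 y * 'D_a (f_ 1) y - n_ 1 y * 'D_a (f_ 0) y) != 0.
  apply/negP => /eqP /(height_angle_independent Vy) e.
  have za : 'D_b (f_ ord_max) y = 0.
    have := congr1 (fun M : 'rV[R]_2 => M 0 0) e; rewrite !mxE /= => <-.
    by rewrite mulr1 mulr0 subr0.
  have zb : 'D_a (f_ ord_max) y = 0.
    have := congr1 (fun M : 'rV[R]_2 => M 0 1) e; rewrite !mxE /= mulr0 mulr1 sub0r => /eqP.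
    by rewrite oppr_eq0 => /eqP.
  have [w _] := height_direction Vy.
  rewrite (derive_basis w (smooth_differentiable (smooth_pos Q Ac ord_max) Vy)).
  by rewrite -/a -/b za zb !scaler0 addr0 ltxx.
have [ha hb] := codazzi_algebra
  (horizontal_pos_derive a Vy) (horizontal_pos_derive b Vy)
  (horizontal_normal_derive a Vy) (horizontal_normal_derive b Vy)
  (derive_angle a Vy) (derive_angle b Vy) (closed_height a b Vy) (closed_angle a b Vy) indep.
rewrite (derive_basis v (differentiable_mu Vy)).
rewrite (derive_basis v (smooth_differentiable (smooth_pos Q Ac ord_max) Vy)).
exact: (proportional_combination _ _ ha hb).
Qed.

End chart.
End structure_equations.

(** * Local inversion and segments in a chart *)

Section local_tools.
Context {R : realType}.

Lemma increasing_of_derive (f df : R -> R) (d : R) :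
  (forall s, - d <= s <= d -> is_derive s (1 : R) f (df s) /\ 0 < df s) ->
  forall a b, - d <= a -> a < b -> b <= d -> f a < f b.
Proof.
move=> h a b da ab bd.
have [||s] := @MVT R f df a b ab.
- move=> s; rewrite in_itv /= => /andP[sa sb].
  by have [|//] := h s; rewrite (le_trans da (ltW sa)) (le_trans (ltW sb) bd).
- apply: derivable_within_continuous => s; rewrite in_itv /= => /andP[sa sb].
  by have [|[]] := h s; rewrite ?(le_trans da sa) ?(le_trans sb bd).
rewrite in_itv /= => /andP[sa sb] e; rewrite -subr_gt0 e mulr_gt0 ?subr_gt0 //.
by have [|//] := h s; rewrite (le_trans da (ltW sa)) (le_trans (ltW sb) bd).
Qed.

(** A curve along which the height increases can be parametrised by the height:
[eta] is the change of parameter. *)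
Lemma local_inverse (f df : R -> R) (d : R) : 0 < d ->
  (forall s, - d <= s <= d -> is_derive s (1 : R) f (df s) /\ 0 < df s) ->
  exists2 eta : R -> R, eta (f 0) = 0 & forall t, f (- d) < t < f d ->
   [/\ - d < eta t < d, f (eta t) = t & is_derive t (1 : R) eta (df (eta t))^-1].
Proof.
move=> d0 h; have inc := increasing_of_derive h.
pose eta t := if pselect (exists s, - d < s < d /\ f s = t) is left e then sval (cid e) else 0.
have etaK s : - d < s < d -> eta (f s) = s.
  move=> sd; rewrite /eta; case: pselect => [e|]; last by move=> n; exfalso; apply: n; exists s.
  case: cid => s' /= [/andP[s'd ds'] e']; have /andP[sd1 sd2] := sd.
  have [lt|lt|//] := ltgtP s' s.
    by have := inc s' s (ltW s'd) lt (ltW sd2); rewrite e' ltxx.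
  by have := inc s s' (ltW sd1) lt (ltW ds'); rewrite e' ltxx.
exists eta; first by apply: etaK; rewrite oppr_lt0 d0.
move=> t /andP[t1 t2].
have dd : - d <= d by rewrite ltW // gt0_cp.
have cf : {within `[- d, d], continuous f}.
  by apply: derivable_within_continuous => s; rewrite in_itv /= => /h[[]].
have [s] : exists2 s, s \in `[- d, d] & f s = t.
  apply: (IVT dd cf); rewrite ge_min le_max (ltW t1) (ltW t2) orbT //.
rewrite in_itv /= => /andP[s1 s2] st.
have sd : - d < s < d.
  rewrite !lt_neqAle s1 s2 !andbT; apply/andP; split; apply/eqP => e.
    by move: t1; rewrite e st ltxx.
  by move: t2; rewrite -e st ltxx.
rewrite -st etaK //; split=> //.
have nd : \forall u \near s, - d < u < d.
  have : \forall u \near s, u \in `]- d, d[ by apply: near_in_itvoo; rewrite in_itv.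
  by apply: filterS => u; rewrite in_itv.
have weak u : - d < u < d -> - d <= u <= d by move=> /andP[u1 u2]; rewrite !ltW.
apply: is_derive_inverse.
- by apply: filterS nd => u /etaK.
- by apply: filterS nd => u /weak/h[du _]; exact: is_derive_continuous du.
- by have [] := h s (weak _ sd).
- by have [_ /lt0r_neq0] := h s (weak _ sd).
Qed.

(** Balls are convex, so that points near [p] are joined to it by segments in the
chart. *)
Lemma chart_segment (M : smooth_surface R) (c : chart R M) (p : M) (P : set 'rV[R]_2) :
  dom c p -> (\forall y \near coord c p, P y) ->
  \forall q \near p, exists2 v, (forall s : R, 0 <= s <= 1 -> P (s *: v + coord c p))
    & dom c q /\ 1 *: v + coord c p = coord c q.
Proof.
move=> dp /nbhs_ballP[e /= e0 eP].
have nd : \forall q \near p, dom c q.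
  by apply: open_nbhs_nbhs; split=> //; exact: dom_open.
have nb : \forall q \near p, ball (coord c p) e (coord c q).
  exact: (Defs.coord_continuous dp (nbhsx_ballx _ _ e0)).
apply: filterS2 nd nb => q dq; rewrite -ball_normE /= => bq.
exists (coord c q - coord c p); last by rewrite scale1r subrK.
move=> s /andP[s0 s1]; apply: eP; rewrite -ball_normE /= opprD addrCA subrr addr0 normrN normrZ.
rewrite ger0_norm // distrC in bq *.
by apply: le_lt_trans bq; rewrite ler_piMl.
Qed.

Lemma chart_constant (M : immersed_surface R) (g : M -> R) : connected [set: M] ->
  (forall (c : chart R M) y, atlas c -> cdom c y ->
     differentiable (in_chart c g) y /\ forall v, 'D_v (in_chart c g) y = 0) ->
  forall p q, g p = g q.
Proof.
move=> cM h p q; apply/esym; move: q.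
apply: (@connected_locally_constant M (fun q => g q = g p) p cM) => // r.
have [c Ac dr] := atlas_cover r.
have nV : \forall y \near coord c r, cdom c y.
  exact: (open_nbhs_nbhs (conj (@cdom_open _ _ c) (cdom_coord dr))).
apply: filterS (chart_segment dr nV) => q [v Pv [dq e1]].
have [s st] := @line_MVT R _ (in_chart c g) v (coord c r) 1 ltr01
  (fun s st => (h c _ Ac (Pv s st)).1).
have [_ ->] := h c _ Ac (Pv s st); rewrite e1 mul1r !in_chartE !coordK // => /eqP.
by rewrite subr_eq0 => /eqP ->.
Qed.

End local_tools.

(** * The equation along the surface *)

Section along_the_surface.
Context {R : realType} (M : immersed_surface R) (Q : 'M[R]_3) (H L : R).
Hypothesis oQ : Q *m Q^T = 1%:M.
Hypothesis L0 : L != 0.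
Hypothesis cmcH : forall (c : chart R M) p, atlas c -> dom c p -> mean_curvature c p = H.
Hypothesis dirM : canonical_principal_direction M (fun=> L *: row ord_max Q).
Hypothesis cM : connected [set: M].

Local Notation mu := (transverse_curvature oQ L0 cmcH dirM).

Section chart.
Variables (c : chart R M) (Ac : atlas c).
Local Notation f_ i := (in_chart c (pos Q i)).
Local Notation n_ i := (in_chart c (nor Q i)).
Local Notation m_ := (in_chart c mu).

Lemma normal_height_lt1 y : n_ ord_max y ^+ 2 < 1.
Proof. by rewrite in_chartE expr2 -subr_gt0; exact: (nor_max_lt1 oQ dirM). Qed.

Lemma horizontal_normalE y : n_ 0 y * n_ 0 y + n_ 1 y * n_ 1 y = 1 - n_ ord_max y ^+ 2.
Proof. by rewrite !in_chartE expr2 -(nor_unit oQ (param c y)) addrK. Qed.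

Lemma derive_mu_rate y v : cdom c y ->
  'D_v m_ y = mu_rate H (m_ y) (n_ ord_max y) * 'D_v (f_ ord_max) y.
Proof.
move=> Vy; have s0 := horizontal_normal_neq0 oQ dirM c y.
have := codazzi oQ L0 cmcH dirM Ac v Vy.
rewrite /mu_rate -horizontal_normalE => e.
by rewrite mulrAC -e mulrAC mulfV // mul1r.
Qed.

Lemma derive_nu_rate y v : cdom c y ->
  'D_v (n_ ord_max) y = nu_rate H (m_ y) * 'D_v (f_ ord_max) y.
Proof. by move=> Vy; rewrite (derive_height oQ L0 cmcH dirM Ac v Vy) /nu_rate opprB. Qed.

Section segment.
Variables (x v : 'rV[R]_2).
Hypothesis Pv : forall s : R, 0 <= s <= 1 -> cdom c (s *: v + x).

Lemma segment_mu (s : R) : 0 <= s <= 1 -> is_derive s (1 : R) (fun u : R => m_ (u *: v + x))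
  (mu_rate H (m_ (s *: v + x)) (n_ ord_max (s *: v + x)) * 'D_v (f_ ord_max) (s *: v + x)).
Proof.
move=> st; have dm := differentiable_mu oQ L0 cmcH dirM Ac (Pv st).
by have := is_derive_line dm; rewrite derive_mu_rate //; exact: Pv.
Qed.

Lemma segment_nu (s : R) : 0 <= s <= 1 -> is_derive s (1 : R) (fun u : R => n_ ord_max (u *: v + x))
  (nu_rate H (m_ (s *: v + x)) * 'D_v (f_ ord_max) (s *: v + x)).
Proof.
move=> st; have dm := smooth_differentiable (smooth_nor Q Ac ord_max) (Pv st).
by have := is_derive_line dm; rewrite derive_nu_rate //; exact: Pv.
Qed.

Lemma segment_height (s : R) : 0 <= s <= 1 -> is_derive s (1 : R) (fun u : R => f_ ord_max (u *: v + x))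
  ('D_v (f_ ord_max) (s *: v + x)).
Proof.
by move=> st; exact: is_derive_line (smooth_differentiable (smooth_pos Q Ac ord_max) (Pv st)).
Qed.

Lemma segment_slope (s : R) : 0 <= s <= 1 ->
  {for s, continuous (fun u : R => 'D_v (f_ ord_max) (u *: v + x))}.
Proof.
move=> st; have d := smooth_differentiable (smooth_derive v (smooth_pos Q Ac ord_max)) (Pv st).
exact: (is_derive_continuous (is_derive_line d)).
Qed.

(** Along the segment mu is a solution of a homogeneous linear equation. *)
Lemma segment_mu_zero : m_ x = 0 -> m_ (1 *: v + x) = 0.
Proof.
move=> mx0.
pose k (s : R) := 'D_v (f_ ord_max) (s *: v + x).
pose nn (s : R) := n_ ord_max (s *: v + x).
pose mm (s : R) := m_ (s *: v + x).
pose a (s : R) := 2 * nn s * (H - mm s) / (1 - nn s ^+ 2) * k s.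
have ca (s : R) : 0 <= s <= 1 -> {for s, continuous a}.
  move=> st.
  have ck := segment_slope st.
  have cn : {for s, continuous nn} := is_derive_continuous (segment_nu st).
  have cm : {for s, continuous mm} := is_derive_continuous (segment_mu st).
  have cc (r : R) : {for s, continuous (fun=> r : R)} by exact: cvg_cst.
  have c1 := @continuousM R _ _ _ _ (cc 2) cn.
  have c2 := @continuousB R R^o _ _ _ _ (cc H) cm.
  have c3 := @continuousB R R^o _ _ _ _ (cc 1) (@continuousM R _ _ _ _ cn cn).
  have n0 : 1 - nn s * nn s != 0 by rewrite -expr2 subr_eq0 gt_eqF // normal_height_lt1.
  have c4 : {for s, continuous (fun u => (1 - nn u * nn u)^-1)}.
    exact: (@continuousV R _ (fun u : R => 1 - nn u * nn u) s n0 c3).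
  exact: (@continuousM R _ _ _ _ (@continuousM R _ _ _ _ (@continuousM R _ _ _ _ c1 c2) c4) ck).
have [||||||||h _] := @linear_system_zero R mm (fun=> 0) a (fun=> 0) (fun=> 0) (fun=> 0) 1 ltr01.
- exact: ca.
- by move=> s _; exact: cvg_cst.
- by move=> s _; exact: cvg_cst.
- by move=> s _; exact: cvg_cst.
- move=> s st; apply: is_derive_eq (segment_mu st) _.
  by rewrite /a /mu_rate -/(mm s) -/(nn s) -/(k s); ring.
- move=> s st; apply: is_derive_eq (is_derive_cst (0 : R) s (1 : R)) _.
  by rewrite !mul0r addr0.
- by rewrite /mm scale0r add0r.
- by [].
exact: h.
Qed.
End segment.
End chart.

Lemma transverse_curvature_zero_or : (forall p, mu p = 0) \/ (forall p, mu p != 0).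
Proof.
have [[p0 p00]|n] := pselect (exists p, mu p = 0); last first.
  by right => p; apply/eqP => e; apply: n; exists p.
left; apply: (@connected_locally_constant M (fun p => mu p = 0) p0 cM) => // p.
have [c Ac dp] := atlas_cover p.
have nV : \forall y \near coord c p, cdom c y.
  exact: (open_nbhs_nbhs (conj (@cdom_open _ _ c) (cdom_coord dp))).
apply: filterS (chart_segment dp nV) => q [v Pv [dq e1]].
have cp g : in_chart c g (coord c p) = g p by rewrite in_chartE coordK.
have cq g : in_chart c g (coord c q) = g q by rewrite in_chartE coordK.
split=> [mq|mp].
  (* the same segment, run from q to p *)
  have e2 : 1 *: - v + coord c q = coord c p by rewrite -e1 !scale1r addKr.
  have Pv' (s : R) : 0 <= s <= 1 -> cdom c (s *: - v + coord c q).
    move=> /andP[s0 s1].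
    have -> : s *: - v + coord c q = (1 - s) *: v + coord c p.
      by rewrite -e1 scale1r scalerN scalerBl scale1r addrA [- _ + _]addrC.
    by apply: Pv; rewrite subr_ge0 s1 gerBl.
  by rewrite -cp -e2; apply: (segment_mu_zero Ac Pv'); rewrite cq.
by rewrite -cq -e1; apply: (segment_mu_zero Ac Pv); rewrite cp.
Qed.

(** On the coordinate line in a direction along which the height increases, the
state can be written as a function [z] of the height, which solves the equation.
If [q] is close to [p], the state along the segment from [p] to [q] and [z]
evaluated at the height satisfy the same equation, hence coincide. *)
Lemma local_profile_solution (p : M) : (forall p, mu p != 0) ->
  exists I z, solution (profile_ode H) I z /\ \forall q \near p,
    I (pos Q ord_max q) /\ z (pos Q ord_max q) = (mu q, nor Q ord_max q).
Proof.
move=> mu0; have [c Ac dp] := atlas_cover p.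
set x := coord c p; have Vx : cdom c x := cdom_coord dp.
have [w _ w0] := height_direction oQ L0 cmcH dirM Ac Vx.
have sf := smooth_derive w (smooth_pos Q Ac ord_max).
have nV : \forall y \near x, cdom c y.
  exact: (open_nbhs_nbhs (conj (@cdom_open _ _ c) Vx)).
have nf : \forall y \near x, 0 < 'D_w (in_chart c (pos Q ord_max)) y.
  have cf := smooth_continuous sf Vx.
  exact: (@cvgr_gt _ _ _ _ _ ('D_w (in_chart c (pos Q ord_max)) x : R) cf 0 w0).
have [e /= e0 eP] := (nbhs_ballP _ _).1 (filterI nV nf).
(* keeps s *: w + x in the ball of radius e for |s| <= d *)
pose d := e / (1 + `|w|).
have n1 : 0 < 1 + `|w| by rewrite ltr_pwDl.
have d0 : 0 < d by rewrite divr_gt0.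
have sb (s : R) : - d <= s <= d -> ball x e (s *: w + x).
  move=> sd; rewrite -ball_normE /= opprD addrCA subrr addr0 normrN normrZ.
  apply: (@le_lt_trans _ _ (d * `|w|)); first by rewrite ler_wpM2r // ler_norml.
  by rewrite /d -mulrA gtr_pMr // ltr_pdivrMl // mulr1 ltrDr.
pose f (s : R) := in_chart c (pos Q ord_max) (s *: w + x).
pose df (s : R) := 'D_w (in_chart c (pos Q ord_max)) (s *: w + x).
have fP (s : R) : - d <= s <= d -> is_derive s (1 : R) f (df s) /\ 0 < df s.
  move=> sd; have [Vs fs] := eP _ (sb s sd); split; last exact: fs.
  exact: is_derive_line (smooth_differentiable (smooth_pos Q Ac ord_max) Vs).
have [eta eta0 etaP] := local_inverse d0 fP.
have md0 : - d < 0 by rewrite oppr_lt0.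
have inc : f (- d) < f 0 < f d.
  apply/andP; split; first exact: (increasing_of_derive fP (lexx _) md0 (ltW d0)).
  exact: (increasing_of_derive fP (ltW md0) d0 (lexx _)).
pose I : set R := `]f (- d), f d[%classic.
have oI : open I by apply: interval_open.
pose z t := (in_chart c mu (eta t *: w + x), in_chart c (nor Q ord_max) (eta t *: w + x)).
have odez t : I t -> profile_ode H z t.
  rewrite /I /= in_itv /= => /etaP[/andP[h1 h2] ft deta].
  have [Vs fs] := eP _ (sb (eta t) (ltac:(by rewrite !ltW))).
  have dm := is_derive_line (differentiable_mu oQ L0 cmcH dirM Ac Vs).
  have dn := is_derive_line (smooth_differentiable (smooth_nor Q Ac ord_max) Vs).
  rewrite (derive_mu_rate Ac w Vs) in dm; rewrite (derive_nu_rate Ac w Vs) in dn.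
  have f0 := lt0r_neq0 fs.
  split; rewrite /z /=.
  - exact: mu0.
  - exact: normal_height_lt1.
  - apply: is_derive_eq (@is_derive1_comp _ (fun s => in_chart c mu (s *: w + x)) eta _ _ _ dm deta) _.
    by rewrite /df mulfK.
  - apply: is_derive_eq (@is_derive1_comp _ (fun s => in_chart c (nor Q ord_max) (s *: w + x)) eta _ _ _ dn deta) _.
    by rewrite /df mulfK.
exists I, z; split.
  by split; [exact: oI|exact: interval_is_interval|exact: odez].
have cp g : in_chart c g x = g p by rewrite /x in_chartE coordK.
have fx : f 0 = in_chart c (pos Q ord_max) x by rewrite /f scale0r add0r.
have nI : \forall y \near x, I (in_chart c (pos Q ord_max) y).
  have cf := smooth_continuous (smooth_pos Q Ac ord_max) Vx.
  have Ix : I (in_chart c (pos Q ord_max) x) by rewrite /I /= in_itv /= -fx.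
  exact: (cf I (open_nbhs_nbhs (conj oI Ix))).
have nVI : \forall y \near x, cdom c y /\ I (in_chart c (pos Q ord_max) y) by exact: filterI nV nI.
apply: filterS (chart_segment dp nVI) => q [v Pv [dq e1]].
have cq g : in_chart c g (coord c q) = g q by rewrite in_chartE coordK.
have PV (s : R) : 0 <= s <= 1 -> cdom c (s *: v + x) by move=> /Pv[].
have one : (0 : R) <= (1 : R) <= (1 : R) by rewrite ler01 lexx.
have [_ Iq] := Pv 1 one; rewrite e1 cq in Iq; split=> //.
pose hs (s : R) := in_chart c (pos Q ord_max) (s *: v + x).
have [|||||h1 h2] := @profile_ode_unique R H
  (fun s : R => 'D_v (in_chart c (pos Q ord_max)) (s *: v + x))
  (fun s : R => in_chart c mu (s *: v + x))
  (fun s : R => in_chart c (nor Q ord_max) (s *: v + x))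
  (fun s => (z (hs s)).1) (fun s => (z (hs s)).2).
- by move=> s st; exact: segment_slope.
- move=> s st; split; [exact: normal_height_lt1|exact: segment_mu|exact: segment_nu].
- move=> s st; have [_ Is] := Pv s st; have [_ n1' dm dn] := odez _ Is.
  have dh := segment_height Ac PV st.
  split=> //; first exact: (is_derive1_comp dm dh).
  exact: (is_derive1_comp dn dh).
- by rewrite /hs !scale0r !add0r -fx /z /= eta0 scale0r add0r.
- by rewrite /hs !scale0r !add0r -fx /z /= eta0 scale0r add0r.
rewrite /hs !e1 !cq in h1 h2.
by rewrite [LHS]surjective_pairing -h1 -h2.
Qed.

End along_the_surface.

(** * Classification *)

(** The derivative of n0 / r and n1 / r, for r the norm of (n0, n1), is proportional
to n0 dn1 - n1 dn0. *)
Lemma unit_direction_algebra (R : realType) (r n0 n1 d0 d1 : R) : r ^+ 2 = n0 ^+ 2 + n1 ^+ 2 -> r != 0 ->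
  n0 * d1 - n1 * d0 = 0 ->
  d0 / r - n0 * ((n0 * d0 + n1 * d1) / r) / r ^+ 2 = 0 /\
  d1 / r - n1 * ((n0 * d0 + n1 * d1) / r) / r ^+ 2 = 0.
Proof.
move=> re r0 k.
have r3 : r ^+ 3 != 0 by rewrite expf_neq0.
split; apply: (mulIf r3); rewrite mul0r.
  transitivity (d0 * r ^+ 2 - n0 * (n0 * d0 + n1 * d1)); first by field.
  by rewrite re; transitivity (- n1 * (n0 * d1 - n1 * d0)); [ring|rewrite k mulr0].
transitivity (d1 * r ^+ 2 - n1 * (n0 * d0 + n1 * d1)); first by field.
by rewrite re; transitivity (n0 * (n0 * d1 - n1 * d0)); [ring|rewrite k mulr0].
Qed.

Lemma cylinder_algebra (R : realType) (H a b r n0 n1 n2 f0 f1 f2 d0 d1 : R) :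
  H != 0 -> r != 0 -> n0 = a * r -> n1 = b * r ->
  n0 * f0 + n1 * f1 = - n2 * f2 -> n0 * d0 + n1 * d1 = n2 * (2 * H) * f2 ->
  a * f0 + b * f1 + (a * d0 + b * d1) / (2 * H) = 0.
Proof.
move=> H0 r0 e0 e1 ef ed; have h2 : 2 * H != 0 by rewrite mulf_neq0.
apply: (mulfI r0); rewrite mulr0.
transitivity ((n0 * f0 + n1 * f1) + (n0 * d0 + n1 * d1) / (2 * H)).
  by rewrite e0 e1; field.
by rewrite ef ed; field.
Qed.

Section classification.
Context {R : realType} (M : immersed_surface R) (Q : 'M[R]_3) (H L : R).
Hypothesis oQ : Q *m Q^T = 1%:M.
Hypothesis L0 : L != 0.
Hypothesis cmcH : forall (c : chart R M) p, atlas c -> dom c p -> mean_curvature c p = H.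
Hypothesis dirM : canonical_principal_direction M (fun=> L *: row ord_max Q).
Hypothesis cM : connected [set: M].
Variable p0 : M.

Local Notation mu := (transverse_curvature oQ L0 cmcH dirM).

Lemma dot_sub_frame_vec (p : M) a b c i : dot (imm p - frame_vec Q a b c) (row i Q) = pos Q i p - dot (frame_vec Q a b c) (row i Q).
Proof. by rewrite dotDl dotNl posE. Qed.

Lemma row_frame_vec : [/\ row 0 Q = frame_vec Q 1 0 0, row 1 Q = frame_vec Q 0 1 0 & row ord_max Q = frame_vec Q 0 0 1].
Proof. by rewrite /frame_vec !scale0r !scale1r !addr0 !add0r. Qed.

Section rotational.
Hypothesis mu0 : forall p, mu p != 0.

(** For i = 0, 1 these are the coordinates of the centre of the parallel through
the point. *)
Lemma axis_constant (i : 'I_3) : i = 0 \/ i = 1 ->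
  forall p q : M, pos Q i p + nor Q i p / mu p = pos Q i q + nor Q i q / mu q.
Proof.
move=> hi; apply: (@chart_constant R M (fun p => pos Q i p + nor Q i p / mu p) cM) => c y Ac Vy.
have m0 : in_chart c mu y != 0 by rewrite in_chartE.
have dm := differentiable_mu oQ L0 cmcH dirM Ac Vy.
have df := smooth_differentiable (smooth_pos Q Ac i) Vy.
have dn := smooth_differentiable (smooth_nor Q Ac i) Vy.
have -> : in_chart c (fun p => pos Q i p + nor Q i p / mu p) =
   in_chart c (pos Q i) + in_chart c (nor Q i) * (fun z => (in_chart c mu z)^-1).
  by apply/funext => z; rewrite !fctE !in_chartE.
have dV := differentiableV dm m0.
split; first exact: (differentiableD df (differentiableM dn dV)).
move=> v.
have hf := smooth_is_derive v (smooth_pos Q Ac i) Vy.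
have hn := smooth_is_derive v (smooth_nor Q Ac i) Vy.
have hm : is_derive y v (in_chart c mu : _ -> R) ('D_v (in_chart c mu) y).
  by apply: derivableP; exact: diff_derivable.
have hV : is_derive y v (fun z => (in_chart c mu z)^-1 : R^o) (- (in_chart c mu y) ^- 2 *: 'D_v (in_chart c mu) y).
  have hder : derivable (in_chart c mu) y v := diff_derivable dm.
  apply: DeriveDef; first exact: (derivableV m0 hder).
  exact: (deriveV m0 hder).
have e := @derive_val _ _ _ _ _ _ _ (is_deriveD hf (is_deriveM hn hV)).
rewrite e /GRing.scale /=.
have [h0 h1] := axis_algebra (horizontal_normal_neq0 oQ dirM c y) m0
  (horizontal_pos_derive oQ Ac v Vy) (horizontal_normal_derive oQ L0 cmcH dirM Ac v Vy)
  (derive_angle oQ L0 cmcH dirM Ac v Vy) (codazzi oQ L0 cmcH dirM Ac v Vy).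
case: hi => ->; [rewrite -[RHS]h0|rewrite -[RHS]h1]; congr (_ + _); by rewrite addrC mulrC mulNr mulrN mulrA mulrAC.
Qed.

(** The state (mu, nu) is a function of the height by [glue_solutions], and so is
the distance to the axis. *)
Lemma rotational_case : exists S : immersed_surface R, delaunay_surface S /\ part_of M S.
Proof.
have [I [z [solz Ip0 zP]]] := @glue_solutions R _ (profile_ode H) (@profile_ode_near R H)
  (@profile_solution_unique R H) M (pos Q ord_max) (fun q => (mu q, nor Q ord_max q)) p0 cM
  (fun p => local_profile_solution p mu0).
have prof := profile_of_solution solz.
pose o := frame_vec Q (pos Q 0 p0 + nor Q 0 p0 / mu p0) (pos Q 1 p0 + nor Q 1 p0 / mu p0) 0.
have u1 : (1 : R) ^+ 2 + 0 ^+ 2 = 1 by rewrite expr1n expr0n addr0.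
pose u0 : set_type (annulus I) := SigSub (mem_set (annulus_polar Ip0 u1)).
exists (revolution_surface prof o oQ u0); split; first exact: revolution_delaunay.
apply: part_of_revolution => p.
have [r0 r1 r2] := row_frame_vec; have [Ip zp] := zP p.
rewrite !dot_sub_frame_vec r0 r1 r2 !(dot_frame_vec oQ).
rewrite !(mulr0, mulr1, addr0, add0r, subr0) zp /=; split=> //.
rewrite (axis_constant (or_introl erefl) p0 p) (axis_constant (or_intror erefl) p0 p).
have n1 : 0 < 1 - nor Q ord_max p ^+ 2 by rewrite expr2; exact: (nor_max_lt1 oQ dirM).
rewrite !opprD !addNKr !sqrrN !exprMn !sqrrN exprVn -mulrDl sqr_sqrtr ?(ltW n1) //.
by congr (_ / _); rewrite [nor Q ord_max p ^+ 2]expr2 -[X in X - _](nor_unit oQ p) addrK !expr2.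
Qed.
End rotational.

Section cylindrical.
Hypothesis mu0 : forall p, mu p = 0.

Lemma in_chart_mu0 (c : chart R M) y : in_chart c mu y = 0. Proof. by rewrite in_chartE. Qed.

Lemma angle_derive0 (c : chart R M) y v : atlas c -> cdom c y ->
  in_chart c (nor Q 0) y * 'D_v (in_chart c (nor Q 1)) y
   - in_chart c (nor Q 1) y * 'D_v (in_chart c (nor Q 0)) y = 0.
Proof. by move=> Ac Vy; rewrite (derive_angle oQ L0 cmcH dirM Ac v Vy) in_chart_mu0 oppr0 mul0r. Qed.

(** By d nu = (mu - 2H) dh = 0 and since the horizontal part of the normal keeps its
direction, the whole normal is constant. *)
Lemma planar_case : H = 0 -> exists S : immersed_surface R, delaunay_surface S /\ part_of M S.
Proof.
move=> H0.
have dnor i (c : chart R M) y v : atlas c -> cdom c y -> 'D_v (in_chart c (nor Q i)) y = 0.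
  move=> Ac Vy; have k := angle_derive0 v Ac Vy.
  have h := horizontal_normal_derive oQ L0 cmcH dirM Ac v Vy.
  have hh := derive_height oQ L0 cmcH dirM Ac v Vy.
  rewrite in_chart_mu0 H0 !mulr0 subr0 ?mulr0 mul0r in h.
  rewrite in_chart_mu0 H0 !mulr0 subr0 oppr0 mul0r in hh.
  have s0 := horizontal_normal_neq0 oQ dirM c y.
  have e (n0 n1 d0 d1 : R) : n0 * n0 + n1 * n1 != 0 -> n0 * d1 - n1 * d0 = 0 -> n0 * d0 + n1 * d1 = 0 ->
      d0 = 0 /\ d1 = 0.
    move=> n k1 h1; split; apply: (mulfI n); rewrite mulr0.
      by transitivity (n0 * (n0 * d0 + n1 * d1) - n1 * (n0 * d1 - n1 * d0)); [ring|rewrite k1 h1; ring].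
    by transitivity (n1 * (n0 * d0 + n1 * d1) + n0 * (n0 * d1 - n1 * d0)); [ring|rewrite k1 h1; ring].
  have [e0 e1] := e _ _ _ _ s0 k h.
  by have [->|->|->] := ord3P i.
have cnor i : forall p q : M, nor Q i p = nor Q i q.
  apply: chart_constant => // c y Ac Vy; split; last by move=> v; exact: dnor.
  exact: (smooth_differentiable (smooth_nor Q Ac i) Vy).
have [Q' oQ' r2] := orthonormal_frame (normal_unit p0).
exists (plane_surface (imm p0) oQ'); split; first exact: plane_delaunay.
apply: part_of_plane => p; rewrite r2 dotDl dotNl.
suff -> : dot (imm p) (normal p0) = dot (imm p0) (normal p0) by rewrite subrr.
pose g (q : M) := pos Q 0 q * nor Q 0 p0 + pos Q 1 q * nor Q 1 p0 + pos Q ord_max q * nor Q ord_max p0.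
have gE (q : M) : dot (imm q) (normal p0) = g q by rewrite (dot_parseval _ _ oQ) -!posE -!norE.
rewrite !gE; apply: (chart_constant (g := g)) => // c y Ac Vy.
have hf i v : is_derive y v (fun z => in_chart c (pos Q i) z * nor Q i p0 : R^o)
    (in_chart c (nor Q i) y * 'D_v (in_chart c (pos Q i)) y).
  apply: is_derive_eq (is_deriveM (smooth_is_derive v (smooth_pos Q Ac i) Vy)
    (is_derive_cst (nor Q i p0 : R^o) y v)) _.
  by rewrite scaler0 add0r /GRing.scale /= in_chartE (cnor i p0 (param c y)).
have df i : differentiable (fun z => in_chart c (pos Q i) z * nor Q i p0 : R^o) y.
  exact: (differentiableM (smooth_differentiable (smooth_pos Q Ac i) Vy) (differentiable_cst _ _)).
have -> : in_chart c g = (fun z => in_chart c (pos Q 0) z * nor Q 0 p0 : R^o) +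
   (fun z => in_chart c (pos Q 1) z * nor Q 1 p0 : R^o) + (fun z => in_chart c (pos Q ord_max) z * nor Q ord_max p0 : R^o).
  by apply/funext => z; rewrite !fctE !in_chartE.
split; first exact: (differentiableD (differentiableD (df 0) (df 1)) (df ord_max)).
move=> v; rewrite (@derive_val _ _ _ _ _ _ _ (is_deriveD (is_deriveD (hf 0 v) (hf 1 v)) (hf ord_max v))).
exact: (nor_derive_pos oQ Ac v Vy).
Qed.

Definition horizontal_norm (p : M) : R := Num.sqrt (nor Q 0 p * nor Q 0 p + nor Q 1 p * nor Q 1 p).

Lemma horizontal_norm_sqr p : horizontal_norm p ^+ 2 = nor Q 0 p ^+ 2 + nor Q 1 p ^+ 2.
Proof. by rewrite /horizontal_norm -!expr2 sqr_sqrtr // addr_ge0 ?sqr_ge0. Qed.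

Lemma horizontal_norm_gt0 p : 0 < horizontal_norm p.
Proof.
rewrite sqrtr_gt0; have := nor_max_lt1 oQ dirM p.
by rewrite -[X in X - _](nor_unit oQ p) addrK.
Qed.

Lemma derive_horizontal_norm (c : chart R M) y : atlas c -> cdom c y ->
  differentiable (in_chart c horizontal_norm) y /\ forall v, 'D_v (in_chart c horizontal_norm) y =
    (in_chart c (nor Q 0) y * 'D_v (in_chart c (nor Q 0)) y +
     in_chart c (nor Q 1) y * 'D_v (in_chart c (nor Q 1)) y) / in_chart c horizontal_norm y.
Proof.
move=> Ac Vy.
pose sq := in_chart c (nor Q 0) * in_chart c (nor Q 0) + in_chart c (nor Q 1) * in_chart c (nor Q 1).
have hE : in_chart c horizontal_norm = (Num.sqrt : R^o -> R^o) \o sq.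
  by apply/funext => z; rewrite /= /sq !fctE !in_chartE.
have dn j := smooth_differentiable (smooth_nor Q Ac j) Vy.
have dsq : differentiable sq y.
  exact: (differentiableD (differentiableM (dn 0) (dn 0)) (differentiableM (dn 1) (dn 1))).
have hy : in_chart c horizontal_norm y = Num.sqrt (sq y) by rewrite hE.
have sq0 : 0 < sq y by rewrite -sqrtr_gt0 -hy in_chartE horizontal_norm_gt0.
have hs : is_derive (sq y : R) (1 : R) Num.sqrt (2 * Num.sqrt (sq y))^-1 := is_derive1_sqrt sq0.
rewrite hy hE; split; first by have [] := derive_comp 0 dsq hs.
move=> v; have [_ Dr] := derive_comp v dsq hs.
have hn j := smooth_is_derive v (smooth_nor Q Ac j) Vy.
have Dsq := @derive_val _ _ _ _ _ _ _ (is_deriveD (is_deriveM (hn 0) (hn 0)) (is_deriveM (hn 1) (hn 1))).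
have fin (x0 x1 r : R) : r != 0 -> (x0 + x0 + (x1 + x1)) * (2 * r)^-1 = (x0 + x1) / r.
  by move=> rn; field.
apply: etrans Dr _; apply: etrans (congr1 (fun t => t * (2 * Num.sqrt (sq y))^-1) Dsq) _.
by apply: fin; rewrite gt_eqF // sqrtr_gt0.
Qed.

(** As mu = 0, the horizontal normal does not turn. *)
Lemma direction_constant (i : 'I_3) : i = 0 \/ i = 1 ->
  forall p q : M, nor Q i p / horizontal_norm p = nor Q i q / horizontal_norm q.
Proof.
move=> hi; apply: (@chart_constant R M (fun p => nor Q i p / horizontal_norm p) cM) => c y Ac Vy.
have dn := smooth_differentiable (smooth_nor Q Ac i) Vy.
have [dr Dr] := derive_horizontal_norm Ac Vy.
have r0 : in_chart c horizontal_norm y != 0 by rewrite in_chartE lt0r_neq0 // horizontal_norm_gt0.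
have -> : in_chart c (fun p => nor Q i p / horizontal_norm p) =
   in_chart c (nor Q i) * (fun z => (in_chart c horizontal_norm z)^-1).
  by apply/funext => z; rewrite !fctE !in_chartE.
have dV := differentiableV dr r0.
split; first exact: (differentiableM dn dV).
move=> v; have hn := smooth_is_derive v (smooth_nor Q Ac i) Vy.
have hV : is_derive y v (fun z => (in_chart c horizontal_norm z)^-1 : R^o)
    (- (in_chart c horizontal_norm y) ^- 2 *: 'D_v (in_chart c horizontal_norm) y).
  have hder : derivable (in_chart c horizontal_norm) y v := diff_derivable dr.
  apply: DeriveDef; first exact: (derivableV r0 hder).
  exact: (deriveV r0 hder).
have re : in_chart c horizontal_norm y ^+ 2 = in_chart c (nor Q 0) y ^+ 2 + in_chart c (nor Q 1) y ^+ 2.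
  by rewrite !in_chartE horizontal_norm_sqr.
have [h0 h1] := unit_direction_algebra re r0 (angle_derive0 v Ac Vy).
have fin (n d w x r : R) : r != 0 -> w = x -> d / r - n * x / r ^+ 2 = 0 ->
    n * (- r ^- 2 * w) + r^-1 * d = 0.
  by move=> rn -> <-; field.
apply: etrans (@derive_val _ _ _ _ _ _ _ (is_deriveM hn hV)) _.
by case: hi => hi; rewrite hi; [exact: (fin _ _ _ _ _ r0 (Dr v) h0)|exact: (fin _ _ _ _ _ r0 (Dr v) h1)].
Qed.

(** The functions [g0] and [g1] below are the coordinates, in the plane orthogonal
to the constant horizontal tangent direction, of the centre of curvature
f + n / (2H); both are constant. So M is at distance 1 / (2|H|) from a line in
that direction. *)
Lemma cylindrical_case : H != 0 -> exists S : immersed_surface R, delaunay_surface S /\ part_of M S.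
Proof.
move=> H0; pose a := nor Q 0 p0 / horizontal_norm p0; pose b := nor Q 1 p0 / horizontal_norm p0.
have h2 : 2 * H != 0 by rewrite mulf_neq0.
have rn p : horizontal_norm p != 0 by rewrite lt0r_neq0 // horizontal_norm_gt0.
have na p : nor Q 0 p = a * horizontal_norm p by rewrite /a (direction_constant (or_introl erefl) p0 p) divfK.
have nb p : nor Q 1 p = b * horizontal_norm p by rewrite /b (direction_constant (or_intror erefl) p0 p) divfK.
have ab : a ^+ 2 + b ^+ 2 = 1.
  by rewrite /a /b !exprMn -mulrDl -horizontal_norm_sqr exprVn divff // expf_neq0.
clearbody a b.
have [Q' [oQ' r0 r1 r2]] := horizontal_frame oQ ab.
pose g0 (p : M) := a * pos Q 0 p + b * pos Q 1 p + (a * nor Q 0 p + b * nor Q 1 p) / (2 * H).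
pose g1 (p : M) := pos Q ord_max p + nor Q ord_max p / (2 * H).
have hZ (k : R) (f : 'rV[R]_2 -> R^o) y v df : is_derive y v f df -> is_derive y v (fun z => k * f z : R^o) (k * df).
  by move=> hf; exact: (is_deriveZ k hf).
have dZ (k : R) (f : 'rV[R]_2 -> R^o) y : differentiable f y -> differentiable (fun z => k * f z : R^o) y.
  by move=> df; exact: (differentiableZ k df).
have cg0 p q : g0 p = g0 q.
  apply: (chart_constant (g := g0)) => // c y Ac Vy.
  have df j := smooth_differentiable (smooth_pos Q Ac j) Vy.
  have dn j := smooth_differentiable (smooth_nor Q Ac j) Vy.
  have -> : in_chart c g0 = (fun z => a * in_chart c (pos Q 0) z : R^o) + (fun z => b * in_chart c (pos Q 1) z : R^o)
     + ((fun z => (2 * H)^-1 * (a * in_chart c (nor Q 0) z) : R^o) + (fun z => (2 * H)^-1 * (b * in_chart c (nor Q 1) z) : R^o)).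
    by apply/funext => z; rewrite !fctE !in_chartE /g0 -mulrDr [_^-1 * _]mulrC.
  split.
    exact: (differentiableD (differentiableD (dZ _ _ _ (df 0)) (dZ _ _ _ (df 1)))
      (differentiableD (dZ _ _ _ (dZ _ _ _ (dn 0))) (dZ _ _ _ (dZ _ _ _ (dn 1))))).
  move=> v.
  have hf j := smooth_is_derive v (smooth_pos Q Ac j) Vy.
  have hn j := smooth_is_derive v (smooth_nor Q Ac j) Vy.
  rewrite (@derive_val _ _ _ _ _ _ _ (is_deriveD (is_deriveD (hZ a _ _ _ _ (hf 0)) (hZ b _ _ _ _ (hf 1)))
    (is_deriveD (hZ _ _ _ _ _ (hZ a _ _ _ _ (hn 0))) (hZ _ _ _ _ _ (hZ b _ _ _ _ (hn 1)))))).
  have ed := horizontal_normal_derive oQ L0 cmcH dirM Ac v Vy.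
  rewrite in_chart_mu0 subr0 in ed.
  have na' : in_chart c (nor Q 0) y = a * horizontal_norm (param c y) by rewrite in_chartE na.
  have nb' : in_chart c (nor Q 1) y = b * horizontal_norm (param c y) by rewrite in_chartE nb.
  have := cylinder_algebra H0 (rn (param c y)) na' nb' (horizontal_pos_derive oQ Ac v Vy) ed.
  by rewrite -mulrDr [_^-1 * _]mulrC.
have cg1 p q : g1 p = g1 q.
  apply: (chart_constant (g := g1)) => // c y Ac Vy.
  have df := smooth_differentiable (smooth_pos Q Ac ord_max) Vy.
  have dn := smooth_differentiable (smooth_nor Q Ac ord_max) Vy.
  have -> : in_chart c g1 = in_chart c (pos Q ord_max) + (fun z => (2 * H)^-1 * in_chart c (nor Q ord_max) z : R^o).
    by apply/funext => z; rewrite !fctE !in_chartE /g1 [_^-1 * _]mulrC.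
  split; first exact: (differentiableD df (dZ _ _ _ dn)).
  move=> v; have hf := smooth_is_derive v (smooth_pos Q Ac ord_max) Vy.
  have hn := smooth_is_derive v (smooth_nor Q Ac ord_max) Vy.
  rewrite (@derive_val _ _ _ _ _ _ _ (is_deriveD hf (hZ _ _ _ _ _ hn))).
  rewrite (derive_height oQ L0 cmcH dirM Ac v Vy) in_chart_mu0 subr0.
  have cancel (x : R) : x + (2 * H)^-1 * (- (2 * H) * x) = 0 by field.
  exact: cancel.
pose o := frame_vec Q' (g0 p0) (g1 p0) 0.
have u1 : (1 : R) ^+ 2 + 0 ^+ 2 = 1 by rewrite expr1n expr0n addr0.
pose u0 : set_type (annulus setT) := SigSub (mem_set (annulus_polar (I : [set: R] 0) u1)).
exists (revolution_surface (cylinder_profile H0) o oQ' u0); split; first exact: revolution_delaunay.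
apply: part_of_revolution => p; split=> //.
have [s0 s1 _] : [/\ row 0 Q' = frame_vec Q' 1 0 0, row 1 Q' = frame_vec Q' 0 1 0 & row ord_max Q' = frame_vec Q' 0 0 1].
  by rewrite /frame_vec !scale0r !scale1r !addr0 !add0r.
have o0 : dot o (row 0 Q') = g0 p by rewrite /o s0 (dot_frame_vec oQ') (cg0 p0 p); ring.
have o1 : dot o (row 1 Q') = g1 p by rewrite /o s1 (dot_frame_vec oQ') (cg1 p0 p); ring.
rewrite !dotDl !dotNl o0 o1 r0 r1.
rewrite (frame_vec_dot oQ (imm p)) !(dot_frame_vec oQ) -!posE /g0 /g1 sqrrN.
have nu := nor_unit oQ p.
have fin (f0 f1 f2 n0 n1 n2 r : R) : n0 = a * r -> n1 = b * r ->
    n0 * n0 + n1 * n1 + n2 * n2 = 1 ->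
    (f0 * a + f1 * b + f2 * 0 - (a * f0 + b * f1 + (a * n0 + b * n1) / (2 * H))) ^+ 2 +
    (f0 * 0 + f1 * 0 + f2 * 1 - (f2 + n2 / (2 * H))) ^+ 2 = (2 * H)^-1 ^+ 2.
  move=> e0 e1 e2.
  have er : (a * n0 + b * n1) ^+ 2 + n2 ^+ 2 = 1.
    rewrite -e2 e0 e1; transitivity ((a ^+ 2 + b ^+ 2) ^+ 2 * r ^+ 2 + n2 ^+ 2); first by ring.
    by rewrite ab; transitivity ((a ^+ 2 + b ^+ 2) * r ^+ 2 + n2 ^+ 2); [rewrite ab; ring|ring].
  transitivity (((a * n0 + b * n1) ^+ 2 + n2 ^+ 2) * (2 * H)^-1 ^+ 2); first by field.
  by rewrite er mul1r.
exact: (fin _ _ _ _ _ _ _ (na p) (nb p) nu).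
Qed.

End cylindrical.
End classification.

Theorem corollary14 (R : realType) (M : immersed_surface R) (X : 'rV[R]_3)
    (M_connected : connected [set: M])
    (M_direction : canonical_principal_direction M (fun=> X))
    (M_cmc : constant_mean_curvature M) :
  exists S : immersed_surface R, delaunay_surface S /\ part_of M S.
Proof.
have [p0|noM] := pselect (exists p : M, True); last first.
  (* M is empty: any surface will do *)
  have oQ : (1%:M : 'M[R]_3) *m 1%:M^T = 1%:M by rewrite trmx1 mulmx1.
  exists (plane_surface 0 oQ); split; first exact: plane_delaunay.
  by apply: part_of_plane => p; exfalso; apply: noM; exists p.
case: p0 => p0 _.
have X0 : X != 0.
  have [/(_ p0) + _] := M_direction; apply: contra => /eqP ->.
  by rewrite /tangent_part dotE !mxE !mul0r !addr0 scale0r subrr.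
have XX : 0 < dot X X.
  rewrite lt_def dotE -!expr2 !addr_ge0 ?sqr_ge0 // andbT.
  apply: contra X0; rewrite !paddr_eq0 ?addr_ge0 ?sqr_ge0 // !sqrf_eq0.
  move=> /andP[/andP[/eqP h0 /eqP h1] /eqP h2]; apply/eqP/rowP => i; rewrite [RHS]mxE.
  by have [->|->|->] := ord3P i.
pose L := Num.sqrt (dot X X).
have L0 : L != 0 by rewrite gt_eqF // sqrtr_gt0.
have LL : L * L = dot X X by rewrite -expr2 sqr_sqrtr // ltW.
have [|Q oQ QX] := @orthonormal_frame R (L^-1 *: X).
  by rewrite dotZl dotZr -LL; field.
have XE : X = L *: row ord_max Q by rewrite QX scalerA mulfV // scale1r.
rewrite XE in M_direction.
have [H cmcH] := M_cmc.
have [mu0|mu0] := transverse_curvature_zero_or oQ L0 cmcH M_direction M_connected.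
  have [H0|H0] := eqVneq H 0.
    exact: (planar_case M_connected p0 mu0 H0).
  exact: (cylindrical_case M_connected p0 mu0 H0).
exact: (rotational_case M_connected p0 mu0).
Qed.
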